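(* Let $G$ be a group acting geometrically on a CAT(0) cube complex $X$. Then: \begin{itemize} \item for every integer $L \geq 0$, the metric space $(X,\delta_L)$ is $9(L+2)$-hyperbolic; \item for every integer $L \geq 0$, the action $G \curvearrowright (X,\delta_L)$ is non-uniformly acylindrical; \item an isometry $g \in \mathrm{Isom}(X)$ is a contracting isometry of $X$ if and only if it induces a loxodromic isometry of $(X,\delta_L)$ when $L$ is sufficiently large; otherwise, $g$ induces an elliptic isometry of $(X,\delta_L)$ for every integer $L \geq 0$. \end{itemize}
   Context: A CAT(0) cube complex is identified with its one-skeleton, endowed with the combinatorial (graph) distance $d$; ''$x \in X$'' means that $x$ is a vertex, and isometries are cubical automorphisms. Geometric action: properly discontinuous and cocompact. A hyperplane is an equivalence class of edges for the transitive closure of the relation identifying parallel edges of squares; removing it leaves two connected components, its halfspaces. Two distinct hyperplanes are transverse if they contain two non-parallel edges of a common square, and disjoint otherwise. A facing triple is a triple of pairwise disjoint hyperplanes none of which separates the other two. For an integer $L \geq 0$, two disjoint hyperplanes $J_1,J_2$ are $L$-well-separated if every collection of hyperplanes transverse to both $J_1$ and $J_2$ which contains no facing triple has cardinality at most $L$. For $x,y \in X$, $\delta_L(x,y)$ is the maximal number of pairwise $L$-well-separated hyperplanes separating $x$ and $y$; this defines a metric on the vertices of $X$. A metric space $(S,\rho)$ is $\delta$-hyperbolic if $\rho(p,r)+\rho(q,s) \leq \max(\rho(p,q)+\rho(r,s),\rho(p,s)+\rho(q,r))+2\delta$ for all $p,q,r,s \in S$. An action of $G$ on a metric space $(S,\rho)$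 is non-uniformly acylindrical if, for every $\epsilon \geq 0$, there exists $R \geq 0$ such that, for all $x,y \in S$ with $\rho(x,y)\geq R$, the set $\{g \in G \mid \rho(x,gx) \leq \epsilon, \rho(y,gy)\leq \epsilon\}$ is finite. An isometry $g$ of $(S,\rho)$ is loxodromic if $n \mapsto g^n x$ is a quasi-isometric embedding $\mathbb{Z} \to S$ for some (equivalently any) $x\in S$, and elliptic if it has bounded orbits. A subspace $Y$ of a metric space is contracting if there exists $K \geq 0$ such that the nearest-point projection onto $Y$ of any ball disjoint from $Y$ has diameter at most $K$. An isometry $g \in \mathrm{Isom}(X)$ is contracting if there exists $x \in X$ such that $n \mapsto g^n x$ is a quasi-isometric embedding $\mathbb{Z} \to X$ and $\langle g \rangle \cdot x$ is contracting in $(X,d)$. *)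

(* Defs.v *)
From HB Require Import structures.
From Stdlib Require Import Relation_Operators.
From mathcomp Require Import all_boot all_order all_algebra.
From mathcomp Require Import all_classical all_reals.

Set Implicit Arguments.
Unset Strict Implicit.
Unset Printing Implicit Defensive.

Import Order.TTheory GRing.Theory Num.Theory.

Local Open Scope classical_set_scope.
Local Open Scope card_scope.
Local Open Scope ring_scope.

(* The vertices of the n-cube are the functions 'I_n -> {0,1}; a face is
   obtained by freezing the coordinates in S to their values at w. *)
Definition std_face n (S : {set 'I_n}) (w : {ffun 'I_n -> bool}) :
    set {ffun 'I_n -> bool} :=
  [set v | forall i, i \in S -> v i = w i].

(* A cube is represented by its set of vertices. [cube_chart cube c Q] says
   that c identifies the vertices of the standard n-cube with those of Q, and
   the faces of the standard n-cube with the cubes contained in Q. *)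
Definition cube_chart (V : Type) (cube : set (set V)) n
    (c : {ffun 'I_n -> bool} -> V) (Q : set V) : Prop :=
  [/\ injective c,
      Q = range c
    & forall A : set V, A `<=` Q ->
        (cube A <-> exists S w, A = c @` std_face S w)].

(* Complexes in which cubes are embedded and two cubes meet in a common face
   or not at all; every CAT(0) cube complex has these two properties. *)
Record cube_complex := CubeComplex {
  vertex :> Type;
  cube : set (set vertex);
  cube_vertex : forall x, cube [set x];
  cube_model : forall Q, cube Q ->
    exists n (c : {ffun 'I_n -> bool} -> vertex), cube_chart cube c Q;
  cube_meet : forall P Q, cube P -> cube Q ->
    P `&` Q !=set0 -> cube (P `&` Q)
}.

Section CubeComplex.
Variable X : cube_complex.

Definition cube_dim n (Q : set X) : Prop :=
  cube Q /\ exists c : {ffun 'I_n -> bool} -> X, cube_chart (@cube X) c Q.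

Definition edge : set (set X) := cube_dim 1.
Definition square : set (set X) := cube_dim 2.
Definition adj (x y : X) : Prop := edge [set x; y].

Definition is_path (x : X) (p : seq X) : bool :=
  path (fun y z => `[< adj y z >]) x p.

(* The length of a shortest edge path (0 if there is none, which does not
   happen in a connected complex). *)
Definition distn (x y : X) : nat :=
  xget 0%N [set n | (exists p, [/\ is_path x p, last x p = y & size p = n]) /\
    forall p, is_path x p -> last x p = y -> (n <= size p)%N].

(* The simplex of the link of x carried by a cube Q containing x; the edges
   at x are recorded by their other endpoints. *)
Definition link_simplex (x : X) (E : set X) : Prop :=
  exists Q, [/\ cube Q, Q x & E = [set y | Q y /\ adj x y]].

Definition flag_links : Prop :=
  forall (x : X) (E : set X), finite_set E -> E `<=` adj x ->
    (forall y z, E y -> E z -> y <> z -> link_simplex x [set y; z]) ->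
    link_simplex x E.

(* Edge paths are written as the list of all the vertices they visit. *)
Inductive elementary_homotopy : seq X -> seq X -> Prop :=
| backtrack s a b t :
    adj a b -> elementary_homotopy (s ++ [:: a; b; a] ++ t) (s ++ [:: a] ++ t)
| across_square s a b c d t Q :
    square Q -> Q a -> Q b -> Q c -> Q d ->
    adj a b -> adj b c -> adj a d -> adj d c ->
    elementary_homotopy (s ++ [:: a; b; c] ++ t) (s ++ [:: a; d; c] ++ t).

Definition homotopic : seq X -> seq X -> Prop :=
  clos_refl_sym_trans (seq X) elementary_homotopy.

Definition simply_connected : Prop :=
  (forall x y : X, exists2 p, is_path x p & last x p = y) /\
  (forall (x : X) p, is_path x p -> last x p = x -> homotopic (x :: p) [:: x]).

Definition CAT0 : Prop := simply_connected /\ flag_links.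

Definition parallel_in (Q e f : set X) : Prop :=
  [/\ square Q, edge e, edge f, e `<=` Q & f `<=` Q] /\
  (e = f \/ e `&` f = set0).

Definition hyperplane (J : set (set X)) : Prop :=
  exists2 e, edge e &
    J = [set f | clos_refl_trans (set X)
                   (fun e1 e2 => exists Q, parallel_in Q e1 e2) e f].

Definition halfspace (J : set (set X)) (D : set X) : Prop :=
  exists x, D = [set y | clos_refl_trans X
                           (fun a b => adj a b /\ ~ J [set a; b]) x y].

Definition separates (J : set (set X)) (A B : set X) : Prop :=
  exists D1 D2, [/\ halfspace J D1, halfspace J D2, D1 <> D2, A `<=` D1
                  & B `<=` D2].

Definition transverse (J1 J2 : set (set X)) : Prop :=
  J1 <> J2 /\
  exists Q e1 e2,
    [/\ square Q, J1 e1, J2 e2, e1 `<=` Q & e2 `<=` Q] /\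
    ~ parallel_in Q e1 e2.

Definition disjoint_hyp (J1 J2 : set (set X)) : Prop :=
  J1 <> J2 /\ ~ transverse J1 J2.

Definition carrier (J : set (set X)) : set X := \bigcup_(e in J) e.

Definition separates_hyp (J J1 J2 : set (set X)) : Prop :=
  separates J (carrier J1) (carrier J2).

Definition facing_triple (J1 J2 J3 : set (set X)) : Prop :=
  [/\ hyperplane J1, hyperplane J2 & hyperplane J3] /\
  [/\ disjoint_hyp J1 J2, disjoint_hyp J1 J3 & disjoint_hyp J2 J3] /\
  [/\ ~ separates_hyp J1 J2 J3, ~ separates_hyp J2 J1 J3
    & ~ separates_hyp J3 J1 J2].

Definition well_separated (L : nat) (J1 J2 : set (set X)) : Prop :=
  disjoint_hyp J1 J2 /\
  forall H : set (set (set X)),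
    (forall J, H J -> [/\ hyperplane J, transverse J J1 & transverse J J2]) ->
    ~ (exists J J' J'', [/\ H J, H J', H J'' & facing_triple J J' J'']) ->
    H #<= `I_L.

Definition separating_family (L : nat) (x y : X) (H : set (set (set X))) :
    Prop :=
  (forall J, H J -> hyperplane J /\ separates J [set x] [set y]) /\
  (forall J1 J2, H J1 -> H J2 -> J1 <> J2 -> well_separated L J1 J2).

(* The maximum exists since finitely many hyperplanes separate x and y. *)
Definition deltan (L : nat) (x y : X) : nat :=
  xget 0%N [set n | (exists2 H, separating_family L x y H & H #= `I_n) /\
    forall H m, separating_family L x y H -> H #= `I_m -> (m <= n)%N].

Record isom := Isom {
  isom_fun :> X -> X;
  isom_inv : X -> X;
  isom_funK : cancel isom_fun isom_inv;
  isom_invK : cancel isom_inv isom_fun;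
  isom_cube : forall Q : set X, cube (isom_fun @` Q) <-> cube Q
}.

Definition isom_pow (g : isom) (n : int) : X -> X :=
  match n with
  | Posz k => iter k g
  | Negz k => iter k.+1 (isom_inv g)
  end.

Definition is_action (G : groupType) (act : G -> isom) : Prop :=
  (forall x, act 1%g x = x) /\
  (forall g h x, act (g * h)%g x = act g (act h x)).

(* Compact sets meet finitely many open cubes, so proper discontinuity amounts
   to finiteness of [g | g F meets F] for finite sets F of vertices, and
   cocompactness to the existence of finitely many orbits of cubes. *)
Definition properly_discontinuous (G : groupType) (act : G -> isom) : Prop :=
  forall F : set X, finite_set F ->
    finite_set [set g | (act g @` F) `&` F !=set0].

Definition cocompact (G : groupType) (act : G -> isom) : Prop :=
  exists C : set (set X), [/\ finite_set C, C `<=` @cube X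
    & forall Q, cube Q -> exists g P, C P /\ Q = act g @` P].

Definition geometric_action (G : groupType) (act : G -> isom) : Prop :=
  [/\ is_action act, properly_discontinuous act & cocompact act].

End CubeComplex.

Section Metric.
Variable R : realType.

Definition is_metric (S : Type) (rho : S -> S -> R) : Prop :=
  [/\ forall x y, rho x y = 0 <-> x = y,
      forall x y, rho x y = rho y x
    & forall x y z, rho x z <= rho x y + rho y z].

Definition hyperbolic (S : Type) (rho : S -> S -> R) (delta : R) : Prop :=
  is_metric rho /\
  forall p q r s, rho p r + rho q s <=
    Num.max (rho p q + rho r s) (rho p s + rho q r) + 2 * delta.

Definition isometric (S : Type) (rho : S -> S -> R) (f : S -> S) : Prop :=
  bijective f /\ forall x y, rho (f x) (f y) = rho x y.

Definition nonuniformly_acylindrical (G S : Type) (rho : S -> S -> R)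
    (act : G -> S -> S) : Prop :=
  (forall g, isometric rho (act g)) /\
  forall eps : R, 0 <= eps -> exists2 r : R, 0 <= r &
    forall x y, r <= rho x y ->
      finite_set [set g | rho x (act g x) <= eps /\ rho y (act g y) <= eps].

Definition qi_embedding (S T : Type) (rho : S -> S -> R) (sigma : T -> T -> R)
    (f : S -> T) : Prop :=
  exists A B : R, [/\ 1 <= A, 0 <= B & forall s t,
    A^-1 * rho s t - B <= sigma (f s) (f t) <= A * rho s t + B].

Definition distz (m n : int) : R := `|m - n|%:~R.

Definition ball_disjoint_from (S : Type) (rho : S -> S -> R) (Y B : set S) :
    Prop :=
  (exists x r, B = [set y | rho x y <= r]) /\ B `&` Y = set0.

Definition nearest_points (S : Type) (rho : S -> S -> R) (Y : set S) (x : S) :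
    set S :=
  [set y | Y y /\ forall z, Y z -> rho x y <= rho x z].

Definition contracting (S : Type) (rho : S -> S -> R) (Y : set S) : Prop :=
  exists2 K : R, 0 <= K & forall B, ball_disjoint_from rho Y B ->
    forall y z, (\bigcup_(x in B) nearest_points rho Y x) y ->
                (\bigcup_(x in B) nearest_points rho Y x) z -> rho y z <= K.

Variable X : cube_complex.

Definition loxodromic (rho : X -> X -> R) (g : isom X) : Prop :=
  isometric rho g /\
  exists x, qi_embedding distz rho (fun n => isom_pow g n x).

Definition elliptic (rho : X -> X -> R) (g : isom X) : Prop :=
  isometric rho g /\
  forall x, exists B : R,
    forall m n, rho (isom_pow g m x) (isom_pow g n x) <= B.

Definition dist (x y : X) : R := (distn x y)%:R.

Definition delta_dist (L : nat) (x y : X) : R := (deltan L x y)%:R.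

Definition contracting_isom (g : isom X) : Prop :=
  exists x, qi_embedding distz dist (fun n => isom_pow g n x) /\
            contracting dist (range (fun n => isom_pow g n x)).

End Metric.

(* Main.v *)
Require Import Defs.
From Stdlib Require Import Relation_Operators.
From mathcomp Require Import all_boot all_order all_algebra.
From mathcomp Require Import finmap zify.
From mathcomp Require Import all_classical all_reals.

(** The 1-skeleton of the complex is a median graph, and everything else is done
    with its hyperplanes, seen as bipartitions of the vertices.

    That the 1-skeleton is median is proved in the style of the word problem for
    Coxeter groups. A path is reduced if no sequence of flips across squares makes
    it backtrack. The flag condition makes flips confluent ([confP]) and gives an
    exchange condition ([exchange]), so that paths act on classes of reduced paths
    by extension and cancellation. Homotopic paths act in the same way, and simple
    connectivity shows that reduced paths with the same ends are equivalent
    ([good_uniq]): they are the geodesics. This yields the quadrangle condition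
    ([quadrangle]), from which it follows that a hyperplane is the set of edges
    between the vertices closer to one end and those closer to the other end of any
    of its edges ([side_edge]), that the distance counts the separating hyperplanes
    ([size_walls]), that convex sets have gates ([gate]) and that medians exist
    ([median_ex]). Two hyperplanes are transverse exactly when the four quadrants
    they define are nonempty ([transverseP]).

    Hyperbolicity. Along a geodesic [deltan L] is additive up to [L + 2]
    ([deltan_between]). Four points attach to a box whose sides and diagonals are
    separated by hyperplanes splitting the points two by two; hyperplanes splitting
    them differently cross, so that a well-separated family is of a single type and
    the four-point inequality holds in the box without error ([deltan_box]). This
    gives the constant [2 * (L + 2)], below the required [9 * (L + 2)].

    Acylindricity. An element moving two distant points little maps two members of
    a separating family to hyperplanes that again separate these points. The latter
    are finitely many, and the elements with prescribed images of two well-separated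
    hyperplanes form a finite set: the common stabilizer moves a suitable vertex by
    at most [L] ([ws_stab]).

    Contracting isometries. If an orbit of [g] is unbounded for [deltan L], the
    pigeonhole principle gives a hyperplane and a power of [g] mapping one of its
    halfspaces properly into itself, the hyperplane and its image being well-separated
    ([pigeonhole]). The translates of this hyperplane define levels. A geodesic
    crossing consecutive translates passes near the orbit ([med_orb]), so the orbit
    is quasi-isometrically embedded and contracting ([far_contracting]). Conversely,
    along a contracting orbit a nested pair of translates exists because pairwise
    crossing hyperplanes are bounded in number, by Ramsey's theorem. Two distant
    translates of it are well-separated: a large family crossing both without facing
    triples would give two points that are far from the orbit and close to each other,
    but with distant projections to the orbit ([contracts_ws]). The metric [deltan L]
    then grows linearly along the orbit for all large [L] ([level_deltan]). *)

Set Implicit Arguments.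
Unset Strict Implicit.
Unset Printing Implicit Defensive.
Import Order.TTheory GRing.Theory Num.Theory.
Local Open Scope classical_set_scope.

(** * Cubes, squares and the link condition *)

Section Cubes.
Variable X : cube_complex.
Hypothesis flag : flag_links X.
Implicit Types (x y z a b c d : X) (Q : set X).

(** The face of the [n]-cube whose free coordinates are the [io j], the other
    coordinates being those of [v]. *)
Definition cube_emb n k (io : 'I_k -> 'I_n) (v : {ffun 'I_n -> bool})
    (u : {ffun 'I_k -> bool}) : {ffun 'I_n -> bool} :=
  [ffun i => if [pick j | io j == i] is Some j then u j else v i].

Lemma cube_emb_in n k (io : 'I_k -> 'I_n) v u j :
  injective io -> cube_emb io v u (io j) = u j.
Proof.
move=> inj; rewrite ffunE; case: pickP => [j' /eqP/inj -> //|/(_ j)].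
by rewrite eqxx.
Qed.

Lemma cube_emb_out n k (io : 'I_k -> 'I_n) v u i :
  (forall j, io j != i) -> cube_emb io v u i = v i.
Proof.
by move=> h; rewrite ffunE; case: pickP => // j; rewrite (negPf (h j)).
Qed.

(** The faces of a face are faces, so a chart restricts to each face. *)
Lemma subchart n (c : {ffun 'I_n -> bool} -> X) Q k (io : 'I_k -> 'I_n) v :
  injective io -> cube_chart (@cube X) c Q ->
  cube_chart (@cube X) (fun u => c (cube_emb io v u))
    (range (fun u => c (cube_emb io v u))).
Proof.
move=> inj [cinj QE face].
have einj : injective (cube_emb io v).
  move=> u u' e; apply/ffunP => j.
  by rewrite -(cube_emb_in v u j inj) e cube_emb_in.
have sub : range (fun u => c (cube_emb io v u)) `<=` Q.
  by rewrite QE => _ [u _ <-]; exists (cube_emb io v u).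
split=> [u u' /cinj/einj //|//|A sA].
rewrite face; last exact: subset_trans sub.
split=> [[S [w AE]]|[S [w AE]]].
- have [w0 _ /cinj w0E] : range (fun u => c (cube_emb io v u)) (c w).
    by apply: sA; rewrite AE; exists w.
  exists [set j | io j \in S]%SET, w0; rewrite AE; apply/seteqP; split=> _ [x hx <-].
    have [u _ /cinj uE] : range (fun u => c (cube_emb io v u)) (c x).
      by apply: sA; rewrite AE; exists x.
    exists u; last by rewrite uE.
    move=> j; rewrite inE => /hx; rewrite -uE -w0E !cube_emb_in //.
  exists (cube_emb io v x) => // i iS; rewrite -w0E.
  have [j /eqP e|h] := pickP (fun j => io j == i).
    by rewrite -e !cube_emb_in // hx // inE e.
  by rewrite !cube_emb_out // => j; rewrite h.
- exists ([set i | [forall j, io j != i]] :|: (io @: S))%SET, (cube_emb io v w).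
  rewrite AE; apply/seteqP; split=> _ [x hx <-].
    exists (cube_emb io v x) => // i; rewrite !inE => /orP[/forallP h|/imsetP[j jS ->]].
      by rewrite !cube_emb_out.
    by rewrite !cube_emb_in // hx.
  pose u := [ffun j => x (io j)].
  have xE : cube_emb io v u = x.
    apply/ffunP => i; have [j /eqP e|h] := pickP (fun j => io j == i).
      by rewrite -e cube_emb_in // ffunE.
    have hj j : io j != i by rewrite h.
    rewrite cube_emb_out // hx ?cube_emb_out // !inE; apply/orP; left.
    exact/forallP.
  exists u; last by rewrite xE.
  by move=> j jS; rewrite ffunE hx ?cube_emb_in // !inE imset_f ?orbT.
Qed.

Lemma chart_cube n (c : {ffun 'I_n -> bool} -> X) Q :
  cube_chart (@cube X) c Q -> cube Q.
Proof.
move=> [_ QE face]; apply/face => //.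
exists finset.set0, [ffun=> false]; rewrite QE; apply/seteqP; split=> _ [u _ <-];
  by exists u => // i; rewrite inE.
Qed.

Lemma ord1_all (P : 'I_1 -> Prop) : P ord0 -> forall i, P i.
Proof. by move=> h i; rewrite ord1. Qed.

Lemma edgeP (e : set X) : edge e -> exists a b, e = [set a; b] /\ a <> b.
Proof.
move=> [_ [c [inj eE _]]].
exists (c [ffun=> false]), (c [ffun=> true]); split.
  rewrite eE; apply/seteqP; split=> [_ [u _ <-]|_ [|] ->]; last 2 first.
  - by exists [ffun=> false].
  - by exists [ffun=> true].
  by case u0: (u ord0); [right|left]; congr c; apply/ffunP; apply: ord1_all;
    rewrite ffunE.
by move=> /inj /ffunP /(_ ord0); rewrite !ffunE.
Qed.

Lemma adj_sym x y : adj x y -> adj y x.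
Proof. by rewrite /adj setUC. Qed.

Lemma adj_neq x y : adj x y -> x <> y.
Proof.
move=> /edgeP [a [b [e ab]]] xy; apply: ab.
have ha : [set x; y] a by rewrite e; left.
have hb : [set x; y] b by rewrite e; right.
by move: ha hb; rewrite xy /= => -[] -> [] ->.
Qed.

Definition flipc n (i : 'I_n) (v : {ffun 'I_n -> bool}) : {ffun 'I_n -> bool} :=
  [ffun j => if j == i then ~~ v j else v j].

Lemma flipcK n (i : 'I_n) : involutive (flipc i).
Proof. by move=> v; apply/ffunP => j; rewrite !ffunE; case: eqP; rewrite ?negbK. Qed.

Lemma flipcC n (i j : 'I_n) v : flipc i (flipc j v) = flipc j (flipc i v).
Proof. by apply/ffunP => k; rewrite !ffunE; case: eqP; case: eqP. Qed.

Lemma flipc_inj n (i j : 'I_n) v : flipc i v = flipc j v -> i = j.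
Proof.
move=> /ffunP /(_ i); rewrite !ffunE eqxx; case: eqP => // _.
by case: (v i).
Qed.

Lemma flipc_neq n (i : 'I_n) v : flipc i v <> v.
Proof. by move=> /ffunP /(_ i); rewrite !ffunE eqxx; case: (v i). Qed.

Lemma chart_edge n (c : {ffun 'I_n -> bool} -> X) Q v i :
  cube_chart (@cube X) c Q -> adj (c v) (c (flipc i v)).
Proof.
move=> ch; pose io (_ : 'I_1) := i.
have inj : injective io by move=> j j'; rewrite !ord1.
have := subchart v inj ch; set c' := fun u => _.
suff -> : range c' = [set c v; c (flipc i v)].
  by move=> ch'; split; [exact: chart_cube ch'|exists c'].
have e u : cube_emb io v u = if u ord0 == v i then v else flipc i v.
  apply/ffunP => j; case: (j =P i) => [->|/eqP ji].
    rewrite -[X in cube_emb _ _ _ X]/(io ord0) (cube_emb_in v u ord0 inj).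
    by case: eqP => [->//|]; rewrite ffunE eqxx; case: (u _); case: (v _).
  rewrite cube_emb_out; last by move=> k; rewrite /io eq_sym.
  by case: ifP; rewrite ?ffunE // (negPf ji).
apply/seteqP; split=> [_ [u _ <-]|_ [|] ->].
- by rewrite /c' e; case: eqP; [left|right].
- by exists [ffun=> v i]; rewrite // /c' e ffunE eqxx.
- by exists [ffun=> ~~ v i]; rewrite // /c' e ffunE; case: (v i).
Qed.

(** The edge is a face with two vertices, so its ends differ in one coordinate. *)
Lemma edge_chart n (c : {ffun 'I_n -> bool} -> X) Q v v' :
  cube_chart (@cube X) c Q -> adj (c v) (c v') -> exists i, v' = flipc i v.
Proof.
move=> [inj QE face] a.
have vv' : v <> v' by move=> e; apply: (adj_neq a); rewrite e.
have sub : [set c v; c v'] `<=` Q by rewrite QE => _ [|] ->; eexists.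
have [/(_ a.1)[S [w E]] _] := face _ sub.
have hw u : std_face S w u -> u = v \/ u = v'.
  by move=> hu; have [/inj|/inj] : [set c v; c v'] (c u) by [rewrite E; exists u]; auto.
have mem u : u = v \/ u = v' -> std_face S w u.
  move=> hu; have : [set c v; c v'] (c u) by case: hu => ->; [left|right].
  by rewrite E => -[u' h /inj <-].
have hv := mem _ (or_introl erefl); have hv' := mem _ (or_intror erefl).
have /existsP [i ii] : [exists i, v i != v' i].
  apply: contra_notT vv' => /existsPn h; apply/ffunP => i.
  by have := h i; rewrite negbK => /eqP.
exists i; have iS : i \notin S.
  by apply: contraNN ii => iS; rewrite hv // hv'.
have hf : std_face S w (flipc i v).
  move=> j jS; rewrite ffunE; case: eqP => [e|_]; last exact: hv.
  by rewrite -e jS in iS.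
by have [/flipc_neq//|->] := hw _ hf.
Qed.

(** Squares are used through their vertices, listed in cyclic order. *)
Definition sq a b c d : Prop :=
  [/\ adj a b, adj b c, adj c d & adj d a] /\
  [/\ a <> c, b <> d & square [set a; b; c; d]].

Lemma set_square Q a b c d : square Q ->
  (forall z, Q z <-> [\/ z = a, z = b, z = c | z = d]) ->
  square [set a; b; c; d].
Proof.
move=> h e; suff <- : Q = [set a; b; c; d] by [].
apply/seteqP; split=> z /=; rewrite e; first by case; auto.
by move=> [[[]|]|]; [constructor 1|constructor 2|constructor 3|constructor 4].
Qed.

Lemma sq_rev a b c d : sq a b c d -> sq a d c b.
Proof.
move=> [[h1 h2 h3 h4] [h5 h6 h7]]; split; split=> //; try exact: adj_sym.
  exact: nesym.
apply: set_square h7 _ => z; split; first by move=> [[[]|]|]; auto using or4.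
by case=> ->; rewrite /=; tauto.
Qed.

Lemma sq_rot a b c d : sq a b c d -> sq b c d a.
Proof.
move=> [[h1 h2 h3 h4] [h5 h6 h7]]; split; split=> //; first exact: nesym.
apply: set_square h7 _ => z; split; first by move=> [[[]|]|]; auto using or4.
by case=> ->; rewrite /=; tauto.
Qed.

Lemma chart_square n (c : {ffun 'I_n -> bool} -> X) Q v i j :
  cube_chart (@cube X) c Q -> i <> j ->
  sq (c v) (c (flipc i v)) (c (flipc i (flipc j v))) (c (flipc j v)).
Proof.
move=> ch ij; have [cinj QE _] := ch.
pose io (k : 'I_2) := if k == ord0 then i else j.
have ord2 (k : 'I_2) : k = ord0 \/ k = lift ord0 ord0.
  by case: k => [[|[|//]]] ?; [left|right]; exact: val_inj.
have inj : injective io.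
  by move=> k k'; have [] := ord2 k => ->; have [] := ord2 k' => -> //=;
    rewrite /io /= => // /esym.
have := subchart v inj ch; set c' := fun u => _ => ch'.
split; split.
- exact: (chart_edge _ _ ch).
- by rewrite flipcC; exact: (chart_edge _ _ ch).
- by apply: adj_sym; exact: (chart_edge _ _ ch).
- by apply: adj_sym; exact: (chart_edge _ _ ch).
- move=> /cinj /ffunP /(_ i); rewrite !ffunE eqxx; case: eqP => // _.
  by case: (v i).
- by move=> /cinj /flipc_inj.
apply: (@set_square (range c')); first by split; [exact: chart_cube ch'|exists c'].
have e u : cube_emb io v u = (if u ord0 == v i then id else flipc i)
    ((if u (lift ord0 ord0) == v j then id else flipc j) v).
  have fE (b b' : bool) k' w : (if b == b' then id else flipc k') w =
      [ffun k => if k == k' then b (+) b' (+) w k else w k].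
    by apply/ffunP => k; rewrite ffunE; case: b b' => [] [] /=; rewrite ?ffunE;
      case: (k =P k').
  have h0 : cube_emb io v u i = u ord0 := cube_emb_in v u ord0 inj.
  have h1 : cube_emb io v u j = u (lift ord0 ord0) :=
    cube_emb_in v u (lift ord0 ord0) inj.
  have h2 k : k <> i -> k <> j -> cube_emb io v u k = v k.
    move=> ki kj; apply: cube_emb_out => l; rewrite /io.
    by case: ifP => _; apply/eqP => e; [apply: ki|apply: kj].
  rewrite !fE; move: (cube_emb io v u) h0 h1 h2 => W h0 h1 h2.
  apply/ffunP => k; rewrite !ffunE.
  have ji : (i == j) = false by apply/eqP.
  case: (k =P i) => [->|ki]; first by rewrite h0 ji; case: (u _) (v _) => [] [].
  case: (k =P j) => [->|kj]; first by rewrite h1; case: (u _) (v _) => [] [].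
  exact: h2.
move=> z; split=> [[u _ <-]|].
  rewrite /c' e; case: ifP; case: ifP => _ _ /=; first [by constructor 1|by constructor 2|by constructor 3|by constructor 4].
pose u (b b' : bool) : {ffun 'I_2 -> bool} := [ffun k => if k == ord0 then b else b'].
have nb (b : bool) : (~~ b == b) = false by case: b.
case=> ->.
- by exists (u (v i) (v j)); [by []|rewrite /c' e !ffunE /= !eqxx].
- by exists (u (~~ v i) (v j)); [by []|rewrite /c' e !ffunE /= eqxx nb].
- by exists (u (~~ v i) (~~ v j)); [by []|rewrite /c' e !ffunE /= !nb].
- by exists (u (v i) (~~ v j)); [by []|rewrite /c' e !ffunE /= eqxx nb].
Qed.

Lemma squareP Q : square Q -> exists a b c d, sq a b c d /\
  forall z, Q z <-> [\/ z = a, z = b, z = c | z = d].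
Proof.
move=> [_ [c ch]]; have [_ QE _] := ch.
pose o : 'I_2 := ord0; pose l : 'I_2 := lift ord0 ord0.
have := chart_square [ffun=> false] ch (_ : o <> l).
move=> /(_ (fun e => ltac:(by []))); do 4! eexists; split; first eassumption.
move=> z; rewrite QE; split=> [[u _ <-]|]; last by case=> ->; eexists.
have e : u = (if u o then flipc o else id) ((if u l then flipc l else id) [ffun=> false]).
  apply/ffunP => k; have [] : k = o \/ k = l.
    by case: k => [[|[|//]]] ?; [left|right]; exact: val_inj.
  by move=> ->; case: (u o) (u l) => [] []; rewrite /= !ffunE.
  by move=> ->; case: (u o) (u l) => [] []; rewrite /= !ffunE.
by rewrite e; case: (u o) (u l) => [] [] /=; first [by constructor 1|by constructor 2|by constructor 3|by constructor 4].
Qed.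

Lemma chart_corner n (ch : {ffun 'I_n -> bool} -> X) Q a b c :
  cube_chart (@cube X) ch Q -> Q a -> Q b -> Q c -> adj a b -> adj b c -> a <> c ->
  exists u i j, [/\ i <> j, ch u = a, ch (flipc i u) = b & ch (flipc j (flipc i u)) = c].
Proof.
move=> chP; have [_ -> _] := chP; move=> [u _ <-] [v _ <-] [w _ <-].
move=> /(edge_chart chP) [i ->] /(edge_chart chP) [j ->] ac.
by exists u, i, j; split=> // e; apply: ac; rewrite e flipcK.
Qed.

(** The intersection of the two squares is a face with at least three vertices,
    hence is the whole square. *)
Lemma sq_uniq a b c d d' : sq a b c d -> sq a b c d' -> d = d'.
Proof.
move=> s s'; have [[ab bc _ _] [ac _ Sq]] := s; have [[_ _ _ _] [_ _ Sq']] := s'.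
set Q := [set a; b; c; d] in Sq; set Q' := [set a; b; c; d'] in Sq'.
have cQ : cube (Q `&` Q').
  by apply: cube_meet; [case: Sq|case: Sq'|exists a; split; rewrite /Q /Q' /=; tauto].
have sub : Q `<=` Q'.
  have [_ [ch chP]] := Sq; have [inj QE face] := chP.
  have [/(_ cQ)[S [w E]] _] := face _ (@subIsetl _ Q Q').
  have [Qa Qb Qc] : [/\ Q a, Q b & Q c] by split; rewrite /Q /=; tauto.
  have [u [i [j [ij ea eb ec]]]] := chart_corner chP Qa Qb Qc ab bc ac.
  have mem v : [\/ ch v = a, ch v = b | ch v = c] -> std_face S w v.
    move=> hv; have : (Q `&` Q') (ch v) by case: hv => ->; rewrite /Q /Q' /=; tauto.
    by rewrite E => -[v' h /inj <-].
  have hb := mem _ (Or32 _ _ eb).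
  have Si : i \notin S.
    apply/negP => iS; have := mem _ (Or31 _ _ ea) i iS.
    by rewrite -(hb i iS) ffunE eqxx; case: (u i).
  have Sj : j \notin S.
    apply/negP => jS; have := hb j jS.
    by rewrite -(mem _ (Or33 _ _ ec) j jS) [RHS]ffunE eqxx; case: (flipc i u j).
  have hS k : k \notin S.
    have [-> //|-> //] : k = i \/ k = j.
    case: i j k {eb ec hb Si Sj} ij => [[|[|//]]] ? [[|[|//]]] ? [[|[|//]]] ? // ij;
      by [left; exact: val_inj|right; exact: val_inj|case: ij; exact: val_inj].
  rewrite QE => _ [v _ <-]; suff : (Q `&` Q') (ch v) by case.
  by rewrite E; exists v => // k kS; have := hS k; rewrite kS.
have [[[dd|dd]|dd]|//] : Q' d by apply: sub; right.
- by case: s => [[_ _ _ /adj_neq h] _]; case: h.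
- by case: s => [_ [_ h _]]; case: h.
- by case: s => [[_ _ /adj_neq h _] _]; case: h.
Qed.

Lemma square_corner Q a b c d : square Q -> Q a -> Q b -> Q c -> Q d ->
  adj a b -> adj b c -> adj a d -> adj d c -> a <> c -> b <> d -> sq a b c d.
Proof.
move=> SQ Qa Qb Qc Qd ab bc ad dc ac bd.
split; split=> //; try exact: adj_sym.
apply: (set_square SQ) => z; split; last by case=> ->.
have [p [q [r [s [_ E]]]]] := squareP SQ.
move: Qa Qb Qc Qd (adj_neq ab) (adj_neq bc) (adj_neq ad) (adj_neq dc) ac bd.
rewrite !E => {E} {ab bc ad dc}.
case=> ->; case=> ->; case=> ->; case=> -> *; try contradiction;
  match goal with h : or4 _ _ _ _ |- _ => case: h => -> end;
  first [by constructor 1|by constructor 2|by constructor 3|by constructor 4].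
Qed.

(** The two ends of a diagonal differ in two coordinates. *)
Lemma sq_ndiag a b c d : sq a b c d -> ~ adj a c.
Proof.
move=> [[ab bc _ _] [ac _ [_ [ch chP]]]]; have [inj QE _] := chP.
have [Qa Qb Qc] : [/\ [set a; b; c; d] a, [set a; b; c; d] b & [set a; b; c; d] c].
  by split; rewrite /=; tauto.
have [ua [i [j [ij ea _ ec]]]] := chart_corner chP Qa Qb Qc ab bc ac.
rewrite -ea -ec => /(edge_chart chP) [k] /ffunP E.
have := E i; have := E j; rewrite !ffunE !eqxx.
have -> : (i == j) = false by apply/eqP.
have -> : (j == i) = false by apply/eqP => /esym.
case: eqP => [<-|_]; last by case: (ua j).
by case: eqP => [//|_]; case: (ua i).
Qed.

(** The flag condition at [v]: the three neighbours pairwise span squares, so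
    they lie in a common cube; [s] is opposite to [v] in the 3-cube they span. *)
Lemma sq_cube v x y z xy xz yz :
  sq v x xy y -> sq v x xz z -> sq v y yz z ->
  exists s, [/\ sq s xy x xz, sq s xy y yz & sq s xz z yz].
Proof.
move=> s1 s2 s3; have [[vx _ _ yv] [vxy xy' S1]] := s1.
have [[_ _ _ zv] [vxz xz' S2]] := s2; have [[_ _ _ _] [vyz yz' S3]] := s3.
have lk p q r : sq v p q r -> link_simplex v [set p; r].
  move=> S; have [[h1 h2 h3 h4] [h5 h6 h7]] := S.
  exists [set v; p; q; r]; split; first by case: h7.
    by rewrite /=; tauto.
  apply/seteqP; split=> [t [] ->|t [/= H a]]; first 2 last.
  - case: H a => [[[->|->]|->]|->] a; [| by left | | by right].
      by case: (adj_neq a).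
    by case: (sq_ndiag S).
  - by split=> //=; tauto.
  - by split=> /=; [tauto|exact: adj_sym].
have sub : [set x; y; z] `<=` adj v.
  by move=> t [[]|] -> //; exact: adj_sym.
have [Q [cQ Qv EQ]] : link_simplex v [set x; y; z].
  have fin : finite_set [set x; y; z] by exact: finite_set3.
  apply: (@flag v _ fin sub).
  have C p q : link_simplex v [set p; q] -> link_simplex v [set q; p].
    by rewrite setUC.
  move=> p q [[->|->]|->] [[->|->]|->] // _;
    first [by apply: lk; eassumption|by apply/C/lk; eassumption].
have [n [c ch]] := cube_model cQ; have [inj QE _] := ch.
have [v0 e0] : exists v0, c v0 = v by move: Qv; rewrite QE => -[v0 _ <-]; exists v0.
have dir p : [set x; y; z] p -> exists i, p = c (flipc i v0).
  rewrite EQ QE => -[[u _ <-]]; rewrite -e0 => /(edge_chart ch) [i ->].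
  by exists i.
have [i ei] : exists l, x = c (flipc l v0) by apply: dir; left; left.
have [j ej] : exists l, y = c (flipc l v0) by apply: dir; left; right.
have [k ek] : exists l, z = c (flipc l v0) by apply: dir; right.
have ij : i <> j by move=> h; apply: xy'; rewrite ei ej h.
have ik : i <> k by move=> h; apply: xz'; rewrite ei ek h.
have jk : j <> k by move=> h; apply: yz'; rewrite ej ek h.
have far p q r l m : sq v p q r -> p = c (flipc l v0) -> r = c (flipc m v0) ->
    l <> m -> q = c (flipc l (flipc m v0)).
  move=> S ep er lm; apply/esym/(@sq_uniq r v p).
    by rewrite -e0 ep er; apply/sq_rot/sq_rot/sq_rot; exact: (chart_square _ ch lm).
  exact/sq_rot/sq_rot/sq_rot.
rewrite (far _ _ _ _ _ s1 ei ej ij) (far _ _ _ _ _ s2 ei ek ik).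
rewrite (far _ _ _ _ _ s3 ej ek jk) ei ej ek.
exists (c (flipc i (flipc j (flipc k v0)))).
split; apply/sq_rot/sq_rot.
- rewrite (flipcC i k v0) (flipcC i j (flipc k v0)) (flipcC i k v0).
  rewrite (flipcC j k (flipc i v0)) (flipcC i j v0).
  exact: (chart_square _ ch (nesym jk)).
- rewrite (flipcC j k v0) (flipcC i k (flipc j v0)); exact: (chart_square _ ch (nesym ik)).
- rewrite (flipcC i j (flipc k v0)); exact: (chart_square _ ch (nesym ij)).
Qed.

Lemma parallel_inP (Q e f : set X) : parallel_in Q e f -> e = f \/
  exists a b c d, [/\ sq a b c d, e = [set a; b] & f = [set d; c]].
Proof.
move=> [[SQ Ee Ef eQ fQ] [->|ef]]; first by left.
right; have [p [q [r [s [S E]]]]] := squareP SQ.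
have [a [b [eE ab]]] := edgeP Ee; have [c [d [fE cd]]] := edgeP Ef.
have [Qa Qb] : Q a /\ Q b by split; apply: eQ; rewrite eE; [left|right].
have [Qc Qd] : Q c /\ Q d by split; apply: fQ; rewrite fE; [left|right].
have dis u : e u -> f u -> False by move=> h h'; have : (e `&` f) u by []; rewrite ef.
have n1 : a <> c by move=> h; apply: (dis a); rewrite ?eE ?fE ?h; [left|left].
have n2 : a <> d by move=> h; apply: (dis a); rewrite ?eE ?fE ?h; [left|right].
have n3 : b <> c by move=> h; apply: (dis b); rewrite ?eE ?fE ?h; [right|left].
have n4 : b <> d by move=> h; apply: (dis b); rewrite ?eE ?fE ?h; [right|right].
have aab : adj a b by rewrite /adj -eE.
have acd : adj c d by rewrite /adj -fE.
have S1 := sq_rev S; have S2 := sq_rot S; have S3 := sq_rot S2.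
have S4 := sq_rot S3; have S5 := sq_rot S1; have S6 := sq_rot S5.
have S7 := sq_rot S6.
have nd1 := sq_ndiag S; have nd2 := sq_ndiag S2.
have nd3 := sq_ndiag S3; have nd4 := sq_ndiag S4.
have C u w : [set u; w] = [set w; u] :> set X by rewrite setUC.
have [S'|S'] : sq a b c d \/ sq a b d c.
- move=> {eE fE}; move: n1 n2 n3 n4 aab acd ab cd.
  move: Qa Qb Qc Qd; rewrite !E => {E}; case=> ->; case=> ->; case=> ->; case=> -> => *;
  first [contradiction|left; assumption|right; assumption].
- by exists a, b, c, d; split=> //; rewrite C.
- by exists a, b, d, c.
Qed.

Lemma parallel_sq a b c d : sq a b c d ->
  parallel_in [set a; b; c; d] [set a; b] [set d; c].
Proof.
move=> [[ab bc cd da] [ac bd SQ]]; split.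
  split=> //; first exact: adj_sym.
    by move=> z [] -> /=; tauto.
  by move=> z [] -> /=; tauto.
right; apply/seteqP; split=> // z [[] -> []] h.
- by case: (adj_neq da).
- by case: ac.
- by case: bd.
- by case: (adj_neq bc).
Qed.

End Cubes.

(** * Reduced edge paths *)

Section Paths.
Variable X : cube_complex.
Hypothesis flag : flag_links X.
Implicit Types (x y z a b c d w : X) (p q r s t l : seq X).

(** Edge paths are lists of vertices. The moves and the extensions take place at
    the head of the list, so a path from a base vertex to [x] is a list with head
    [x] that ends at the base vertex. *)
Inductive flip : seq X -> seq X -> Prop :=
| flip_here a b c d t : sq a b c d -> flip [:: a, b, c & t] [:: a, d, c & t]
| flip_cons x p q : flip p q -> flip (x :: p) (x :: q).

Inductive eqv p : seq X -> Prop :=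
| eqv_refl : eqv p p
| eqv_step q r : eqv p q -> flip q r -> eqv p r.

Inductive has_bt : seq X -> Prop :=
| bt_here a b t : has_bt [:: a, b, a & t]
| bt_cons x p : has_bt p -> has_bt (x :: p).

Fixpoint walk p : Prop :=
  if p is x :: q then (if q is y :: _ then adj x y else True) /\ (q <> [::] -> walk q)
  else False.

(** Reduced paths; they turn out to be the geodesics. *)
Definition good p : Prop := walk p /\ forall q, eqv p q -> ~ has_bt q.

Lemma flip_sym p q : flip p q -> flip q p.
Proof. by elim=> *; [apply/flip_here/sq_rev|apply: flip_cons]. Qed.

Lemma eqv_trans p q r : eqv p q -> eqv q r -> eqv p r.
Proof. by move=> pq; elim=> // q' r' _ h; exact: eqv_step. Qed.

Lemma eqv1 p q : flip p q -> eqv p q.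
Proof. by move=> h; apply: eqv_step h; exact: eqv_refl. Qed.

Lemma eqv_sym p q : eqv p q -> eqv q p.
Proof.
elim=> [|q' r _ IH /flip_sym/eqv1 h]; first exact: eqv_refl.
exact: eqv_trans h IH.
Qed.

Lemma eqv_cons x p q : eqv p q -> eqv (x :: p) (x :: q).
Proof.
elim=> [|q' r _ IH h]; first exact: eqv_refl.
by apply: eqv_step IH _; exact: flip_cons.
Qed.

Lemma eqv_sq a b c d t : sq a b c d -> eqv [:: a, b, c & t] [:: a, d, c & t].
Proof. by move=> h; exact/eqv1/flip_here. Qed.

Lemma flip_inv p q : flip p q ->
  [/\ size p = size q, ohead p = ohead q & forall x, last x p = last x q].
Proof.
by elim=> [//|x p' q' h [e0 e1 e2]]; split=> [/=|//|y /=]; rewrite ?e0 ?e2.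
Qed.

Lemma eqv_inv p q : eqv p q ->
  [/\ size p = size q, ohead p = ohead q & forall x, last x p = last x q].
Proof.
elim=> [//|q' r _ [-> -> e] /flip_inv [-> -> e']]; split=> // x.
by rewrite e e'.
Qed.

Lemma eqv_head x y p q : eqv (x :: p) (y :: q) -> x = y.
Proof. by move=> /eqv_inv [_ [->]]. Qed.

Lemma flip_walk p q : flip p q -> walk p -> walk q.
Proof.
elim=> [a b c d t|x p' q' h IH [h1 h2]].
  move=> [[ab bc cd da] _] [_ /(_ _)[//|_ /(_ _)[//|h1 h2]]].
  split; first exact: adj_sym.
  move=> _; split; first exact: adj_sym.
  by move=> _; split.
have [_ eh _] := flip_inv h.
have nq : p' <> [::] by case: h.
split; last by move=> _; exact/IH/h2.
by case: p' q' eh h1 {h IH h2 nq} => [|a p'] [|b q'] //= [->].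
Qed.

Lemma eqv_walk p q : eqv p q -> walk p -> walk q.
Proof. by elim=> // q' r _ IH /flip_walk h /IH/h. Qed.

Lemma good_eqv p q : eqv p q -> good p -> good q.
Proof.
move=> e [w h]; split; first exact: eqv_walk w.
by move=> r /(eqv_trans e)/h.
Qed.

Lemma good_behead x y p : good [:: x, y & p] -> good (y :: p).
Proof.
move=> [[_ w] h]; split; first exact: w.
by move=> q /(eqv_cons x)/h nb /(bt_cons x)/nb.
Qed.

Lemma good_adj x y p : good [:: x, y & p] -> adj x y.
Proof. by move=> [[]]. Qed.

Lemma good_nbt a b t : ~ good [:: a, b, a & t].
Proof. by move=> [_ /(_ _ (eqv_refl _))]; apply; exact: bt_here. Qed.

(** How equivalent reduced paths [x :: p] and [x :: q] may differ at their end;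
    see [confP]. *)
Definition conf x p q : Prop := eqv p q \/
  exists y z w r, [/\ eqv p [:: y, w & r], eqv q [:: z, w & r] & sq x y w z].

Lemma flip_split x p l : flip (x :: p) l -> exists2 q, l = x :: q &
  flip p q \/ exists y z w r, [/\ p = [:: y, w & r], q = [:: z, w & r] & sq x y w z].
Proof.
move E : (x :: p) => k h; case: h E => [a b c d t S [-> ->]|x' p' q' h [-> ->]].
  by exists [:: d, c & t] => //; right; exists b, d, c, t.
by exists q' => //; left.
Qed.

Lemma conf_eqv x p q q' : conf x p q -> eqv q q' -> conf x p q'.
Proof.
move=> [h|[y [z [w [r [h1 h2 h3]]]]]] e; [left|right].
  exact: eqv_trans h e.
by exists y, z, w, r; split=> //; apply: eqv_trans h2; exact: eqv_sym.
Qed.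

(** Transitivity of the second alternative of [conf]: two squares at [x]
    either coincide or, with the square below them, span a 3-cube. *)
Lemma conf_step x p y2 y3 w' r' :
  (forall q, eqv [:: y2, w' & r'] (y2 :: q) -> conf y2 (w' :: r') q) ->
  conf x p [:: y2, w' & r'] -> sq x y2 w' y3 -> conf x p [:: y3, w' & r'].
Proof.
move=> C [h|[y1 [y2' [w [r [h1 h2 S]]]]]] S'.
  by right; exists y2, y3, w', r'; split=> //; exact: eqv_refl.
have e := eqv_head h2; subst y2'.
case: (C _ h2) => [e|[b [c [t [u [e1 e2 S2]]]]]].
  have ew := eqv_head e; subst w'.
  have -> : y3 = y1.
    apply: (@sq_uniq _ w y2 x); first exact/sq_rot/sq_rot/sq_rev.
    exact/sq_rot/sq_rot.
  by left; apply: eqv_trans h1 _; apply/eqv_cons/eqv_sym.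
have eb := eqv_head e1; subst b; have ec := eqv_head e2; subst c.
have [s [s1 s2 s3]] := sq_cube flag S2 (sq_rot S') (sq_rot (sq_rev S)).
right; exists y1, y3, s, (t :: u); split.
- apply: eqv_trans h1 _; apply: eqv_trans (eqv_cons _ e2) _.
  exact/eqv_sq/sq_rot/sq_rev.
- apply: eqv_trans (eqv_cons _ e1) _.
  exact/eqv_sq/sq_rot/sq_rev.
- exact/sq_rot/sq_rot.
Qed.

(** By induction on the length, [conf] absorbs every flip of a chain of flips
    leading from [x :: p] to [x :: q]. *)
Lemma confP x p q : good (x :: p) -> eqv (x :: p) (x :: q) -> conf x p q.
Proof.
move: {2}(size p) (leqnn (size p)) => n.
elim: n x p q => [|n IH] x p q sp g e.
  have [+ _ _] := eqv_inv e.
  by case: p q sp {g e} => // -[] // _ _; left; exact: eqv_refl.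
suff H l : eqv (x :: p) l -> exists2 q', l = x :: q' & conf x p q'.
  by have [q' [->]] := H _ e.
clear e q; elim=> [|l1 l' e [q E c]]; first by exists p => //; left; exact: eqv_refl.
subst l1; move=> /flip_split [q' -> h].
exists q' => //; case: h => [/eqv1 h|]; first exact: conf_eqv h.
move=> [y2 [y3 [w [r [? ? S]]]]]; subst q q'.
apply: conf_step c S => q e'; apply: IH => //; last exact/good_behead/(good_eqv e).
by have [/= [E'] _ _] := eqv_inv e; move: sp; rewrite E'.
Qed.

(** Cancellation: the second alternative of [conf] requires different heads. *)
Lemma eqv_behead x y p q :
  good [:: x, y & p] -> eqv [:: x, y & p] [:: x, y & q] -> eqv (y :: p) (y :: q).
Proof.
move=> g /(confP g)[//|[b [c [t [u [e1 e2 S]]]]]].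
have eb := eqv_head e1; have ec := eqv_head e2; subst b c.
by case: S => _ [].
Qed.

(** The exchange condition of Coxeter groups, for paths. Along a chain of flips
    from [y :: x :: p], either the part below [y] stays reduced, or a square at
    the end of [x :: p] allows this path to be rewritten so that its last edge
    comes from [y]. *)
Lemma exchange x p y : good (x :: p) -> adj x y ->
  (exists q, eqv (x :: p) [:: x, y & q]) \/ good [:: y, x & p].
Proof.
move: {2}(size p) (leqnn (size p)) => n.
elim: n x p y => [|n IH] x p y sp g a.
  right; case: p sp g => // _ g; split; first by split; [exact: adj_sym|].
  move=> q e; have [+ _ _] := eqv_inv e.
  by case: q {e} => [|? [|? [|? ?]]] // _ h; inversion h as [|? ? h1]; inversion h1 as [|? ? h2]; inversion h2.
have [?|nex] := pselect (exists q, eqv (x :: p) [:: x, y & q]); [by left|right].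
have H l : eqv [:: y, x & p] l ->
    exists b : seq X, [/\ l = y :: b, conf y (x :: p) b & good b].
  elim=> [|l1 l' e [b [E c gb]]].
    by exists (x :: p); split=> //; left; exact: eqv_refl.
  subst l1; move=> /flip_split [b' -> h].
  exists b'; split=> //; case: h => [/eqv1 h|[y1 [y2 [w [r [? ? S]]]]]].
  - exact: conf_eqv h.
  - by subst; apply: conf_step c S => q; exact: confP.
  - exact: good_eqv gb.
  have : conf y (x :: p) b' by subst; apply: conf_step c S => q; exact: confP.
  move=> [h|[x1 [v [w1 [u [e1 e2 S1]]]]]]; first exact: good_eqv g.
  have ex := eqv_head e1; subst x1.
  have g1 := good_eqv e1 g; have g2 := good_behead g1.
  have aw : adj w1 v by case: S1 => -[].
  have su : size u <= n.
    have [/= [E'] _ _] := eqv_inv e1.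
    by move: sp; rewrite E'.
  have [[q e3]|g3] := IH w1 u v su g2 aw.
  - case: nex; exists (v :: q); apply: eqv_trans e1 _.
    apply: eqv_trans (eqv_cons _ e3) _.
    exact/eqv_sq/sq_rot.
  - exact: good_eqv (eqv_sym e2) g3.
split; first by split; [exact: adj_sym|case: g].
move=> l /H [b [-> c gb]] h; inversion h as [a' v r E1|? ? hb]; subst; last first.
  by case: gb => _ /(_ _ (eqv_refl _)).
case: c => [e|[x1 [z [w [r1 [e1 e2 S]]]]]].
  by apply: nex; exists r; have ex := eqv_head e; subst v.
have ex := eqv_head e1; have ez := eqv_head e2; subst x1 z.
case: (confP gb e2) => [e|[b1 [b2 [t [u [e3 e4 S1]]]]]].
  by have E := eqv_head e; case: S => _ []; rewrite E.
have ? := eqv_head e3; have ? := eqv_head e4; subst b1 b2.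
have E : x = t.
  apply: (@sq_uniq _ y v w); first exact: sq_rev.
  exact/sq_rot/sq_rot/sq_rot/sq_rev.
subst t; apply: (@good_nbt x w u); apply: good_eqv g.
by apply: eqv_trans e1 _; exact: eqv_cons.
Qed.

(** Simple connectivity enters through an action of all paths on equivalence
    classes of reduced paths: following an edge extends the reduced path or
    cancels its last edge, and homotopic paths act in the same way. *)
Definition follow p y : seq X :=
  if pselect (exists q, if p is x :: _ then eqv p [:: x, y & q] else False)
  is left h then y :: projT1 (cid h) else y :: p.

Lemma follow_back x p y q : good (x :: p) -> eqv (x :: p) [:: x, y & q] ->
  eqv (follow (x :: p) y) (y :: q).
Proof.
move=> g e; rewrite /follow; case: pselect => [h|]; last by case; exists q.
case: cid => q' /= e'; apply: (@eqv_behead x); first exact: good_eqv e' g.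
exact: eqv_trans (eqv_sym e') e.
Qed.

Lemma follow_fwd x p y : good [:: y, x & p] -> follow (x :: p) y = [:: y, x & p].
Proof.
move=> g; rewrite /follow; case: pselect => // -[q e]; exfalso.
by apply: (@good_nbt y x q); apply: good_eqv g; exact: eqv_cons.
Qed.

Lemma followP x p y : good (x :: p) -> adj x y ->
  (exists q, [/\ good (y :: q), eqv (x :: p) [:: x, y & q]
                & eqv (follow (x :: p) y) (y :: q)]) \/
  (good [:: y, x & p] /\ follow (x :: p) y = [:: y, x & p]).
Proof.
move=> g /(exchange g)[[q e]|g']; [left|by right; rewrite follow_fwd].
exists q; split=> //; last exact: follow_back.
exact/good_behead/(good_eqv e).
Qed.

Lemma follow_cons p y : exists q, follow p y = y :: q.
Proof. by rewrite /follow; case: pselect => *; eexists. Qed.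

Lemma follow_good x p y : good (x :: p) -> adj x y -> good (follow (x :: p) y).
Proof.
move=> g /(followP g)[[q [g' _ e]]|[g' -> //]].
exact: good_eqv (eqv_sym e) g'.
Qed.

Lemma follow_eqv x p p' y : good (x :: p) -> adj x y -> eqv (x :: p) (x :: p') ->
  eqv (follow (x :: p) y) (follow (x :: p') y).
Proof.
move=> g a e; have g' := good_eqv e g.
have [[q [gq e1 e2]]|[g1 ->]] := followP g a.
  apply: eqv_trans e2 _; apply/eqv_sym/follow_back => //.
  exact: eqv_trans (eqv_sym e) e1.
rewrite follow_fwd; first exact: eqv_cons.
by apply: good_eqv g1; exact: eqv_cons.
Qed.

Lemma followK x p y : good (x :: p) -> adj x y ->
  eqv (follow (follow (x :: p) y) x) (x :: p).
Proof.
move=> g a; have [[q [gq e1 e2]]|[g1 ->]] := followP g a; last first.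
  by apply: follow_back => //; exact: eqv_refl.
have [q' E] := follow_cons (x :: p) y; rewrite E in e2 *.
apply: eqv_trans (eqv_sym e1).
apply: eqv_trans (follow_eqv _ (adj_sym a) e2) _; first exact: good_eqv (eqv_sym e2) gq.
rewrite follow_fwd; first exact: eqv_refl.
exact: good_eqv g.
Qed.

(** If [b] retraces an edge of the path and [d] extends it, then passing the
    square makes [c] retrace an edge on the second route. *)
Lemma follow_sq1 a b c d p q : good (a :: p) -> sq a b c d ->
  eqv (a :: p) [:: a, b & q] -> good [:: d, a & p] ->
  eqv (follow (follow (a :: p) b) c) (follow (follow (a :: p) d) c).
Proof.
move=> g S e gd; have [[ab bc cd da] _] := S.
rewrite (follow_fwd gd).
have e1 : eqv [:: d, a & p] [:: d, c, b & q].
  by apply: eqv_trans (eqv_cons _ e) _; exact/eqv_sq/sq_rot/sq_rot/sq_rot.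
have gc := good_eqv e1 gd.
have e2 := follow_back g e; have [q' E] := follow_cons (a :: p) b.
rewrite E in e2 *; have gb := good_behead gc.
have gb' := good_behead gb; have g' := good_eqv (eqv_sym e2) gb'.
apply: eqv_trans (follow_eqv g' bc e2) _.
rewrite (follow_fwd gb); apply: eqv_sym; exact: follow_back.
Qed.

(** If [c] retraced an edge of [b :: a :: p], the square below it would be the
    square [a b c d], and [d] would retrace an edge of [a :: p]. *)
Lemma follow_fwd2 a b c d p : sq a b c d -> good [:: b, a & p] ->
  good [:: d, a & p] -> good [:: c, b, a & p].
Proof.
move=> S gb gd; have [[ab bc cd da] [ac bd _]] := S.
have [[q e]|//] := exchange gb bc.
case: (confP gb e) => [e'|[b1 [b2 [t [u [e3 e4 S1]]]]]].
  by case: ac; exact: eqv_head e'.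
have ? := eqv_head e3; have ? := eqv_head e4; subst b1 b2.
have E : d = t.
  apply: (@sq_uniq _ c b a); first exact/sq_rot/sq_rot/sq_rev.
  exact/sq_rot/sq_rot/sq_rot.
subst t; exfalso; apply: (@good_nbt d a u); apply: good_eqv gd.
exact: eqv_cons.
Qed.

Lemma follow_sq a b c d p : good (a :: p) -> sq a b c d ->
  eqv (follow (follow (a :: p) b) c) (follow (follow (a :: p) d) c).
Proof.
move=> g S; have [[ab bc cd da] [ac bd _]] := S.
have [[q [gq e1 e2]]|[gb Eb]] := followP g ab; last first.
  have [[q [gq e1 e2]]|[gd Ed]] := followP g (adj_sym da).
    by apply: eqv_sym; apply: follow_sq1 e1 gb => //; exact: sq_rev.
  have gcb := follow_fwd2 S gb gd; have gcd := follow_fwd2 (sq_rev S) gd gb.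
  rewrite Eb Ed !follow_fwd //.
  exact/eqv_sq/sq_rot/sq_rot/sq_rev.
have [[q' [gq' e1' e2']]|[gd Ed]] := followP g (adj_sym da); last first.
  exact: follow_sq1 e1 gd.
have e := eqv_trans (eqv_sym e1) e1'.
case: (confP (good_eqv e1 g) e) => [e'|[b1 [b2 [t [u [e3 e4 S1]]]]]].
  by case: bd; exact: eqv_head e'.
have ? := eqv_head e3; have ? := eqv_head e4; subst b1 b2.
have E : c = t.
  apply: (@sq_uniq _ d a b); first exact/sq_rot/sq_rot/sq_rot.
  exact/sq_rot/sq_rot/sq_rot.
subst t.
have back v s : good (v :: s) -> eqv (follow (a :: p) v) (v :: s) -> adj v c ->
    eqv (v :: s) [:: v, c & u] -> eqv (follow (follow (a :: p) v) c) (c :: u).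
  move=> gv ev av es; have [k E] := follow_cons (a :: p) v; rewrite E in ev *.
  by apply: follow_back; [exact: good_eqv (eqv_sym ev) gv|exact: eqv_trans ev es].
apply: eqv_trans (back _ _ gq e2 bc e3) _; apply: eqv_sym.
exact: back gq' e2' (adj_sym cd) e4.
Qed.

Lemma is_path_cons x y l : is_path x (y :: l) <-> adj x y /\ is_path y l.
Proof. by rewrite /is_path /=; split=> [/andP[/asboolP]|[/asboolP -> ->]]. Qed.

Lemma foldl_follow_good x p l : good (x :: p) -> is_path x l ->
  exists2 q, foldl follow (x :: p) l = last x l :: q & good (last x l :: q).
Proof.
elim: l x p => [|y l IH] x p g; first by exists p.
move=> /is_path_cons [a h] /=; have g' := follow_good g a.
have [q E] := follow_cons (x :: p) y; rewrite E in g' *.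
exact: IH.
Qed.

Lemma foldl_follow_eqv x p p' l : good (x :: p) -> is_path x l ->
  eqv (x :: p) (x :: p') -> eqv (foldl follow (x :: p) l) (foldl follow (x :: p') l).
Proof.
elim: l x p p' => [//|y l IH] x p p' g /is_path_cons [a h] e /=.
have := follow_eqv g a e; have g' := follow_good g a.
have [q E] := follow_cons (x :: p) y; have [q' E'] := follow_cons (x :: p') y.
rewrite E E' in g' * => e'; exact: IH.
Qed.

Lemma foldl_follow_inj x p p' l : good (x :: p) -> good (x :: p') -> is_path x l ->
  eqv (foldl follow (x :: p) l) (foldl follow (x :: p') l) -> eqv (x :: p) (x :: p').
Proof.
elim: l x p p' => [//|y l IH] x p p' g g' /is_path_cons [a h] /= e.
have gy := follow_good g a; have gy' := follow_good g' a.
have := followK g a; have := followK g' a.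
have [q E] := follow_cons (x :: p) y; have [q' E'] := follow_cons (x :: p') y.
rewrite E E' in gy gy' e * => h2 h1.
apply: eqv_trans (eqv_sym h1) _; apply: eqv_trans h2.
apply: follow_eqv => //; [exact: adj_sym|exact: IH e].
Qed.

Definition run l : seq X := if l is x :: l' then foldl follow [:: x] l' else [::].
Definition is_path_list l : bool := if l is x :: l' then is_path x l' else true.

Lemma good1 x : good [:: x].
Proof.
split=> // q e; have [+ _ _] := eqv_inv e.
by case: q {e} => [|? [|? ?]] // _ h; inversion h as [|? ? h1]; inversion h1.
Qed.

Lemma run_cat s a t : run (s ++ a :: t) = foldl follow (run (rcons s a)) t.
Proof. by case: s => [//|x s] /=; rewrite -cat_rcons foldl_cat. Qed.

Lemma path_list_cat s a t :
  is_path_list (s ++ a :: t) = is_path_list (rcons s a) && is_path a t.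
Proof.
case: s => [//|x s] /=; rewrite -cat_rcons /is_path cat_path.
by rewrite last_rcons.
Qed.

Lemma run_good s a : is_path_list (rcons s a) ->
  exists2 q, run (rcons s a) = a :: q & good (a :: q).
Proof.
case: s => [_|x s] /=; first by exists [::] => //; exact: good1.
by move=> h; have [q] := foldl_follow_good (good1 x) h; rewrite last_rcons; exists q.
Qed.

Lemma run_homotopy1 l l' : elementary_homotopy l l' ->
  is_path_list l = is_path_list l' /\ (is_path_list l -> eqv (run l) (run l')).
Proof.
case=> [s a b t ab|s a b c d t Q SQ Qa Qb Qc Qd ab bc ad dc].
  have pE : is_path_list (s ++ [:: a; b; a] ++ t) = is_path_list (s ++ [:: a] ++ t).
    rewrite !cat_cons !path_list_cat; congr (_ && _).
    apply/idP/idP => [/is_path_cons [_ /is_path_cons [_]] //|h].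
    by apply/is_path_cons; split=> //; apply/is_path_cons; split=> //; exact: adj_sym.
  split=> //; rewrite pE !cat_cons path_list_cat !run_cat => /andP[h1 h2].
  have [q -> g] := run_good h1; rewrite /=.
  have := followK g ab.
  have [q' E] := follow_cons (a :: q) b; rewrite E.
  have [k E'] := follow_cons (b :: q') a; rewrite E' => e.
  apply: foldl_follow_eqv => //; exact: good_eqv (eqv_sym e) g.
have pE x y : is_path a [:: x, y & t] <-> [/\ adj a x, adj x y & is_path y t].
  by rewrite !is_path_cons; split=> [[? [? ?]]|[? ? ?]].
split.
  rewrite !cat_cons !path_list_cat; congr (_ && _).
  by apply/idP/idP => /pE [_ _ h]; apply/pE.
rewrite !cat_cons !path_list_cat !run_cat => /andP[h1 /pE [_ _ h2]].
have [q -> g] := run_good h1; rewrite /=.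
suff e : eqv (follow (follow (a :: q) b) c) (follow (follow (a :: q) d) c).
  have gb := follow_good g ab.
  have [q' E] := follow_cons (a :: q) b; rewrite E in gb e *.
  have gc := follow_good gb bc; have [k E'] := follow_cons (b :: q') c.
  have [k' E2] := follow_cons (follow (a :: q) d) c; rewrite E' E2 in gc e *.
  exact: foldl_follow_eqv.
have [bd|bd] := pselect (b = d); first by rewrite bd; exact: eqv_refl.
have [ac|ac] := pselect (a = c).
  subst c; apply: eqv_trans (followK g ab) _; exact/eqv_sym/followK.
apply: follow_sq => //; exact: square_corner SQ Qa Qb Qc Qd _ _ _ _ _ _.
Qed.

Lemma run_homotopy l l' : homotopic l l' ->
  is_path_list l = is_path_list l' /\ (is_path_list l -> eqv (run l) (run l')).
Proof.
elim=> {l l'} [l l' /run_homotopy1 //|l|l l' _ [h1 h2]|l1 l2 l3 _ [h1 h2] _ [h3 h4]].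
- by split=> // _; exact: eqv_refl.
- by split=> // h; apply/eqv_sym/h2; rewrite h1.
- split=> [|h]; first by rewrite h1.
  by apply: eqv_trans (h2 h) _; apply: h4; rewrite -h1.
Qed.

Lemma walk_path x p : walk (x :: p) -> is_path x p.
Proof.
elim: p x => [//|y p IH] x [a h]; apply/is_path_cons; split=> //.
exact/IH/h.
Qed.

Lemma path_walk x p : is_path x p -> walk (x :: p).
Proof. by elim: p x => [//|y p IH] x /is_path_cons [a /IH h]; split. Qed.

Lemma path_rev x p : is_path x p -> is_path_list (rev (x :: p)).
Proof.
elim: p x => [//|y p IH] x /is_path_cons [a /IH h].
move: h; rewrite !rev_cons -!cats1 -catA cats1 /= => h.
rewrite path_list_cat h; apply/is_path_cons; split=> //; exact: adj_sym.
Qed.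

Lemma run_rev x p : good (x :: p) -> eqv (run (rev (x :: p))) (x :: p).
Proof.
elim: p x => [|y p IH] x g; first exact: eqv_refl.
have g' := good_behead g; have := IH _ g'.
have := path_rev (walk_path (proj1 g')).
rewrite (rev_cons x) rev_cons; set s := rev p => h.
have [q Eq gq] := run_good h.
have -> : run (rcons (rcons s y) x) = follow (run (rcons s y)) x.
  by case: (s) => [//|z s'] /=; rewrite -!cats1 foldl_cat.
rewrite Eq => e; have ey := eqv_head e.
have a := good_adj g.
apply: eqv_trans (follow_eqv gq (adj_sym a) e) _.
rewrite follow_fwd //; exact: eqv_refl.
Qed.

Hypothesis sc : simply_connected X.

(** Both paths, followed by the reverse of [q], are closed, hence homotopic to
    the constant path, hence act on the constant path in the same way. *)
Lemma good_uniq x p q : good (x :: p) -> good (x :: q) -> last x p = last x q ->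
  eqv (x :: p) (x :: q).
Proof.
move=> gp gq lpq.
have pq := walk_path (proj1 gq).
apply: (foldl_follow_inj gp gq pq).
have H p' : good (x :: p') -> last x p' = last x q ->
    eqv (foldl follow (x :: p') q) [:: last x q].
  move=> g el; have e := run_rev g.
  have hp := path_rev (walk_path (proj1 g)).
  have E : rev (x :: p') = last x q :: behead (rev (x :: p')).
    rewrite -el; case/lastP: p' {g el e hp} => [//|p' z].
    by rewrite rev_cons rev_rcons last_rcons.
  have [q' Eq gq'] : exists2 q', run (rev (x :: p')) = x :: q' & good (x :: q').
    by move: hp; rewrite rev_cons => /run_good.
  have [_ h] : is_path_list (rev (x :: p') ++ q) = is_path_list [:: last x q] /\
    (is_path_list (rev (x :: p') ++ q) -> eqv (run (rev (x :: p') ++ q)) (run [:: last x q])).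
    apply: run_homotopy; rewrite E cat_cons; apply: (proj2 sc).
      have : is_path_list (rev (x :: p') ++ q).
        by rewrite rev_cons cat_rcons path_list_cat -rev_cons hp.
      by rewrite {1}E.
    rewrite last_cat; congr (last _ q).
    move: E; rewrite rev_cons; case: (rev p') => [|z s] /= [].
      by move=> <-.
    by rewrite last_rcons.
  have : is_path_list (rev (x :: p') ++ q).
    by rewrite rev_cons cat_rcons path_list_cat -rev_cons hp.
  move=> /h; rewrite [run [:: _]]/= rev_cons cat_rcons run_cat -rev_cons Eq.
  apply: eqv_trans; apply: foldl_follow_eqv => //.
  by apply: eqv_sym; rewrite -Eq.
exact: eqv_trans (H _ gp lpq) (eqv_sym (H _ gq erefl)).
Qed.

End Paths.

(** * The combinatorial distance *)

Section Distance.
Variable X : cube_complex.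
Hypothesis hX : CAT0 X.
Implicit Types (x y z a b c u v w : X) (p q r s t l : seq X) (J K : set (set X)).
Local Notation d := (@distn X).

Let sc : simply_connected X := proj1 hX.
Let flag : flag_links X := proj2 hX.

Lemma distnP x y :
  (exists p, [/\ is_path x p, last x p = y & size p = d x y]) /\
  forall p, is_path x p -> last x p = y -> d x y <= size p.
Proof.
rewrite /distn; apply: (@xgetPex _ 0 [set n | (exists p, [/\ is_path x p, last x p = y & size p = n]) /\
    forall p, is_path x p -> last x p = y -> n <= size p]).
have ex : exists n, `[< exists p, [/\ is_path x p, last x p = y & size p = n] >].
  by have [p h1 h2] := proj1 sc x y; exists (size p); apply/asboolP; exists p.
case: (ex_minnP ex) => n /asboolP h1 h2; exists n; split=> // p hp hl.
by apply: h2; apply/asboolP; exists p.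
Qed.

Lemma geodesic x y : exists p, [/\ is_path x p, last x p = y & size p = d x y].
Proof. by case: (distnP x y). Qed.

Lemma distn_le x p : is_path x p -> d x (last x p) <= size p.
Proof. by move=> h; have [_] := distnP x (last x p); apply. Qed.

Lemma bt_shorten x p : has_bt (x :: p) -> is_path x p ->
  exists q, [/\ is_path x q, last x q = last x p & size p = (size q).+2].
Proof.
move E : (x :: p) => l h; elim: h x p E => [a b t|y q h IH] x p [-> ->].
  by move=> /is_path_cons [_ /is_path_cons [_ ht]]; exists t.
case: q h IH => [|z q] h IH; first by inversion h.
move=> /is_path_cons [az hz]; have [k [h1 h2 h3]] := IH _ _ erefl hz.
exists (z :: k); split=> /=; [exact/is_path_cons|exact: h2|by rewrite h3].
Qed.

Lemma geodesic_good x p : is_path x p -> size p = d x (last x p) -> good (x :: p).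
Proof.
move=> hp hs; split; first exact: path_walk.
move=> q e hb; have hw := eqv_walk e (path_walk hp).
have [es eh el] := eqv_inv e; case: q es eh el e hb hw => // y q [es] [<-] el e hb hw.
have [k [h1 h2 h3]] := bt_shorten hb (walk_path hw).
have := distn_le h1; rewrite h2; have /= <- := el x; rewrite -hs es h3; lia.
Qed.

Lemma good_geodesic x p : good (x :: p) -> size p = d x (last x p).
Proof.
move=> g; have [q [h1 h2 h3]] := geodesic x (last x p).
have gq : good (x :: q) by apply: geodesic_good => //; rewrite h2.
by have [[->] _ _] := eqv_inv (good_uniq flag sc g gq (esym h2)).
Qed.

Lemma distn_sym x y : d x y = d y x.
Proof.
suff H u v : d u v <= d v u by apply/eqP; rewrite eqn_leq !H.
move: u v => {x y} x y; have [p [h1 h2 h3]] := geodesic y x; have := path_rev h1; rewrite -h3 -h2.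
case/lastP: p {h1 h2 h3} => [_|p z].
  by rewrite /=; apply: (@distn_le y [::]).
rewrite last_rcons rev_cons rev_rcons /= => /distn_le.
by rewrite last_rcons size_rcons size_rev size_rcons.
Qed.

Lemma distn0 x : d x x = 0.
Proof. by apply/eqP; rewrite -leqn0; exact: (@distn_le x [::]). Qed.

Lemma distn_eq0 x y : d x y = 0 -> x = y.
Proof. by have [[|? ?] [_ //= <- <-]] := geodesic x y. Qed.

Lemma distn_tri x y z : d x z <= d x y + d y z.
Proof.
have [p [h1 h2 <-]] := geodesic x y; have [q [h3 h4 <-]] := geodesic y z.
rewrite -size_cat -h4 -h2 -last_cat; apply: distn_le.
by move: h1; rewrite /is_path cat_path => ->; rewrite h2.
Qed.

Lemma distn_adj x y : adj x y -> d x y = 1.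
Proof.
move=> a; have : d x y <= 1.
  by apply: (@distn_le x [:: y]); apply/is_path_cons.
by case E : (d x y) => [|[|]] //; case: (adj_neq a); exact: distn_eq0.
Qed.

Lemma distn_step x y n : d x y = n.+1 -> exists2 x', adj x x' & d x' y = n.
Proof.
have [[|x' p] [h1 h2 h3]] := geodesic x y; first by rewrite -h3.
move=> hn; have [a h] := (is_path_cons _ _ _).1 h1; exists x' => //.
have := distn_le h; have := distn_tri x x' y; rewrite (distn_adj a) -h2 /=.
by rewrite /= in h2 h3; rewrite h2; lia.
Qed.

Lemma distn1_adj x y : d x y = 1 -> adj x y.
Proof. by move=> /distn_step [z a /distn_eq0 <-]. Qed.

(** A geodesic is reduced, so an edge at its end either extends it to a geodesic
    or is the last edge of another geodesic. *)
Lemma distn_parity z x y : adj x y -> d y z = (d x z).+1 \/ d x z = (d y z).+1.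
Proof.
move=> a; have [p [h1 h2 h3]] := geodesic x z.
have g : good (x :: p) by apply: geodesic_good => //; rewrite h2.
have [[q e]|g'] := exchange flag g a.
  right; have ge := good_eqv e g.
  have [[es] _ el] := eqv_inv e; have /= l1 := el x.
  have := good_geodesic (good_behead ge); rewrite -l1 h2 => <-.
  by rewrite -h3 es.
by left; have := good_geodesic g'; rewrite /= h2 h3 => <-.
Qed.

Lemma distn_parityr z x y : adj x y -> d z y = (d z x).+1 \/ d z x = (d z y).+1.
Proof. by rewrite !(distn_sym z); exact: distn_parity. Qed.

(** The quadrangle condition: the geodesics through [y] and [y'] are equivalent
    reduced paths, and [confP] provides the square. *)
Lemma quadrangle z x y y' n : adj x y -> adj x y' -> y <> y' ->
  d x z = n.+1 -> d y z = n -> d y' z = n ->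
  exists2 w, sq x y w y' & (d w z).+1 = n.
Proof.
move=> a a' yy' dx dy dy'.
have H u : adj x u -> d u z = n ->
    exists p, [/\ good [:: x, u & p], last u p = z & size p = n].
  move=> au du; have [p [h1 h2 h3]] := geodesic u z.
  exists p; split; rewrite -?du //; apply: geodesic_good => /=.
    exact/is_path_cons.
  by rewrite h2 dx -du h3.
have [p [g1 l1 s1]] := H y a dy; have [q [g2 l2 s2]] := H y' a' dy'.
have e := good_uniq flag sc g1 g2 (etrans l1 (esym l2)).
case: (confP flag g1 e) => [/eqv_head //|[b [c [w [r [e1 e2 S]]]]]].
have ? := eqv_head e1; have ? := eqv_head e2; subst b c.
exists w => //; have gw := good_behead (good_eqv e1 (good_behead g1)).
have [[es] _ el] := eqv_inv e1; have /= lw := el x.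
have := good_geodesic gw; rewrite -lw l1 => <-.
by rewrite -s1 es.
Qed.

(** * Hyperplanes and their sides *)

Definition closer a b z : bool := d z a < d z b.

Lemma closerN a b z : adj a b -> closer b a z = ~~ closer a b z.
Proof.
move=> ab; rewrite /closer; have := distn_parity z ab.
rewrite (distn_sym b) (distn_sym a); lia.
Qed.

(** If the two partitions differed at [z], then [z] would be at the same distance
    from [a] and [c], nearer than from [b]; the quadrangle condition then gives a
    square at the corner [a b c] other than the given one. *)
Lemma closer_sq a b c e z : sq a b c e -> closer a b z = closer e c z.
Proof.
have H a' b' c' e' : sq a' b' c' e' -> closer a' b' z -> closer e' c' z.
  move=> S; have [[ab bc ce ea] [ac be _]] := S; rewrite /closer.
  have := distn_parity z ab; have := distn_parity z bc.
  have := distn_parity z ce; have := distn_parity z ea.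
  rewrite !(distn_sym z) => h1 h2 h3 h4 h5.
  rewrite ltnNge; apply/negP => h6.
  have [k hk] : exists k, d b' z = k.+1 by exists (d a' z); lia.
  have [] := @quadrangle z b' a' c' k (adj_sym ab) bc ac hk; try lia.
  move=> w Sw; have -> : w = e'.
    by apply: (@sq_uniq _ a' b' c') => //; exact/sq_rot/sq_rot/sq_rot/sq_rev.
  lia.
move=> S; apply/idP/idP; first exact: H.
by apply: H; exact/sq_rot/sq_rev.
Qed.

Definition par := clos_refl_trans (set X) (fun e1 e2 => exists Q, parallel_in Q e1 e2).
Definition edge_class a b : set (set X) := [set f | par [set a; b] f].

Lemma par_refl (e : set X) : par e e. Proof. exact: rt_refl. Qed.

Lemma par_trans (e f g : set X) : par e f -> par f g -> par e g.
Proof. exact: rt_trans. Qed.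

Lemma par_sym (e f : set X) : par e f -> par f e.
Proof.
elim=> {e f} [e f [Q [[SQ Ee Ef eQ fQ] h]]|e|e f g _ IH1 _ IH2].
- apply: rt_step; exists Q; split; first by split.
  by rewrite setIC; case: h => h; [left|right].
- exact: rt_refl.
- exact: rt_trans IH2 IH1.
Qed.

Lemma sq_par a b c e : sq a b c e -> par [set a; b] [set e; c].
Proof. by move=> S; apply: rt_step; exists [set a; b; c; e]; exact: parallel_sq. Qed.

Lemma set2_eq (T : Type) (x y u v : T) : [set x; y] = [set u; v] ->
  (x = u /\ y = v) \/ (x = v /\ y = u).
Proof.
move=> e.
have hx : [set u; v] x by rewrite -e; left.
have hy : [set u; v] y by rewrite -e; right.
have hu : [set x; y] u by rewrite e; left.
have hv : [set x; y] v by rewrite e; right.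
move: hx hy hu hv => /=; intuition congruence.
Qed.

Lemma par_closer (e f : set X) : par e f -> forall a b, adj a b -> e = [set a; b] ->
  exists u v, [/\ adj u v, f = [set u; v] & forall z, closer a b z = closer u v z].
Proof.
elim=> {e f} [e f [Q hQ]|e|e f g _ IH1 _ IH2] a b ab E.
- case: (parallel_inP hQ) => [<-|]; first by exists a, b.
  move=> [p [q [r [s [S e1 e2]]]]]; have H : [set a; b] = [set p; q] by rewrite -E -e1.
  have [[_ _ asr _] _] := S.
  case: (set2_eq H) => -[? ?]; subst a b.
    by exists s, r; split; [exact: adj_sym| |move=> z; exact: closer_sq].
  exists r, s; split=> //; first by rewrite e2 setUC.
  by move=> z; apply: closer_sq; exact/sq_rot/sq_rot/sq_rot/sq_rev.
- by exists a, b.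
- have [u [v [uv fE h]]] := IH1 _ _ ab E.
  have [u' [v' [uv' -> h']]] := IH2 _ _ uv fE.
  by exists u', v'; split=> // z; rewrite h h'.
Qed.

(** The quadrangle condition provides a ladder of squares leading from the edge
    [uv] down to the edge [ab]. *)
Lemma cross_par a b u v : adj a b -> adj u v -> closer a b u -> ~~ closer a b v ->
  par [set u; v] [set a; b].
Proof.
move=> ab; move E : (d u a) => n; elim: n u v E => [|n IH] u v E uv cu cv.
  have ? := distn_eq0 E; subst u; suff -> : v = b by exact: par_refl.
  apply: distn_eq0; move: cv; rewrite /closer.
  by rewrite (distn_sym v a) (distn_adj uv); have := distn_parity b uv; rewrite (distn_adj ab); lia.
have [u' uu' du'] := distn_step E.
move: cu cv; rewrite /closer => cu cv.
have h1 := distn_parity a uv; have h2 := distn_parity b uv.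
have h3 := distn_parityr u ab; have h4 := distn_parityr v ab.
have h5 := distn_parity b uu'; have h6 := distn_parityr u' ab.
have ne : u' <> v by move=> e; subst v; lia.
have [e1 [e2 e3]] : d u b = n.+2 /\ d u' b = n.+1 /\ d v b = n.+1 by lia.
have [w S [dw]] := quadrangle uu' uv ne e1 e2 e3.
have [[_ u'w wv _] _] := S.
have h7 := distn_parity a wv.
apply: par_trans (sq_par (sq_rev S)) _.
apply: IH => //; rewrite /closer; lia.
Qed.

Lemma hyperplaneP (J : set (set X)) : hyperplane J <-> exists a b, adj a b /\ J = edge_class a b.
Proof.
split=> [[e /[dup] Ee /edgeP [a [b [E _]]] ->]|[a [b [ab ->]]]].
  by exists a, b; rewrite /adj /edge_class -E.
by exists [set a; b].
Qed.

(** A choice of one of the two sides of each hyperplane. On sets of edges that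
    are not hyperplanes it is constant, so that a set of edges separating two
    vertices is automatically a hyperplane. *)
Definition side (J : set (set X)) z : bool :=
  if pselect (exists ab : X * X, adj ab.1 ab.2 /\ J = edge_class ab.1 ab.2) is left h
  then closer (projT1 (cid h)).1 (projT1 (cid h)).2 z else false.

Lemma side_hyp J x y : side J x != side J y -> hyperplane J.
Proof.
rewrite /side; case: pselect => // h _.
by case: h => -[a b] [ab E]; apply/hyperplaneP; exists a, b.
Qed.

Lemma sideP J : hyperplane J ->
  exists a b, [/\ adj a b, J = edge_class a b & side J = closer a b].
Proof.
move=> /hyperplaneP [a [b [ab E]]]; rewrite /side; case: pselect => [h|]; last first.
  by case; exists (a, b).
by case: cid => -[u v] /= [uv E']; exists u, v.
Qed.

(** The hyperplane of [ab] consists of the edges that cross between the vertices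
    closer to [a] and those closer to [b]. *)
Lemma side_edge J u v : hyperplane J -> adj u v ->
  (J [set u; v] <-> side J u != side J v).
Proof.
move=> /sideP [a [b [ab -> ->]]] uv; split.
  move=> /par_closer /(_ _ _ ab erefl) [u' [v' [uv' E0 h]]].
  have E := set2_eq E0; rewrite !h /closer; have := distn_adj uv'.
  by case: E => -[-> ->]; rewrite !distn0 distn_sym => ->.
case cu: (closer a b u); case cv : (closer a b v) => // _; apply: par_sym.
  by apply: cross_par => //; rewrite cv.
rewrite setUC; apply: cross_par => //; [exact: adj_sym|by rewrite cu].
Qed.

Lemma edge_wall u v : adj u v -> exists J, side J u != side J v /\
  forall J', side J' u != side J' v -> J' = J.
Proof.
move=> uv; have hJ : hyperplane (edge_class u v) by apply/hyperplaneP; exists u, v.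
exists (edge_class u v); split; first by apply/side_edge => //; exact: par_refl.
move=> J' h; have hJ' := side_hyp h; have := (side_edge hJ' uv).2 h.
have [a [b [ab -> _]]] := sideP hJ' => ab_uv.
apply/seteqP; split=> e; rewrite /edge_class /=; last exact: par_trans.
by apply: par_trans; exact: par_sym.
Qed.

Lemma edge_closer J u v z : adj u v -> side J u != side J v ->
  closer u v z = (side J z == side J u).
Proof.
move=> uv h; have hJ := side_hyp h; have := (side_edge hJ uv).2 h.
have [a [b [ab E sE]]] := sideP hJ; rewrite {1}E => /par_closer.
move=> /(_ _ _ ab erefl) [u' [v' [uv' E0 c]]].
case: (set2_eq E0) => -[? ?]; subst u' v'; rewrite sE !c /closer !distn0.
  by rewrite (distn_adj uv); case: (_ < _).
rewrite (distn_adj uv) -!/(closer _ _ _) (closerN _ uv); by case: closer.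
Qed.

(** A geodesic crosses a hyperplane at most once: its remaining part stays on the
    side of the vertices closer to the end of the crossing edge. *)
Lemma walls_ex x y : exists s : seq (set (set X)),
  [/\ uniq s, size s = d x y & forall J, (J \in s) = (side J x != side J y)].
Proof.
move E : (d x y) => n; elim: n x E => [|n IH] x E.
  by exists [::]; split=> // J; rewrite (distn_eq0 E) eqxx.
have [x' xx' dx'] := distn_step E; have [s [us ss sP]] := IH x' dx'.
have [J0 [h0 u0]] := edge_wall xx'.
have e0 : side J0 x' = side J0 y.
  have := edge_closer y (adj_sym xx'); rewrite /closer (distn_sym y) (distn_sym y x) E dx'.
  by move=> /(_ J0); rewrite eq_sym h0 ltnSn => /(_ erefl)/esym/eqP.
exists (J0 :: s); split=> [/=|/=|J]; rewrite ?ss //.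
  by rewrite us sP e0 eqxx.
rewrite in_cons sP; have [->|/eqP ne] := J =P J0; first by rewrite -e0 h0.
suff -> : side J x = side J x' by [].
by apply/eqP; apply: contraNT ne => /u0 ->.
Qed.

Definition walls x y : seq (set (set X)) := projT1 (cid (walls_ex x y)).

Lemma walls_uniq x y : uniq (walls x y).
Proof. by rewrite /walls; case: cid => s []. Qed.

Lemma size_walls x y : size (walls x y) = d x y.
Proof. by rewrite /walls; case: cid => s []. Qed.

Lemma mem_walls x y J : (J \in walls x y) = (side J x != side J y).
Proof. by rewrite /walls; case: cid => s []. Qed.

Lemma side_inj x y : (forall J, side J x = side J y) -> x = y.
Proof.
move=> h; apply: distn_eq0; rewrite -size_walls; case E : (walls x y) => [//|J s].
by have := mem_walls x y J; rewrite E in_cons eqxx h eqxx.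
Qed.

Lemma distn_ge x y (s : seq (set (set X))) : uniq s ->
  (forall J, J \in s -> side J x != side J y) -> size s <= d x y.
Proof.
by move=> us h; rewrite -size_walls; apply: uniq_leq_size => // J /h; rewrite mem_walls.
Qed.

(** * Gates and medians *)

Definition between a w b : Prop := d a w + d w b = d a b.

(** The hyperplanes separating [a] from [w] and [w] from [b] are those separating
    [a] from [b], except that one separating [w] from both counts twice. *)
Lemma between_side a w b :
  between a w b <-> forall J, side J a = side J b -> side J w = side J a.
Proof.
split=> [h J e|h].
  apply/eqP/negPn/negP => ne.
  have mJ : J \in walls a w by rewrite mem_walls eq_sym.
  have : size (J :: walls a b) <= size (rem J (walls a w) ++ walls w b).
    apply: uniq_leq_size => [/=|K].
      by rewrite mem_walls e eqxx walls_uniq.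
    rewrite in_cons mem_cat mem_rem_uniq ?walls_uniq // inE !mem_walls.
    have [-> _|_ /=] := eqVneq K J; first by rewrite -e ne orbT.
    by case: (side K a) (side K w) (side K b) => [] [] [].
  rewrite /= size_cat size_rem // !size_walls -h.
  have : 0 < d a w by rewrite -size_walls; case: (walls a w) mJ.
  lia.
apply/eqP; rewrite eqn_leq distn_tri andbT -!size_walls -size_cat.
apply: uniq_leq_size => [|K].
  rewrite cat_uniq !walls_uniq /= andbT; apply/hasPn => K.
  rewrite !mem_walls; have := h K.
  by case: (side K a) (side K w) (side K b) => [] [] [] // /(_ erefl).
rewrite mem_cat !mem_walls; have := h K.
by case: (side K a) (side K w) (side K b) => [] [] [] // /(_ erefl).
Qed.

Definition convex (A : set X) : Prop :=
  forall a b w, A a -> A b -> between a w b -> A w.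

(** Sliding the first edge of a path out of [x'] down a ladder of squares. *)
Lemma ladder n (p x' x a : X) : d p x' = n -> d a x' = d a p + n -> adj x x' ->
  d p x = n.+1 -> d a x' = (d a x).+1 ->
  exists w, [/\ adj p w, d a p = (d a w).+1 & d w x <= n].
Proof.
elim: n p x' x => [|n IH] p x' x dp da xx' dx dax.
  by have ? := distn_eq0 dp; subst; exists x; split; rewrite ?distn0 //; exact: adj_sym.
have [q x'q dq] : exists2 q, adj x' q & d q p = n by apply: distn_step; rewrite distn_sym.
have daq : d a q = d a p + n.
  have := distn_tri a q x'; rewrite (distn_adj (adj_sym x'q)).
  by have := distn_tri a p q; rewrite (distn_sym p); lia.
have qx : q <> x by move=> e; subst q; have := distn_sym x p; lia.
have [w S dw] : exists2 w, sq x' q w x & (d w a).+1 = d a p + n.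
  by apply: quadrangle => //; [exact: adj_sym|rewrite distn_sym; lia..].
have [[_ qw wx _] _] := S.
have := distn_tri p w x; rewrite (distn_adj wx) => h1.
have := distn_parityr p qw; rewrite (distn_sym p q) dq => h2.
have [v [pv dv1 dv2]] : exists v, [/\ adj p v, d a p = (d a v).+1 & d v w <= n].
  apply: (IH p q w) => //; rewrite ?(distn_sym p q) ?(distn_sym a w) //;
    [exact: adj_sym|lia..].
exists v; split=> //; have := distn_tri v w x; rewrite (distn_adj wx); lia.
Qed.

(** By induction on [d p x]. If the last edge of a geodesic from [p] to [x] came
    closer to some vertex of [A], sliding it down to [p] would give a vertex of
    [A] nearer to [x] than [p]. *)
Lemma gate A (p x : X) : convex A -> A p -> (forall a, A a -> d p x <= d a x) ->
  forall a, A a -> d a x = d a p + d p x.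
Proof.
move=> cA Ap; move E : (d p x) => n; elim: n x E => [|n IH] x E near a Aa.
  by rewrite (distn_eq0 E) addn0.
have [x' xx' dx'] : exists2 x', adj x x' & d x' p = n.
  by apply: distn_step; rewrite distn_sym.
have da : d a x' = d a p + n.
  apply: IH => //; first by rewrite distn_sym.
  move=> b /near; have := distn_tri b x' x.
  by rewrite (distn_adj (adj_sym xx')); lia.
have [h|h] := distn_parityr a xx'; last lia.
have [w [pw dw1 dw2]] : exists w, [/\ adj p w, d a p = (d a w).+1 & d w x <= n].
  by apply: (@ladder n p x' x a) => //; rewrite distn_sym.
suff /near : A w by lia.
by apply: cA Aa Ap _; rewrite /between (distn_sym w) (distn_adj pw) dw1 addn1.
Qed.

Lemma nearest_ex A x : A !=set0 -> exists2 p, A p & forall a, A a -> d p x <= d a x.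
Proof.
move=> [a Aa].
have ex : exists n, `[< exists2 p, A p & d p x = n >].
  by exists (d a x); apply/asboolP; exists a.
case: (ex_minnP ex) => n /asboolP [p Ap <-] h; exists p => // b Ab.
by apply: h; apply/asboolP; exists b.
Qed.

Lemma gate_ex A x : convex A -> A !=set0 ->
  exists2 p, A p & forall a, A a -> between a p x.
Proof.
move=> cA /(nearest_ex x) [p Ap h]; exists p => // a Aa.
by rewrite /between -(gate cA Ap h).
Qed.

Lemma side_convex J e : convex [set z | side J z = e].
Proof.
by move=> a b w /= ha hb /between_side h; rewrite h ha // hb.
Qed.

Lemma interval_convex y z : convex [set w | between y w z].
Proof.
move=> a b w /between_side ha /between_side hb /between_side h.
apply/between_side => J e; have := h J; rewrite (ha J e) (hb J e); exact.
Qed.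

Definition maj (a b c : bool) : bool := (a && b) || (a && c) || (b && c).

(** The median is the gate of [x] in the interval between [y] and [z]. *)
Lemma median_ex x y z :
  exists m, forall J, side J m = maj (side J x) (side J y) (side J z).
Proof.
have [|m hm h] := gate_ex x (@interval_convex y z).
  by exists y; rewrite /= /between distn0.
have hy : between y m x by apply: h; rewrite /= /between distn0.
have hz : between z m x by apply: h; rewrite /= /between distn0 addn0.
exists m => J; move/between_side/(_ J): hm; move/between_side/(_ J): hy.
move/between_side/(_ J): hz; rewrite /maj.
case: (side J x) (side J y) (side J z) => [] [] [] h1 h2 h3;
  first [exact: h1|exact: h2|exact: h3].
Qed.

Definition med x y z : X := projT1 (cid (median_ex x y z)).

Lemma side_med J x y z : side J (med x y z) = maj (side J x) (side J y) (side J z).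
Proof. by rewrite /med; case: cid. Qed.

Lemma side_onto J e : hyperplane J -> exists z, side J z = e.
Proof.
move=> hJ; have [a [b [ab E _]]] := sideP hJ.
have : J [set a; b] by rewrite E; exact: par_refl.
move/(side_edge hJ ab).1; case: e; case ha: (side J a); case hb : (side J b) => // _;
  by [exists a|exists b].
Qed.

Lemma hyperplane_edge J (e : set X) : hyperplane J -> J e -> edge e.
Proof.
move=> /sideP [a [b [ab -> _]]] /par_closer.
by move=> /(_ _ _ ab erefl) [u [v [uv -> _]]].
Qed.

Lemma carrierP J z : hyperplane J ->
  (carrier J z <-> exists2 z', adj z z' & side J z != side J z').
Proof.
move=> hJ; split=> [[e Je]|[z' zz' h]]; last first.
  by exists [set z; z']; [exact/side_edge|left].
have Ee := hyperplane_edge hJ Je.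
have [a [b [E _]]] := edgeP Ee; subst e.
have := (side_edge hJ Ee).1 Je => h [] ->; first by exists b.
by exists a; [exact: adj_sym|rewrite eq_sym].
Qed.

(** A geodesic between two vertices on one side of [J] does not cross [J]. *)
Lemma halfspaceP J D : hyperplane J ->
  (halfspace J D <-> exists x, D = [set y | side J y = side J x]).
Proof.
move=> hJ.
suff H x : [set y | clos_refl_trans X (fun a b => adj a b /\ ~ J [set a; b]) x y]
    = [set y | side J y = side J x].
  by split=> -[x ->]; exists x; rewrite H.
apply/seteqP; split=> y /=.
  elim=> {x y} [x y [xy h]|//|x y z _ h1 _ h2]; last by rewrite h2.
  by apply/eqP; apply: contra_notT h; rewrite eq_sym => /(side_edge hJ xy).
move E : (d x y) => n; elim: n x E => [|n IH] x E e.
  by rewrite (distn_eq0 E); exact: rt_refl.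
have [x' xx' dx'] := distn_step E.
have ex : side J x' = side J y.
  rewrite e; have : between x x' y by rewrite /between (distn_adj xx') dx' E.
  by move=> /between_side; apply; rewrite e.
apply: rt_trans (IH _ dx' (esym ex)); apply: rt_step; split=> //.
by move=> /(side_edge hJ xx'); rewrite ex e eqxx.
Qed.

Lemma separatesP J A B : hyperplane J -> A !=set0 -> B !=set0 ->
  (separates J A B <-> exists e, (forall a, A a -> side J a = e) /\
                                (forall b, B b -> side J b = ~~ e)).
Proof.
move=> hJ [a Aa] [b Bb]; split.
  move=> [D1 [D2 [/(halfspaceP _ hJ) [x ->] /(halfspaceP _ hJ) [y ->] ne sA sB]]].
  exists (side J x); split=> [c /sA //|c /sB /= ->].
  have : side J x != side J y by apply: contra_notN ne => /eqP ->.
  by case: side; case: side.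
move=> [e [hA hB]].
exists [set y | side J y = e], [set y | side J y = ~~ e]; split=> //.
- by apply/halfspaceP => //; exists a; rewrite hA.
- by apply/halfspaceP => //; exists b; rewrite hB.
- move=> /seteqP [/(_ a (hA a Aa)) /= + _]; rewrite hA //.
  by case: (e).
Qed.

Lemma separates1P J x y : hyperplane J ->
  (separates J [set x] [set y] <-> side J x != side J y).
Proof.
move=> hJ; rewrite separatesP; [|by []|by exists x|by exists y].
split=> [[e [-> // ->//]]|h]; first by case: e.
exists (side J x); split=> [_ -> //|_ ->].
by case: (side J x) (side J y) h => [] [].
Qed.

(** * Transversality and facing triples *)

(** The four quadrants are nonempty; see [transverseP]. *)
Definition cross (J1 J2 : set (set X)) : Prop :=
  forall e1 e2 : bool, exists z, side J1 z = e1 /\ side J2 z = e2.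

Lemma cross_sym J1 J2 : cross J1 J2 -> cross J2 J1.
Proof. by move=> h e1 e2; have [z [? ?]] := h e2 e1; exists z. Qed.

Lemma cross_hyp J1 J2 : cross J1 J2 -> hyperplane J1.
Proof.
move=> h; have [x [hx _]] := h true true; have [y [hy _]] := h false true.
by apply: (@side_hyp _ x y); rewrite hx hy.
Qed.

Lemma cross_neq J1 J2 : cross J1 J2 -> J1 <> J2.
Proof. by move=> h e; subst; have [z [-> //]] := h true false. Qed.

Lemma square_two_edges Q v a b : square Q -> Q v -> Q a -> Q b ->
  adj v a -> adj v b -> a <> b -> exists t : X, sq v a t b.
Proof.
move=> SQ Qv Qa Qb va vb ab; have [p [q [r [s [S E]]]]] := squareP SQ.
have S1 := sq_rev S; have S2 := sq_rot S; have S3 := sq_rot S2.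
have S4 := sq_rot S3; have S5 := sq_rot S1; have S6 := sq_rot S5.
have S7 := sq_rot S6.
have nd1 := sq_ndiag S; have nd2 := sq_ndiag S2.
have nd3 := sq_ndiag S3; have nd4 := sq_ndiag S4.
have n1 := adj_neq va; have n2 := adj_neq vb.
move: n1 n2 va vb ab Qv Qa Qb; rewrite !E => {E}.
move=> n1 n2 va vb ab hv ha hb; move: n1 n2 va vb ab.
case: hv => ->; case: ha => ->; case: hb => -> *;
  first [contradiction | eexists; eassumption].
Qed.

(** The endpoints of an edge of [J]; see [acrossP]. *)
Definition across (J : set (set X)) x x' : Prop := forall K, (side K x != side K x') = (K == J).

Lemma acrossP (J : set (set X)) x x' : across J x x' <-> adj x x' /\ side J x != side J x'.
Proof.
split=> [h|[a hJ] K].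
  split; last by rewrite h.
  apply: distn1_adj; rewrite -size_walls.
  have /perm_size -> // : perm_eq (walls x x') [:: J].
  by apply: uniq_perm; rewrite ?walls_uniq // => K; rewrite mem_walls h inE.
have [J0 [h0 u0]] := edge_wall a; have -> := u0 _ hJ.
by have [->|/eqP ne] := K =P J0; [rewrite h0|apply: contraNF ne => /u0 ->].
Qed.

(** The neighbour of [w] is the median of [w] and of the neighbours of both ends:
    every other hyperplane has two of these three vertices on the side of [w]. *)
Lemma across_convex J x x' y y' w : across J x x' -> across J y y' ->
  side J x = side J y -> between x w y -> exists w', across J w w'.
Proof.
move=> hx hy e /between_side h; exists (med w x' y') => K.
rewrite side_med; have := hx K; have := hy K; have := h K.
have [->|ne] := eqVneq K J.
  rewrite e => /(_ erefl) ->.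
  by case: (side J y) (side J y') (side J x') => [] [] [].
move=> hw /negbT; rewrite negbK => /eqP <- /negbT; rewrite negbK => /eqP <-.
case: (side K x) (side K y) (side K w) hw => [] [] [] //; by move=> /(_ erefl).
Qed.

(** The quadrangle condition at [v], which is at distance two from [t]. *)
Lemma across_sq (J1 J2 : set (set X)) (v a b t : X) : across J1 v a -> across J2 v b -> across J1 b t ->
  J1 <> J2 -> sq v a t b.
Proof.
move=> h1 h2 h3 ne.
have nb K : ~~ ((K == J1) && (K == J2)).
  by apply/negP => /andP[/eqP -> /eqP].
have h4 : across J2 a t.
  move=> K; move: (h1 K) (h2 K) (h3 K) (nb K).
  by case: (K == J1); case: (K == J2) => //=;
    case: (side K v) (side K a) (side K b) (side K t) => [] [] [] [].
have va := ((acrossP _ _ _).1 h1).1; have vb := ((acrossP _ _ _).1 h2).1.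
have bt := ((acrossP _ _ _).1 h3).1; have at' := ((acrossP _ _ _).1 h4).1.
have ab : a <> b.
  by move=> e; have := h1 J1; rewrite e h2 eqxx (introF eqP ne).
have vt : d v t = 2.
  have : [:: J1; J2] =i walls v t.
    move=> K; rewrite mem_walls !inE; move: (h1 K) (h4 K) (nb K).
    by case: (K == J1); case: (K == J2) => //=;
      case: (side K v) (side K a) (side K t) => [] [] [].
  move=> /(uniq_perm _ (walls_uniq v t))/perm_size; rewrite size_walls => <- //=.
  by rewrite inE andbT; apply/eqP.
have [w S /eqP] : exists2 w, sq v a w b & (d w t).+1 = 1.
  by apply: quadrangle => //; exact: distn_adj.
by rewrite eqSS => /eqP/distn_eq0 <-.
Qed.

Lemma cross_edge J x y : side J x != side J y ->
  exists u v, [/\ across J u v, between x u y & between x v y].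
Proof.
move E : (d x y) => n; elim: n x E => [|n IH] x E h.
  by rewrite (distn_eq0 E) eqxx in h.
have [x' xx' dx'] := distn_step E; have dxx' := distn_adj xx'.
have [e|ne] := eqVneq (side J x) (side J x'); last first.
  exists x, x'; split; first exact/acrossP; rewrite /between ?distn0 //.
  by rewrite dxx' E dx'.
have [|u [v [h1 h2 h3]]] := IH _ dx'; first by rewrite -e.
exists u, v; split=> //; move: h2 h3; rewrite /between => h2 h3; apply/eqP;
  rewrite eqn_leq distn_tri andbT.
  by have := distn_tri x x' u; lia.
by have := distn_tri x x' v; lia.
Qed.

(** If the quadrants are nonempty, gates provide edges of [J1] on both sides of
    [J2]. By convexity the edge of [J2] on a geodesic joining them runs along
    [J1], and spans a square with an edge of [J1]. *)
Lemma transverseP J1 J2 : hyperplane J1 -> hyperplane J2 ->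
  (transverse J1 J2 <-> cross J1 J2).
Proof.
move=> h1 h2; split.
  move=> [ne [Q [e1 [e2 [[SQ Je1 Je2 eQ1 eQ2] np]]]]].
  have E1 := hyperplane_edge h1 Je1.
  have E2 := hyperplane_edge h2 Je2.
  have [v [v1 v2]] : (e1 `&` e2) !=set0.
    by apply/set0P/eqP => e; apply: np; split; [split|right].
  have other e : edge e -> e v -> exists2 a, adj v a & e = [set v; a].
    move=> Ee ev; have [a [b [E _]]] := edgeP Ee; subst e.
    case: ev => ->; first by exists b.
    by exists a; [exact: adj_sym|rewrite setUC].
  have [a va Ea] := other _ E1 v1; have [b vb Eb] := other _ E2 v2; subst e1 e2.
  have ab : a <> b by move=> e; apply: np; subst b; split; [split|left].
  have [|||t S] := square_two_edges SQ _ _ _ va vb ab; try by [apply: eQ1; left|apply: eQ1; right|apply: eQ2; right].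
  have A1 : across J1 v a by apply/acrossP; split=> //; exact/side_edge.
  have A2 : across J2 v b by apply/acrossP; split=> //; exact/side_edge.
  have [[_ at' tb _] _] := S.
  have A3 : across J2 a t.
    apply/acrossP; split=> //; apply/side_edge => //.
    have [p [q [pq E _]]] := sideP h2; move: Je2; rewrite E => /par_trans; apply.
    exact/sq_par/sq_rev.
  have ee (J J' : set (set X)) : J <> J' -> (J == J') = false by move/eqP/negPf.
  move: (A1 J1) (A1 J2) (A2 J1) (A2 J2) (A3 J1) (A3 J2); rewrite !eqxx !ee //; last exact: nesym.
  move=> B1 B2 B3 B4 B5 B6 e e'.
  have [z [z1 z2]] : exists z, (side J1 z = e) /\ (side J2 z = e'); last by exists z.
  move: B1 B2 B3 B4 B5 B6.
  case Hv : (side J1 v); case Hv' : (side J2 v); case Ha : (side J1 a);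
  case Ha' : (side J2 a) => //; case Hb : (side J1 b); case Hb' : (side J2 b) => //;
  case Ht : (side J1 t); case Ht' : (side J2 t) => // *; case: e; case: e';
  first [by exists v|by exists a|by exists b|by exists t].
move=> c; split; first exact: cross_neq.
have H e2 : exists x x', [/\ across J1 x x', side J1 x = true & side J2 x = e2].
  have [x [x1 x2]] := c true e2.
  have [|g hg gate_g] := gate_ex x (@side_convex J1 false); first exact: side_onto.
  have gx K : side K g != side K x -> forall a, side J1 a = false -> side K a = side K g.
    move=> ne a /gate_g/between_side/(_ K) h; move: h ne.
    by case: (side K a) (side K g) (side K x) => [] [] [] // /(_ erefl).
  have [n dn] : exists n, d g x = n.+1.
    case E : (d g x) => [|n]; last by exists n.
    by have := distn_eq0 E; move=> e; rewrite -e hg in x1.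
  have [x' gx' dx'] := distn_step dn.
  have bt : between g x' x by rewrite /between (distn_adj gx') dx' dn.
  have sx' : side J1 x' = true.
    case sx : (side J1 x') => //; have := gate_g _ sx; rewrite /between.
    by rewrite (distn_sym x') (distn_adj gx') dx' dn; lia.
  exists x', g; split=> //.
    by apply/acrossP; split; [exact: adj_sym|rewrite sx' hg].
  have e2g : side J2 g = e2.
    apply/eqP; apply: contraT => ne; have [a [a1 a2]] := c false e2.
    by have := gx J2; rewrite x2 ne => /(_ isT _ a1) E; rewrite -E a2 eqxx in ne.
  by move/between_side: bt => ->; rewrite e2g.
have [x [x' [hx x1 x2]]] := H true; have [y [y' [hy y1 y2]]] := H false.
have [u [v [uv bu bv]]] : exists u v, [/\ across J2 u v, between x u y & between x v y].
  by apply: cross_edge; rewrite x2 y2.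
have e1 : side J1 x = side J1 y by rewrite x1 y1.
have [u' hu] := across_convex hx hy e1 bu; have [v' hv] := across_convex hx hy e1 bv.
have S := across_sq hu uv hv (cross_neq c).
exists [set u; u'; v'; v], [set u; u'], [set u; v]; split.
  split; first by case: S => _ [].
  - by have [a b] := (acrossP _ _ _).1 hu; exact/(side_edge h1 a).
  - by have [a b] := (acrossP _ _ _).1 uv; exact/(side_edge h2 a).
  - by move=> z [] -> /=; tauto.
  - by move=> z [] -> /=; tauto.
move=> [_ [E|]]; last by move/seteqP => [/(_ u) + _]; apply; split; left.
case: (set2_eq E) => -[e e']; first by case: S => _ [].
by have [a _] := (acrossP _ _ _).1 uv; case: (adj_neq a).
Qed.

Lemma disjointP J1 J2 : hyperplane J1 -> hyperplane J2 ->
  (disjoint_hyp J1 J2 <-> J1 <> J2 /\ ~ cross J1 J2).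
Proof. by move=> h1 h2; rewrite /disjoint_hyp transverseP. Qed.

Lemma carrier_ex J e : hyperplane J -> exists2 z, carrier J z & side J z = e.
Proof.
move=> hJ; have [x hx] := side_onto e hJ; have [y hy] := side_onto (~~ e) hJ.
have [|u [v [h _ _]]] := @cross_edge J x y; first by rewrite hx hy; case: (e).
have [uv ne] := (acrossP _ _ _).1 h.
have [eu|eu] := eqVneq (side J u) e; first by exists u => //; apply/carrierP => //; exists v.
exists v; first by apply/carrierP => //; exists u; [exact: adj_sym|rewrite eq_sym].
by move: ne eu; case: side; case: side; case: (e).
Qed.

(** Each of the three hyperplanes has vertices of the carriers of the other two on
    one and the same side, namely outside its halfspace disjoint from theirs. *)
Lemma facing_intro J1 J2 J3 e1 e2 e3 :
  hyperplane J1 -> hyperplane J2 -> hyperplane J3 ->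
  J1 <> J2 -> J1 <> J3 -> J2 <> J3 ->
  (forall z, ~ (side J1 z = e1 /\ side J2 z = e2)) ->
  (forall z, ~ (side J1 z = e1 /\ side J3 z = e3)) ->
  (forall z, ~ (side J2 z = e2 /\ side J3 z = e3)) -> facing_triple J1 J2 J3.
Proof.
have dis J J' e e' : hyperplane J -> hyperplane J' -> J <> J' ->
    (forall z, ~ (side J z = e /\ side J' z = e')) -> disjoint_hyp J J'.
  move=> h h' ne n; apply/disjointP => //; split=> // /(_ e e') [z]; exact: n.
have nsep J J' J'' e e' e'' : hyperplane J -> hyperplane J' -> hyperplane J'' ->
    (forall z, ~ (side J z = e /\ side J' z = e')) ->
    (forall z, ~ (side J z = e /\ side J'' z = e'')) -> ~ separates_hyp J J' J''.
  move=> h h' h'' n n'.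
  have [a Ca a'] := carrier_ex e' h'; have [b Cb b''] := carrier_ex e'' h''.
  rewrite /separates_hyp separatesP; [|by []|by exists a|by exists b].
  move=> [f [/(_ _ Ca) ha /(_ _ Cb) hb]].
  move: (n a) (n' b); rewrite a' b'' ha hb.
  by case: (f); case: (e) => // h1 h2; [apply: h1|apply: h2|apply: h2|apply: h1].
move=> h1 h2 h3 n12 n13 n23 d12 d13 d23; split=> //; split.
  by split; [exact: dis d12|exact: dis d13|exact: dis d23].
have sw (J J' : set (set X)) e e' : (forall z, ~ (side J z = e /\ side J' z = e')) ->
    forall z, ~ (side J' z = e' /\ side J z = e).
  by move=> n z [? ?]; apply: (n z).
split; [exact: nsep d12 d13|exact: nsep (sw _ _ _ _ d12) d23|].
exact: nsep (sw _ _ _ _ d13) (sw _ _ _ _ d23).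
Qed.

(** Otherwise all four quadrants would be nonempty: [x] and [y] lie in two
    opposite ones. *)
Lemma nested J K x y : side J x != side J y -> side K x != side K y -> ~ cross J K ->
  (forall z, side J z = side J y -> side K z = side K y) \/
  (forall z, side K z = side K y -> side J z = side J y).
Proof.
move=> s s' c; apply: contra_notP c => /not_orP [/existsNP [z /not_implyP [z1 z2]]].
move=> /existsNP [w /not_implyP [w1 w2]] e e'.
have [t] : exists t : X, (side J t == side J y) = (e == side J y) /\
     (side K t == side K y) = (e' == side K y).
  case: (e == _); case: (e' == _); first by exists y; rewrite !eqxx.
  - by exists z; rewrite z1 eqxx; split=> //; apply/eqP.
  - by exists w; rewrite w1 eqxx; split=> //; apply/eqP.
  - by exists x; split; apply/negbTE.
move=> t12; exists t; move: t12.
by case: (side J t) (side J y) (side K t) (side K y) e e' => [] [] [] [] [] [] [].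
Qed.

(** The halfspaces around [x] are nested, so the middle hyperplane separates the
    other two. *)
Lemma not_facing J1 J2 J3 x y : side J1 x != side J1 y -> side J2 x != side J2 y ->
  side J3 x != side J3 y -> ~ facing_triple J1 J2 J3.
Proof.
move=> s1 s2 s3 [[h1 h2 h3] [[/(disjointP h1 h2) [n12 c12] /(disjointP h1 h3) [n13 c13]
  /(disjointP h2 h3) [n23 c23]] [S1 S2 S3]]].
have nest J J' : side J x != side J y -> side J' x != side J' y -> ~ cross J J' ->
    (forall z, side J z = side J x -> side J' z = side J' x) \/
    (forall z, side J' z = side J' x -> side J z = side J x).
  by move=> s s'; apply: (@nested J J' y x); rewrite eq_sym.
have mid J J' J'' : hyperplane J -> hyperplane J' -> hyperplane J'' -> J <> J' -> J' <> J'' ->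
    side J' x != side J' y -> side J'' x != side J'' y ->
    (forall z, side J z = side J x -> side J' z = side J' x) ->
    (forall z, side J' z = side J' x -> side J'' z = side J'' x) ->
    separates_hyp J' J J''.
  move=> h h' h'' n n' s' s'' i i'.
  have [a Ca _] := carrier_ex true h; have [b Cb _] := carrier_ex true h''.
  apply/separatesP; [by []|by exists a|by exists b|].
  have edge1 K K' u : hyperplane K -> K <> K' -> carrier K u ->
      exists v, side K' u = side K' v /\ side K u != side K v.
    move=> hK ne /(carrierP _ hK) [v uv s]; exists v; split=> //.
    have /acrossP/(_ K') : adj u v /\ side K u != side K v by [].
    by rewrite (introF eqP (nesym ne)) => /negbFE/eqP.
  exists (side J' x); split=> c.
    move=> /(edge1 _ J' _ h n) [v [e ne]].
    have [ec|ec] := eqVneq (side J c) (side J x); first exact: i.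
    by rewrite e; apply: i; move: ne ec; case: side; case: side; case: side.
  move=> /(edge1 _ J' _ h'' (nesym n')) [v [e ne]].
  have far w : side J'' w != side J'' x -> side J' w = ~~ side J' x.
    have := i' w; case: (side J' w); case: (side J' x) => // /(_ erefl) -> ;
    by rewrite eqxx.
  have [ec|ec] := eqVneq (side J'' c) (side J'' x); last exact: far.
  by rewrite e; apply: far; rewrite -ec eq_sym.
have sepC J J' J'' : hyperplane J -> hyperplane J' -> hyperplane J'' ->
    separates_hyp J J' J'' -> separates_hyp J J'' J'.
  by move=> h h' h'' [D1 [D2 [? ? /nesym ? ? ?]]]; exists D2, D1; split.
have [i12|i21] := nest _ _ s1 s2 c12; have [i13|i31] := nest _ _ s1 s3 c13;
  have [i23|i32] := nest _ _ s2 s3 c23.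
- by apply: S2; exact: (mid _ _ _ h1 h2 h3).
- by apply: S3; exact: (mid _ _ _ h1 h3 h2 n13 (nesym n23)).
- by apply: S2; exact: (mid _ _ _ h1 h2 h3).
- by apply: S1; apply: sepC => //; exact: (mid _ _ _ h3 h1 h2 (nesym n13) n12).
- by apply: S1; exact: (mid _ _ _ h2 h1 h3 (nesym n12) n13).
- by apply: S1; exact: (mid _ _ _ h2 h1 h3 (nesym n12) n13).
- by apply: S3; apply: sepC => //; apply: (mid _ _ _ h2 h3 h1 n23 (nesym n13)).
- by apply: S2; apply: sepC => //; apply: (mid _ _ _ h3 h2 h1 (nesym n23) (nesym n12)).
Qed.

End Distance.

(** * Well-separated hyperplanes and the metric they define *)

Lemma card_set_seq (T : choiceType) (s : seq T) : uniq s -> ([set` s] #= `I_(size s))%card.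
Proof.
move=> us; have -> : [set` s] = [set` [fset x in s]%fset].
  by apply/seteqP; split=> x /=; rewrite inE.
by apply/card_eq_fsetP; rewrite card_fseq undup_id.
Qed.

Lemma card_le_seqP (T : choiceType) (H : set T) n :
  (H #<= `I_n)%card <-> forall s, uniq s -> (forall x, x \in s -> H x) -> size s <= n.
Proof.
split=> [le s us sH|h].
  rewrite -card_le_II; apply: card_le_trans le; apply: card_le_trans (subset_card_le sH).
  by have := card_set_seq us; rewrite card_eq_le => /andP[].
have ex : exists k, `[< exists s : seq T, [/\ uniq s, forall x, x \in s -> H x & size s = k] >].
  by exists 0; apply/asboolP; exists [::].
have ub k : `[< exists s : seq T, [/\ uniq s, forall x, x \in s -> H x & size s = k] >] -> k <= n.
  by move=> /asboolP [s [us sH <-]]; exact: h.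
case: (ex_maxnP ex ub) => k /asboolP [s [us sH ss]] mx.
have HE : H = [set` s].
  apply/seteqP; split=> x Hx; last exact: sH.
  apply: contraT => xs; have : k.+1 <= k; last by rewrite ltnn.
  apply: mx; apply/asboolP; exists (x :: s); split=> /=; first by rewrite xs us.
    by move=> y; rewrite in_cons => /orP[/eqP -> //|/sH].
  by rewrite ss.
rewrite HE; apply: card_le_trans (_ : (`I_(size s) #<= _)%card); last first.
  by rewrite card_le_II h.
by have := card_set_seq us; rewrite card_eq_le => /andP[].
Qed.

Lemma max_ex (T : eqType) (R : T -> T -> Prop) (s : seq T) : s != [::] ->
  (forall x y z, R x y -> R y z -> R x z) ->
  (forall x y, x \in s -> y \in s -> R x y \/ R y x) ->
  exists2 x, x \in s & forall y, y \in s -> R y x.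
Proof.
move=> + tr; case: s => // x s _; elim: s x => [|y s IH] x tot.
  by exists x; rewrite ?inE // => y; rewrite inE => /eqP ->; case: (tot x x); rewrite ?inE.
have tot' a b : a \in y :: s -> b \in y :: s -> R a b \/ R b a.
  by move=> ha hb; apply: tot; rewrite in_cons ?ha ?hb orbT.
have [z zs mz] := IH y tot'.
have xs : x \in [:: x, y & s] by rewrite in_cons eqxx.
have zs' : z \in [:: x, y & s] by rewrite in_cons zs orbT.
have [xz|zx] := tot x z xs zs'.
  by exists z => // a; rewrite in_cons => /orP[/eqP ->|/mz].
exists x => // a; rewrite in_cons => /orP[/eqP ->|/mz az]; last exact: tr zx.
by case: (tot x x xs xs).
Qed.

Section Delta.
Variable X : cube_complex.
Hypothesis hX : CAT0 X.
Implicit Types (x y z a b c m : X) (J K H : set (set X)) (s t : seq (set (set X))).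
Local Notation d := (@distn X).
Local Notation cross := (@cross X).

Lemma cross_of J K x y z w : side J x != side J y -> side K x != side K y ->
  side J z = side J x -> side K z = side K y ->
  side J w = side J y -> side K w = side K x -> cross J K.
Proof.
move=> h1 h2 z1 z2 w1 w2 e e'.
have [t] : exists t : X, (side J t == side J y) = (e == side J y) /\
     (side K t == side K y) = (e' == side K y).
  case: (e == _); case: (e' == _); first by exists y; rewrite !eqxx.
  - by exists w; rewrite w1 w2 eqxx; split=> //; apply/negbTE.
  - by exists z; rewrite z1 z2 eqxx; split=> //; apply/negbTE.
  - by exists x; split; apply/negbTE.
move=> t12; exists t; move: t12.
by case: (side J t) (side J y) (side K t) (side K y) e e' => [] [] [] [] [] [] [].
Qed.

Lemma ws_disjoint L J K : hyperplane J -> hyperplane K ->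
  well_separated L J K -> J <> K /\ ~ cross J K.
Proof. by move=> hJ hK [/(disjointP hX hJ hK)]. Qed.

Lemma ws_sym L J K : hyperplane J -> hyperplane K ->
  well_separated L J K -> well_separated L K J.
Proof.
move=> hJ hK [/(disjointP hX hJ hK) [ne nc] h]; split.
  by apply/disjointP => //; split; [exact: nesym|move=> /cross_sym].
by move=> F hF; apply: h => J' /hF [].
Qed.

(** Hyperplanes separating two given vertices contain no facing triple. *)
Lemma ws_card L J K s x y : hyperplane J -> hyperplane K -> well_separated L J K ->
  uniq s -> (forall H, H \in s -> cross H J /\ cross H K) ->
  (forall H, H \in s -> side H x != side H y) -> size s <= L.
Proof.
move=> hJ hK [_ ws] us cs sep.
suff /card_le_seqP : ([set` s] #<= `I_L)%card by apply.
apply: ws => [H /= Hs|].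
  have [c1 c2] := cs _ Hs; have hH := cross_hyp c1.
  by split=> //; apply/transverseP.
move=> [H1 [H2 [H3 [/sep h1 /sep h2 /sep h3]]]].
exact: not_facing h1 h2 h3.
Qed.

Lemma ws_intro L J K : hyperplane J -> hyperplane K -> J <> K -> ~ cross J K ->
  (forall s, uniq s -> (forall H, H \in s -> cross H J /\ cross H K) ->
    (forall H1 H2 H3, H1 \in s -> H2 \in s -> H3 \in s -> ~ facing_triple H1 H2 H3) ->
    size s <= L) ->
  well_separated L J K.
Proof.
move=> hJ hK ne nc h; split; first exact/disjointP.
move=> F hF nf; apply/card_le_seqP => s us sF; apply: h => // [H|H1 H2 H3 h1 h2 h3 f].
  by move=> /sF/hF [hH]; rewrite !transverseP.
by apply: nf; exists H1, H2, H3; split=> //; exact: sF.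
Qed.

Lemma ws_between L J K J' K' : hyperplane J -> hyperplane K -> hyperplane J' -> hyperplane K' ->
  well_separated L J K -> J' <> K' -> ~ cross J' K' ->
  (forall H, cross H J' -> cross H K' -> cross H J /\ cross H K) ->
  well_separated L J' K'.
Proof.
move=> hJ hK hJ' hK' [_ ws] ne nc h; split; first exact/disjointP.
move=> F hF nf; apply: ws => // H /hF [hH].
move=> /(transverseP hX hH hJ') c1 /(transverseP hX hH hK') c2.
by have [? ?] := h _ c1 c2; split=> //; apply/transverseP.
Qed.

(** The families defining [deltan], as duplicate-free lists; they are finite since
    finitely many hyperplanes separate two vertices. *)
Definition sepfam L x y s : Prop :=
  [/\ uniq s, forall J, J \in s -> side J x != side J y
    & forall J K, J \in s -> K \in s -> J <> K -> well_separated L J K].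

Lemma deltanP L x y : (exists2 s, sepfam L x y s & size s = deltan L x y) /\
  (forall s, sepfam L x y s -> size s <= deltan L x y).
Proof.
have fam s : sepfam L x y s -> separating_family L x y [set` s] /\ ([set` s] #= `I_(size s))%card.
  move=> [us ss ws]; split; last exact: card_set_seq.
  split=> [J /= /ss h|J K]; last exact: ws.
  have hJ := side_hyp h; split=> //; exact/separates1P.
have unfam (H : set (set (set X))) : separating_family L x y H ->
    exists2 s, sepfam L x y s & H = [set` s].
  move=> [h1 h2]; exists [seq J <- walls hX x y | `[< H J >]].
    split; first by rewrite filter_uniq ?walls_uniq.
      by move=> J; rewrite mem_filter mem_walls => /andP[].
    by move=> J K; rewrite !mem_filter => /andP[/asboolP hJ _] /andP[/asboolP hK _]; exact: h2.
  apply/seteqP; split=> J /=; rewrite mem_filter mem_walls; last by case/andP => /asboolP.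
  move=> HJ; have [hJ] := h1 _ HJ; rewrite separates1P // => ->.
  by rewrite andbT; apply/asboolP.
have P : [set n | (exists2 F, separating_family L x y F & (F #= `I_n)%card) /\
    forall (F : set (set (set X))) k, separating_family L x y F -> (F #= `I_k)%card -> k <= n] (deltan L x y).
  rewrite /deltan; apply: xgetPex.
  have ex : exists n, `[< exists2 s, sepfam L x y s & size s = n >].
    by exists 0; apply/asboolP; exists [::].
  have ub n : `[< exists2 s, sepfam L x y s & size s = n >] -> n <= d x y.
    move=> /asboolP [s [us ss _] <-]; exact: distn_ge.
  case: (ex_maxnP ex ub) => n /asboolP [s hs <-] mx; exists (size s); split.
    by have [h1 h2] := fam _ hs; exists [set` s].
  move=> F k /unfam [t ht ->] e; have [_ e'] := fam _ ht.
  have <- : size t = k.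
    by apply/card_eq_II; apply: card_eq_trans e; rewrite card_eq_sym.
  by apply: mx; apply/asboolP; exists t.
case: P => -[F /unfam [s hs ->] e] mx; split.
  exists s => //; have [_ e'] := fam _ hs.
  by apply/card_eq_II; apply: card_eq_trans e; rewrite card_eq_sym.
by move=> t /fam [h1 h2]; exact: mx h1 h2.
Qed.

Lemma deltan_ex L x y : exists2 s, sepfam L x y s & size s = deltan L x y.
Proof. by case: (deltanP L x y). Qed.

Lemma deltan_ge L x y s : sepfam L x y s -> size s <= deltan L x y.
Proof. by case: (deltanP L x y) => _; apply. Qed.

Lemma deltan_sym L x y : deltan L x y = deltan L y x.
Proof.
suff H (u v : X) : deltan L u v <= deltan L v u by apply/eqP; rewrite eqn_leq !H.
have [s [us ss ws] <-] := deltan_ex L u v; apply: deltan_ge; split=> // J.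
by rewrite eq_sym; exact: ss.
Qed.

Lemma deltan_le L x y : deltan L x y <= d x y.
Proof. by have [s [us ss _] <-] := deltan_ex L x y; exact: distn_ge. Qed.

Lemma deltan_eq0 L x y : deltan L x y = 0 <-> x = y.
Proof.
split=> [e|->]; last by apply/eqP; rewrite -leqn0 -(distn0 hX y) deltan_le.
apply: (side_inj hX) => J; apply/eqP; apply: contraT => ne.
suff : 1 <= deltan L x y by rewrite e.
apply: (@deltan_ge _ _ _ [:: J]); split=> // [K|K H].
  by rewrite mem_seq1 => /eqP ->.
by rewrite !mem_seq1 => /eqP -> /eqP ->.
Qed.

Lemma sepfam_sub L x y x' y' s : sepfam L x y s ->
  sepfam L x' y' [seq J <- s | side J x' != side J y'].
Proof.
move=> [us ss ws]; split; first exact: filter_uniq.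
  by move=> J; rewrite mem_filter => /andP[].
by move=> J K; rewrite !mem_filter => /andP[_ hJ] /andP[_ hK]; exact: ws.
Qed.

Lemma deltan_tri L x y z : deltan L x z <= deltan L x y + deltan L y z.
Proof.
have [s hs <-] := deltan_ex L x z.
apply: leq_trans (leq_add (deltan_ge (sepfam_sub x y hs)) (deltan_ge (sepfam_sub y z hs))).
rewrite !size_filter -count_predUI -[size s](count_predT).
apply: leq_trans (leq_addr _ _).
case: hs => _ ss _; rewrite !count_predT -size_filter (_ : [seq _ <- s | _] = s) //.
apply/all_filterP/allP => J /ss /=.
by case: (side J x) (side J y) (side J z) => [] [] [].
Qed.

Fact deltan_between_arith (a a' b b' L D : nat) :
  b <= b' + L -> a = a'.+2 -> a' + b' <= D -> a + b <= D + L.+2.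
Proof. lia. Qed.

(** Of a family for [x], [m] the two hyperplanes closest to [m] are dropped. The
    last one but one crosses at most [L] hyperplanes of a family for [m], [y]; it
    separates the remaining hyperplanes of the two families, which are therefore
    pairwise well-separated. *)
Lemma deltan_between L x m y : between x m y ->
  deltan L x m + deltan L m y <= deltan L x y + L.+2.
Proof.
move=> /(between_side hX) bt; have [s hs <-] := deltan_ex L x m.
have [t ht <-] := deltan_ex L m y; have [us ss ws] := hs; have [ut st wt] := ht.
have ms J : J \in s -> side J m = side J y /\ side J x != side J y.
  move=> /ss; have := bt J.
  by case: (side J x) (side J m) (side J y) => [] [] [] // /(_ erefl).
have mt J : J \in t -> side J m = side J x /\ side J x != side J y.
  move=> /st; have := bt J.
  by case: (side J x) (side J m) (side J y) => [] [] [] // /(_ erefl).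
have tge : size t <= deltan L x y.
  by apply: deltan_ge; split=> // J /mt [].
have [s1|s1] := leqP (size s) 1; first by lia.
pose R J K := forall z, side K z = side K y -> side J z = side J y.
have Rtr J K H : R J K -> R K H -> R J H by move=> h h' z /h'/h.
have Rtot r J K : subseq r s -> J \in r -> K \in r -> R J K \/ R K J.
  move=> sr /(mem_subseq sr) hJ /(mem_subseq sr) hK.
  have [->|/eqP ne] := eqVneq J K; first by left.
  have [_ s1'] := ms _ hJ; have [_ s2'] := ms _ hK.
  have [_ c] := ws_disjoint (side_hyp s1') (side_hyp s2') (ws _ _ hJ hK ne).
  by have [?|?] := nested s1' s2' c; [right|left].
have sn : s != [::] by case: (s) s1.
have [B Bs maxB] := max_ex sn Rtr (fun J K => Rtot s J K (subseq_refl s)).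
have rn : rem B s != [::] by rewrite -size_eq0 size_rem //; move: s1; case: (size s) => [|[|]].
have [A Ar maxA] := max_ex rn Rtr (fun J K => Rtot _ J K (rem_subseq B s)).
have As : A \in s := mem_rem Ar.
have AB : A <> B.
  by move=> e; move: Ar; rewrite e mem_rem_uniq // inE eqxx.
have [Am Axy] := ms _ As; have [Bm Bxy] := ms _ Bs.
have hA := side_hyp Axy; have hB := side_hyp Bxy.
set s' := rem A (rem B s).
have s's J : J \in s' -> J \in s by move=> /mem_rem/mem_rem.
have s'A J : J \in s' -> J <> A.
  by move=> + e; rewrite e mem_rem_uniq ?rem_uniq // inE eqxx.
(* [A] crosses the hyperplanes of [t] that are dropped, and then so does [B],
   which lies between [A] and [m]. *)
set t' := [seq K <- t | ~~ `[< cross K A >]].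
have ct : size [seq K <- t | `[< cross K A >]] <= L.
  apply: (@ws_card L A B _ m y) => //; first exact: ws.
  - exact: filter_uniq.
  - move=> K; rewrite mem_filter => /andP[/asboolP c Kt]; split=> //.
    have [Km Kxy] := mt _ Kt.
    have [z [z1 z2]] := c (side K y) (side A x).
    apply: (@cross_of K B x y m z) => //.
    have : side B z <> side B y by move=> /(maxB A As) e; rewrite -z2 e eqxx in Axy.
    by move: Bxy; case: side; case: side; case: side.
  - by move=> K; rewrite mem_filter => /andP[_ /st].
have st' : size t <= size t' + L.
  rewrite -(count_predC (fun K => `[< cross K A >]) t) -!size_filter addnC.
  exact: leq_add (leqnn _) ct.
have ss' : size s = (size s').+2.
  by rewrite !size_rem //; move: s1; case: (size s) => [|[|]].
suff : size (s' ++ t') <= deltan L x y.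
  by rewrite size_cat; exact: deltan_between_arith st' ss'.
have nest_st J K : J \in s' -> K \in t' -> [/\ J <> K, ~ cross J K & well_separated L J K].
  move=> Js'; rewrite mem_filter => /andP[/asboolP nc Kt].
  have Js := s's _ Js'; have [Jm Jxy] := ms _ Js; have [Km Kxy] := mt _ Kt.
  have hJ := side_hyp Jxy; have hK := side_hyp Kxy.
  have RJA : R J A by apply: maxA; exact: mem_rem Js'.
  have out z : side J z = side J x -> side A z = side A x.
    move=> e; have : side A z <> side A y.
      by move=> /RJA e'; move: Jxy; rewrite -e e' eqxx.
    by move: Axy; case: side; case: side; case: side.
  have inA z : side K z = side K y -> side A z = side A y.
    move=> e; apply/eqP; apply: contraT => ne; case: nc.
    apply: (@cross_of K A x y m z) => //.
    by move: ne Axy; case: side; case: side; case: side.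
  have JK : J <> K by move=> e; move: Jxy; rewrite -Jm e Km eqxx.
  have ncJK : ~ cross J K.
    move=> /(_ (side J x) (side K y)) [z [/out z1 /inA z2]].
    by move: Axy; rewrite -z1 -z2 eqxx.
  split=> //; apply: (@ws_between L J A) => //; first by apply: ws => //; exact: s'A.
  move=> H c1 c2; split=> // e e'.
  have [->|ne] := eqVneq e' (side A x).
    by have [z [z1 /out z2]] := c1 e (side J x); exists z.
  have -> : e' = side A y by move: ne Axy; case: side; case: side; case: e'.
  by have [z [z1 /inA z2]] := c2 e (side K y); exists z.
apply: deltan_ge; split.
- rewrite cat_uniq !rem_uniq // filter_uniq // andbT /=.
  by apply/hasPn => K Kt; apply/negP => Ks; have [] := nest_st _ _ Ks Kt.
- move=> J; rewrite mem_cat => /orP[/s's/ms [] //|].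
  by rewrite mem_filter => /andP[_ /mt []].
- move=> J K; rewrite !mem_cat => /orP[hJ|hJ] /orP[hK|hK] ne.
  + by apply: ws => //; exact: s's.
  + by have [] := nest_st _ _ hJ hK.
  + have [_ _ h] := nest_st _ _ hK hJ; apply: ws_sym h.
      by have [_ /side_hyp] := ms _ (s's _ hK).
    by move: hJ; rewrite mem_filter => /andP[_ /mt [_ /side_hyp]].
  + by move: hJ hK; rewrite !mem_filter => /andP[_ ?] /andP[_ ?]; exact: wt.
Qed.

(** [x'] is the vertex at which [x] attaches to the convex hull of [a], [b]
    and [c]: a hyperplane separates it from [x] exactly when it separates [x]
    from all three of them. *)
Definition is_foot x' x a b c : Prop := forall J,
  side J x' = maj (side J x) (side J a) (maj (side J x) (side J b) (side J c)).

Lemma foot_ex x a b c : exists x', is_foot x' x a b c.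
Proof. by exists (med hX x a (med hX x b c)) => J; rewrite !side_med. Qed.

(** The hyperplanes separating the ends of a diagonal of the box spanned by the
    feet split the four points in two ways, and two hyperplanes of different types
    cross. A pairwise disjoint family therefore has a single type, and also
    separates the ends of two opposite sides of the box. *)
Lemma deltan_box L (p q r s p' q' r' s' : X) :
  is_foot p' p q r s -> is_foot q' q p r s -> is_foot r' r p q s -> is_foot s' s p q r ->
  (deltan L p' r' <= deltan L p' q' /\ deltan L p' r' <= deltan L r' s') \/
  (deltan L p' r' <= deltan L p' s' /\ deltan L p' r' <= deltan L q' r').
Proof.
move=> fp fq fr fs.
have typ J : side J p' != side J r' ->
    (side J p' = side J q' /\ side J s' = side J r') \/
    (side J p' = side J s' /\ side J q' = side J r').
  move: (fp J) (fq J) (fr J) (fs J).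
  case: (side J p) (side J q) (side J r) (side J s) => [] [] [] [] -> -> -> -> //= _;
    by [left|right].
move: fp fq fr fs => _ _ _ _; have [F [uF sF wF] <-] := deltan_ex L p' r'.
have fam (x y : X) : (forall J, J \in F -> side J x != side J y) -> size F <= deltan L x y.
  by move=> h; apply: deltan_ge; split.
have [h|] := pselect (forall J, J \in F -> side J p' = side J s' /\ side J q' = side J r').
  left; split; apply: fam => J JF; have [e1 e2] := h _ JF; have ne := sF _ JF.
    by rewrite e2.
  by rewrite -e1 eq_sym.
move=> /existsNP [J /not_implyP [JF nJ]]; have sJ := sF _ JF.
have [[a1 a2]|//] := typ _ sJ; right.
suff h K : K \in F -> side K p' = side K q' /\ side K s' = side K r'.
  split; apply: fam => K KF; have [e1 e2] := h _ KF; have ne := sF _ KF.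
    by rewrite e2.
  by rewrite -e1.
move=> KF; have [//|[b1 b2]] := typ _ (sF _ KF); exfalso.
have JK : J <> K by move=> e; apply: nJ; rewrite e.
have [_] := ws_disjoint (side_hyp sJ) (side_hyp (sF _ KF)) (wF _ _ JF KF JK).
apply; apply: (@cross_of J K p' r' q' s') => //; exact: sF.
Qed.

Fact deltan_hyp_arith M d1 d2 e1 e2 e3 e4 pp qq rr ss pr qs pq rs ps qr :
  (d1 <= e1 /\ d1 <= e2) \/ (d1 <= e3 /\ d1 <= e4) ->
  (d2 <= e4 /\ d2 <= e3) \/ (d2 <= e1 /\ d2 <= e2) ->
  pr <= pp + d1 + rr -> qs <= qq + d2 + ss ->
  pp + e1 + qq <= pq + M -> rr + e2 + ss <= rs + M ->
  pp + e3 + ss <= ps + M -> qq + e4 + rr <= qr + M ->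
  pr + qs <= maxn (pq + rs) (ps + qr) + 2 * M.
Proof.
move=> h1 h2 u1 u2 l1 l2 l3 l4; rewrite addn_maxl leq_max.
have [h|h] : d1 + d2 <= e1 + e2 \/ d1 + d2 <= e3 + e4.
  by clear -h1 h2; lia.
  by apply/orP; left; clear -h u1 u2 l1 l2; lia.
by apply/orP; right; clear -h u1 u2 l3 l4; lia.
Qed.

(** Geodesics join the points through their feet, so by [deltan_between] the
    inequality reduces to the one for the box. *)
Lemma deltan_hyp L (p q r s : X) :
  deltan L p r + deltan L q s <=
  maxn (deltan L p q + deltan L r s) (deltan L p s + deltan L q r) + 2 * (2 * (L + 2)).
Proof.
have [p' fp] := foot_ex p q r s; have [q' fq] := foot_ex q p r s.
have [r' fr] := foot_ex r p q s; have [s' fs] := foot_ex s p q r.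
have bt x x' y : (forall J, side J x = side J y -> side J x' = side J x) -> between x x' y.
  by move=> h; apply/(between_side hX).
have up x x' y' y : deltan L x y <= deltan L x x' + deltan L x' y' + deltan L y y'.
  rewrite -addnA; apply: leq_trans (deltan_tri L x x' y) _; rewrite leq_add2l.
  by rewrite (deltan_sym L y); exact: deltan_tri.
have low x x' y' y : between x x' y -> between x' y' y ->
    deltan L x x' + deltan L x' y' + deltan L y y' <= deltan L x y + 2 * (L + 2).
  move=> /(deltan_between L) h1 /(deltan_between L); rewrite (deltan_sym L y).
  move: h1; move: (deltan L x x') (deltan L x' y') (deltan L y' y) (deltan L x' y) (deltan L x y).
  by clear; lia.
have b2 := deltan_box L fp fq fr fs.
have b3 : (deltan L q' s' <= deltan L q' r' /\ deltan L q' s' <= deltan L p' s') \/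
  (deltan L q' s' <= deltan L p' q' /\ deltan L q' s' <= deltan L r' s').
  rewrite (deltan_sym L p' s') (deltan_sym L p' q').
  apply: (@deltan_box L q r s p) => J; rewrite ?fp ?fq ?fr ?fs;
    by case: (side J p) (side J q) (side J r) (side J s) => [] [] [] [].
apply: deltan_hyp_arith b2 b3 (up _ _ _ _) (up _ _ _ _) _ _ _ _; apply: low; apply: bt => J;
  rewrite ?fp ?fq ?fr ?fs; by case: (side J p) (side J q) (side J r) (side J s) => [] [] [] [].
Qed.

End Delta.

(** * Isometries *)

Section Isometries.
Variable X : cube_complex.
Hypothesis hX : CAT0 X.
Implicit Types (x y z a b c : X) (J K H : set (set X)) (g h : isom X).
Local Notation d := (@distn X).

Lemma image_inv g (A : set X) : isom_inv g @` (g @` A) = A.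
Proof.
rewrite image_comp; apply/seteqP; split=> [_ [x Ax <-]|x Ax] /=.
  by rewrite isom_funK.
by exists x => //=; rewrite isom_funK.
Qed.

Lemma image_fun g (A : set X) : g @` (isom_inv g @` A) = A.
Proof.
rewrite image_comp; apply/seteqP; split=> [_ [x Ax <-]|x Ax] /=.
  by rewrite isom_invK.
by exists x => //=; rewrite isom_invK.
Qed.

Lemma inv_cube g (Q : set X) : cube (isom_inv g @` Q) <-> cube Q.
Proof. by rewrite -(isom_cube g) image_fun. Qed.

Definition inv_isom g : isom X := Isom (isom_invK g) (isom_funK g) (inv_cube g).

Lemma id_cube (Q : set X) : cube ((fun x => x) @` Q) <-> cube Q.
Proof. by rewrite image_id. Qed.

Definition id_isom : isom X := @Isom X id id (fun=> erefl) (fun=> erefl) id_cube.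

Lemma comp_cube g h (Q : set X) : cube ((g \o h) @` Q) <-> cube Q.
Proof. by rewrite -image_comp !isom_cube. Qed.

Definition comp_isom g h : isom X := Isom (can_comp (isom_funK g) (isom_funK h))
  (can_comp (isom_invK h) (isom_invK g)) (comp_cube g h).

Definition pow_isom g (n : int) : isom X :=
  match n with
  | Posz k => iter k (comp_isom g) id_isom
  | Negz k => iter k.+1 (comp_isom (inv_isom g)) id_isom
  end.

Lemma pow_isomE g n x : pow_isom g n x = isom_pow g n x.
Proof.
case: n => k /=; first by elim: k => //= k ->.
by congr (isom_inv g _); elim: k => //= k ->.
Qed.

Lemma isom_powS g (n : int) x : isom_pow g (n + 1)%R x = g (isom_pow g n x).
Proof.
case: n => k; first by rewrite addrC.
case: k => [|k]; first by rewrite /= isom_invK.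
have -> : (Negz k.+1 + 1)%R = Negz k by lia.
by rewrite /= isom_invK.
Qed.

Lemma isom_powN1 g (n : int) x : isom_pow g (n - 1)%R x = isom_inv g (isom_pow g n x).
Proof. by rewrite -[in RHS](subrK 1%R n) isom_powS isom_funK. Qed.

Lemma isom_powD g (m n : int) x : isom_pow g (m + n)%R x = isom_pow g m (isom_pow g n x).
Proof.
elim/int_rec: m => [|m IH|m IH]; first by rewrite add0r.
  by rewrite -addn1 PoszD addrAC !isom_powS IH.
by rewrite -addn1 PoszD opprD addrAC !isom_powN1 IH.
Qed.

Lemma chart_image g n (ch : {ffun 'I_n -> bool} -> X) (Q : set X) :
  cube_chart (@cube X) ch Q -> cube_chart (@cube X) (g \o ch) (g @` Q).
Proof.
move=> [inj QE face]; split.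
- by apply: inj_comp inj; exact: can_inj (isom_funK g).
- by rewrite QE image_comp.
- move=> A AQ; rewrite -{1}(image_fun g A) isom_cube face; last first.
    by rewrite -(image_inv g Q); exact: image_subset.
  split=> -[S [w E]]; exists S, w; first by rewrite -image_comp -E image_fun.
  by rewrite E -image_comp image_inv.
Qed.

Lemma cube_dim_image g n (Q : set X) : cube_dim n Q -> cube_dim n (g @` Q).
Proof.
move=> [cQ [ch h]]; split; first exact/isom_cube.
by exists (g \o ch); exact: chart_image.
Qed.

Lemma adj_image g x y : adj x y -> adj (g x) (g y).
Proof. by move=> /(cube_dim_image g); rewrite image_setU !image_set1. Qed.

Lemma parallel_image g (Q e f : set X) : parallel_in Q e f ->
  parallel_in (g @` Q) (g @` e) (g @` f).
Proof.
move=> [[h1 h2 h3 h4 h5] h6]; split.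
  by split; [exact: cube_dim_image..|exact: image_subset|exact: image_subset].
case: h6 => [->|h6]; [by left|right; apply/seteqP; split=> // _ [[x ex <-] [y fy]]].
move=> /(can_inj (isom_funK g)) E; have : (e `&` f) x by split; rewrite // -E.
by rewrite h6.
Qed.

Lemma par_image g (e f : set X) : par e f -> par (g @` e) (g @` f).
Proof.
elim=> {e f} [e f [Q h]|e|e f k _ IH1 _ IH2].
- by apply: rt_step; exists (g @` Q); exact: parallel_image.
- exact: rt_refl.
- exact: rt_trans IH1 IH2.
Qed.

(** The induced map on sets of edges, in particular on hyperplanes. *)
Definition imgw (f : X -> X) J : set (set X) := (fun e => f @` e) @` J.

Lemma imgw_comp (f f' : X -> X) J : imgw f (imgw f' J) = imgw (f \o f') J.
Proof.
rewrite /imgw image_comp; congr (image J _); apply/funext => e /=.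
by rewrite image_comp.
Qed.

Lemma imgw_id (f : X -> X) J : f =1 id -> imgw f J = J.
Proof.
move=> /funext ->; rewrite /imgw; apply/seteqP; split=> [_ [e Je <-]|e Je].
  by rewrite image_id.
by exists e => //; rewrite image_id.
Qed.

Lemma imgwK g : cancel (imgw g) (imgw (isom_inv g)).
Proof. by move=> J; rewrite imgw_comp imgw_id // => x /=; rewrite isom_funK. Qed.

Lemma imgwVK g : cancel (imgw (isom_inv g)) (imgw g).
Proof. by move=> J; rewrite imgw_comp imgw_id // => x /=; rewrite isom_invK. Qed.

Lemma hyp_image g a b : imgw g (edge_class a b) = edge_class (g a) (g b).
Proof.
apply/seteqP; split=> [_ [e /(par_image g) + <-]|e].
  by rewrite image_setU !image_set1.
move=> /(par_image (inv_isom g)); rewrite image_setU !image_set1 /= !isom_funK => h.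
by exists (isom_inv g @` e) => //; rewrite image_fun.
Qed.

Lemma hyperplane_image g J : hyperplane J -> hyperplane (imgw g J).
Proof.
move=> /hyperplaneP [a [b [ab ->]]]; apply/hyperplaneP; exists (g a), (g b).
by split; [exact: adj_image|exact: hyp_image].
Qed.

Lemma distn_image g x y : d (g x) (g y) = d x y.
Proof.
have H (k : isom X) (u v : X) : d (k u) (k v) <= d u v.
  move E : (d u v) => n; elim: n u E => [|n IH] u E.
    by rewrite (distn_eq0 hX E) distn0.
  have [u' uu' du'] := distn_step hX E.
  apply: leq_trans (distn_tri hX _ (k u') _) _.
  by rewrite (distn_adj hX (adj_image k uu')) add1n ltnS IH.
apply/eqP; rewrite eqn_leq H /=.
by have := H (inv_isom g) (g x) (g y); rewrite /= !isom_funK.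
Qed.

(** The sides of [J] and of its image are chosen independently, so only the
    relation of being on the same side is preserved. *)
Lemma side_image g J x y :
  (side (imgw g J) (g x) == side (imgw g J) (g y)) = (side J x == side J y).
Proof.
have [hJ|nJ] := pselect (hyperplane J); last first.
  have nJ' : ~ hyperplane (imgw g J).
    by move=> /(hyperplane_image (inv_isom g)); rewrite /= imgwK.
  have H K (u v : X) : ~ hyperplane K -> (side K u == side K v).
    by move=> nK; apply/negPn/negP => /side_hyp.
  by rewrite !H.
have [a [b [ab E sE]]] := sideP hJ.
have hgJ := hyperplane_image g hJ; have gab := adj_image g ab.
have : side (imgw g J) (g a) != side (imgw g J) (g b).
  apply/(side_edge hX hgJ gab); rewrite E hyp_image; exact: par_refl.
move=> /(edge_closer hX _ gab) h.
rewrite sE; have <- : closer (g a) (g b) (g x) = closer a b x.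
  by rewrite /closer !distn_image.
have <- : closer (g a) (g b) (g y) = closer a b y by rewrite /closer !distn_image.
by rewrite !h; case: side; case: side; case: side.
Qed.

Lemma imgw_inj g : injective (imgw g).
Proof. exact: can_inj (imgwK g). Qed.

Lemma side_imageV g J x y :
  (side (imgw g J) x == side (imgw g J) y) = (side J (isom_inv g x) == side J (isom_inv g y)).
Proof. by have := side_image g J (isom_inv g x) (isom_inv g y); rewrite !isom_invK. Qed.

Lemma cross_image g J K : cross (imgw g J) (imgw g K) <-> cross J K.
Proof.
have H (k : isom X) J' K' : cross J' K' -> cross (imgw k J') (imgw k K').
  move=> c e e'; have [u [hu hu']] := c true true.
  have [t [t1 t2]] := c (e == side (imgw k J') (k u)) (e' == side (imgw k K') (k u)).
  have := side_image k J' u t; have := side_image k K' u t.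
  rewrite hu hu' t1 t2 => h1 h2; exists (k t); split.
    by move: h2; case: e {t1 t2 h1}; case: side; case: side.
  by move: h1; case: e' {t1 t2 h2}; case: side; case: side.
by split=> [/(H (inv_isom g))|]; [rewrite /= !imgwK|exact: H].
Qed.

Lemma separates_hyp_image g J K H : hyperplane J -> hyperplane K -> hyperplane H ->
  separates_hyp J K H -> separates_hyp (imgw g J) (imgw g K) (imgw g H).
Proof.
move=> hJ hK hH.
have cI K' z : hyperplane K' -> carrier (imgw g K') z -> carrier K' (isom_inv g z).
  move=> hK' /(carrierP hX _ (hyperplane_image g hK')) [z' zz' s].
  apply/carrierP => //; exists (isom_inv g z'); first exact: (adj_image (inv_isom g)).
  by rewrite -side_imageV.
have ne K' : hyperplane K' -> carrier K' !=set0.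
  by move=> hK'; have [z] := carrier_ex hX true hK'; exists z.
move=> /(separatesP hX hJ (ne _ hK) (ne _ hH)) [e [h1 h2]].
have hgJ := hyperplane_image g hJ.
have ngK := ne _ (hyperplane_image g hK); have ngH := ne _ (hyperplane_image g hH).
apply/separatesP => //; have [k Ck] := ngK.
exists (side (imgw g J) k); split=> u.
  move=> Cu; apply/eqP; rewrite side_imageV h1 ?h1 //; exact: cI.
move=> Cu; suff : side (imgw g J) u != side (imgw g J) k by case: side; case: side.
rewrite side_imageV (h1 (isom_inv g k)) ?(h2 (isom_inv g u)); [by case: (e)|exact: cI..].
Qed.

Lemma facing_image g J1 J2 J3 :
  facing_triple (imgw g J1) (imgw g J2) (imgw g J3) -> facing_triple J1 J2 J3.
Proof.
have hI J : hyperplane (imgw g J) -> hyperplane J.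
  by move=> /(hyperplane_image (inv_isom g)); rewrite /= imgwK.
move=> [[/hI h1 /hI h2 /hI h3] [[d12 d13 d23] [s1 s2 s3]]]; split=> //.
have dI J K : hyperplane J -> hyperplane K ->
    disjoint_hyp (imgw g J) (imgw g K) -> disjoint_hyp J K.
  move=> hJ hK /(disjointP hX (hyperplane_image g hJ) (hyperplane_image g hK)) [ne nc].
  by apply/disjointP => //; split=> [E|/(cross_image g)//]; apply: ne; rewrite E.
split; first by split; exact: dI.
by split=> s; [apply: s1|apply: s2|apply: s3]; exact: separates_hyp_image.
Qed.

Lemma ws_image L g J K : hyperplane J -> hyperplane K -> well_separated L J K ->
  well_separated L (imgw g J) (imgw g K).
Proof.
move=> hJ hK ws; have [ne nc] := ws_disjoint hX hJ hK ws.
apply: ws_intro => //; try exact: hyperplane_image.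
- by move=> /imgw_inj.
- by move=> /cross_image.
move=> s us cs nf; rewrite -(size_map (imgw (isom_inv g))).
case: ws => _ ws.
suff /card_le_seqP : ([set` [seq imgw (isom_inv g) H | H <- s]] #<= `I_L)%card.
  by apply=> //; rewrite map_inj_uniq //; exact: can_inj (imgwVK g).
apply: ws => [H /= /mapP [H' /cs [c1 c2] ->]|].
  have cI M : hyperplane M -> cross H' (imgw g M) -> cross (imgw (isom_inv g) H') M.
    by move=> hM c; apply/(cross_image g); rewrite imgwVK.
  have c1' := cI _ hJ c1; have c2' := cI _ hK c2; have hH := cross_hyp c1'.
  by split=> //; apply/transverseP.
move=> [H1 [H2 [H3 [/mapP [K1 k1 ->] /mapP [K2 k2 ->] /mapP [K3 k3 ->]]]]].
by move=> /(@facing_image (inv_isom g)); exact: nf.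
Qed.

Lemma sepfam_image L g x y s : sepfam L x y s ->
  sepfam L (g x) (g y) [seq imgw g J | J <- s].
Proof.
move=> [us ss ws]; split.
- by rewrite map_inj_uniq //; exact: imgw_inj.
- by move=> J /mapP [J' /ss h ->]; rewrite side_image.
move=> J K /mapP [J' hJ ->] /mapP [K' hK ->] ne.
apply: ws_image; try exact: (side_hyp (ss _ _)).
by apply: ws => // E; apply: ne; rewrite E.
Qed.

Lemma deltan_image L g x y : deltan L (g x) (g y) = deltan L x y.
Proof.
have H (k : isom X) (u v : X) : deltan L u v <= deltan L (k u) (k v).
  have [s hs <-] := deltan_ex hX L u v.
  by rewrite -(size_map (imgw k)); exact/deltan_ge/sepfam_image.
apply/eqP; rewrite eqn_leq H /= andbT.
by have := H (inv_isom g) (g x) (g y); rewrite /= !isom_funK.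
Qed.

End Isometries.

(** * Acylindricity *)

Section Acylindricity.
Variable X : cube_complex.
Hypothesis hX : CAT0 X.
Implicit Types (x y z a b c : X) (J K H : set (set X)).
Local Notation d := (@distn X).

Lemma closest_pair (A B : set X) : A !=set0 -> B !=set0 ->
  exists a b, [/\ A a, B b & forall a' b', A a' -> B b' -> d a b <= d a' b'].
Proof.
move=> [a Aa] [b Bb].
have ex : exists n, `[< exists a b, [/\ A a, B b & d a b = n] >].
  by exists (d a b); apply/asboolP; exists a, b.
case: (ex_minnP ex) => n /asboolP [a' [b' [Aa' Bb' <-]]] h; exists a', b'; split=> //.
by move=> a2 b2 h1 h2; apply: h; apply/asboolP; exists a2, b2.
Qed.

(** Each vertex of a closest pair is the gate of the other one. *)
Lemma closest_sep (A B : set X) a b H : convex A -> convex B -> A a -> B b ->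
  (forall a' b', A a' -> B b' -> d a b <= d a' b') -> side H a != side H b ->
  (forall a', A a' -> side H a' = side H a) /\ (forall b', B b' -> side H b' = side H b).
Proof.
move=> cA cB Aa Bb mn ne; split.
  move=> a' Aa'; have : between a' a b.
    by rewrite /between -(gate hX cA Aa _ Aa') // => a2 h; exact: mn.
  move=> /(between_side hX) /(_ H); move: ne.
  by case: (side H a') (side H a) (side H b) => [] [] [] // _ /(_ erefl).
move=> b' Bb'; have : between b' b a.
  rewrite /between -(gate hX cB Bb _ Bb') // => b2 h.
  by rewrite !(distn_sym hX _ a); exact: mn.
move=> /(between_side hX) /(_ H); move: ne.
by case: (side H b') (side H a) (side H b) => [] [] [] // _ /(_ erefl).
Qed.

(** Let [a], [b] be a closest pair in disjoint halfspaces of [J] and [K]. An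
    isometry fixing [J] and [K] preserves these halfspaces, and maps [a], [b] to
    another closest pair. A hyperplane separating [a] from its image separates
    neither pair, so it crosses both [J] and [K]; there are at most [L] of them. *)
Lemma ws_stab L J K : hyperplane J -> hyperplane K -> well_separated L J K ->
  exists a, forall g : isom X, imgw g J = J -> imgw g K = K -> d a (g a) <= L.
Proof.
move=> hJ hK ws; have [ne nc] := ws_disjoint hX hJ hK ws.
have [e1 [e2 dis]] : exists e1 e2, forall z, ~ (side J z = e1 /\ side K z = e2).
  apply: contra_notP nc => h e1 e2; apply: contra_notP h => h.
  by exists e1, e2 => z hz; apply: h; exists z.
have ceq (u v w : bool) : u <> w -> v <> w -> u = v by case: u v w => [] [] [].
have [a [b [Ja Kb mn]]] : exists a b, [/\ [set z | side J z = e1] a, [set z | side K z = e2] b &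
    forall a' b', [set z | side J z = e1] a' -> [set z | side K z = e2] b' -> d a b <= d a' b'].
  by apply: closest_pair; exact: side_onto.
have cJ : convex [set z | side J z = e1] by exact: side_convex.
have cK : convex [set z | side K z = e2] by exact: side_convex.
move: (Ja) (Kb) => /= ja kb.
have jb : side J b <> e1 by move=> h; apply: (dis b).
have ka : side K a <> e2 by move=> h; apply: (dis a).
exists a => g gJ gK.
have fJ u v : (side J (g u) == side J (g v)) = (side J u == side J v).
  by rewrite -{1 2}gJ side_image.
have fK u v : (side K (g u) == side K (g v)) = (side K u == side K v).
  by rewrite -{1 2}gK side_image.
have [jga kgb] : side J (g a) = e1 /\ side K (g b) = e2.
  have gJn z : side J z <> e1 -> side J (g z) <> side J (g a).
    by move=> h /eqP; rewrite fJ ja => /eqP.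
  have gKn z : side K z <> e2 -> side K (g z) <> side K (g b).
    by move=> h /eqP; rewrite fK kb => /eqP.
  have [z0 [h1 h2]] : exists z, side J z <> e1 /\ side K z <> e2.
    apply: contra_notP ne => h.
    have hz z : (side K z == e2) = (side J z != e1).
      apply/idP/idP => [/eqP h1|/eqP h1]; first by apply/eqP => h2; apply: (dis z).
      by apply: contraT => /eqP h2; case: h; exists z.
    have [x hx] := side_onto hX true hJ; have [y hy] := side_onto hX false hJ.
    have [|u [v [uv _ _]]] := @cross_edge _ hX J x y; first by rewrite hx hy.
    have [_ suv] := (acrossP hX _ _ _).1 uv.
    apply/esym/eqP; rewrite -(uv K); move: suv (hz u) (hz v); clear.
    by case: (side J u) (side J v) (side K u) (side K v) e1 e2 => [] [] [] [] [] [].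
  have [j1|/eqP j1] := eqVneq (side J (g a)) e1.
    split=> //; have [//|/eqP k1] := eqVneq (side K (g b)) e2.
    by case: (dis (g a)); split=> //; apply: ceq (gKn _ ka) _ => h; apply: k1.
  have [k1|/eqP k1] := eqVneq (side K (g b)) e2.
    by case: (dis (g b)); split=> //; apply: ceq (gJn _ jb) _ => h; apply: j1.
  case: (dis (g z0)); split.
    by apply: ceq (gJn _ h1) _ => h; apply: j1.
  by apply: ceq (gKn _ h2) _ => h; apply: k1.
have gmn a' b' : [set z | side J z = e1] a' -> [set z | side K z = e2] b' ->
    d (g a) (g b) <= d a' b'.
  by rewrite (distn_image hX); exact: mn.
have sepab H : side H a != side H (g a) ->
    [/\ side H a = side H b, side H (g a) = side H (g b) & cross H J /\ cross H K].
  move=> h.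
  have e : side H a = side H b.
    apply/eqP; apply: contraT => /(closest_sep cJ cK Ja Kb mn) [hA _].
    by rewrite (hA _ jga) eqxx in h.
  have e' : side H (g a) = side H (g b).
    apply/eqP; apply: contraT => /(closest_sep cJ cK jga kgb gmn) [hA _].
    by rewrite (hA _ Ja) eqxx in h.
  have jgb : side J (g b) <> e1 by move=> h'; apply: (dis (g b)).
  have kga : side K (g a) <> e2 by move=> h'; apply: (dis (g a)).
  have two (s t : bool) : s != t -> forall u, u = s \/ u = t.
    by case: s t => [] [] // _ []; auto.
  split=> //; split=> u v.
    have [->|/eqP vn] := eqVneq v e1.
      by have [->|->] := two _ _ h u; [exists a|exists (g a)].
    have jb' : side J b = v := ceq _ _ _ jb vn.
    have jgb' : side J (g b) = v := ceq _ _ _ jgb vn.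
    by have [->|->] := two _ _ h u; [exists b|exists (g b)].
  have [->|/eqP vn] := eqVneq v e2.
    by have [->|->] := two _ _ h u; [exists b; rewrite e|exists (g b); rewrite e'].
  have ka' : side K a = v := ceq _ _ _ ka vn.
  have kga' : side K (g a) = v := ceq _ _ _ kga vn.
  by have [->|->] := two _ _ h u; [exists a|exists (g a)].
rewrite -(size_walls hX); apply: (@ws_card _ hX L J K _ a (g a)) => // [|H|H]; first exact: walls_uniq.
  by rewrite mem_walls => /sepab [_ _].
by rewrite mem_walls.
Qed.

Variable G : groupType.
Variable act : G -> isom X.
Hypothesis hG : geometric_action act.

Let act1 x : act 1%g x = x.
Proof. by case: hG => -[]. Qed.

Let actM g h x : act (g * h)%g x = act g (act h x).
Proof. by case: hG => -[]. Qed.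

Let PD : properly_discontinuous act. Proof. by case: hG. Qed.
Let CC : cocompact act. Proof. by case: hG. Qed.

Lemma actK g x : act (g^-1)%g (act g x) = x.
Proof. by rewrite -actM mulVg act1. Qed.

Lemma actVK g x : act g (act (g^-1)%g x) = x.
Proof. by rewrite -actM mulgV act1. Qed.

Lemma cube_finite (Q : set X) : cube Q -> finite_set Q.
Proof. by move=> /cube_model [n [ch [_ -> _]]]; apply: finite_image; exact: finite_finset. Qed.

(** Every edge at [x] is the image of one of finitely many edges under an element
    of the group that moves this edge to [x]. *)
Lemma locally_finite x : finite_set [set y | adj x y].
Proof.
have [C [finC CQ cov]] := CC.
apply: (@sub_finite_set _ _ (\bigcup_(P in C)
  \bigcup_(g in [set g | (act g @` (P `|` [set x])) `&` (P `|` [set x]) !=set0]) (act g @` P))).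
  move=> y xy; have [g [P [CP E]]] : exists g P, C P /\ [set x; y] = act g @` P.
    by apply: cov; case: xy.
  have [p Pp px] : (act g @` P) x by rewrite -E; left.
  exists P => //; exists g; last by rewrite -E; right.
  by exists x; split; [exists p; [left|]|right].
apply: bigcup_finite => // P CP; apply: bigcup_finite => [|g _].
  apply: PD; rewrite finite_setU; split; last exact: finite_set1.
  exact/cube_finite/CQ.
exact/finite_image/cube_finite/CQ.
Qed.

Lemma ball_finite x n : finite_set [set y | d x y <= n].
Proof.
elim: n => [|n IH].
  apply: (@sub_finite_set _ _ [set x]); last exact: finite_set1.
  by move=> y /=; rewrite leqn0 => /eqP/(distn_eq0 hX) ->.
apply: (@sub_finite_set _ _ ([set y | d x y <= n] `|` \bigcup_(z in [set y | d x y <= n]) [set y | adj z y])).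
  move=> y /=; rewrite leq_eqVlt ltnS => /orP[/eqP|]; last by left.
  rewrite (distn_sym hX) => /(distn_step hX) [z yz dz]; right; exists z; last exact: adj_sym.
  by rewrite /= (distn_sym hX) dz.
rewrite finite_setU; split=> //; apply: bigcup_finite => // z _; exact: locally_finite.
Qed.

(** Two such elements differ by an element fixing [J] and [K], so they map the
    vertex given by [ws_stab] to points at distance at most [L]. *)
Lemma ws_stab_finite L J K A B : hyperplane J -> hyperplane K -> well_separated L J K ->
  finite_set [set g | imgw (act g) J = A /\ imgw (act g) K = B].
Proof.
move=> hJ hK ws; have [a ha] := ws_stab hJ hK ws.
have [[g0 [gA gB]]|nex] := pselect (exists g, imgw (act g) J = A /\ imgw (act g) K = B); last first.
  suff -> : [set g | imgw (act g) J = A /\ imgw (act g) K = B] = set0 by exact: finite_set0.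
  by apply/seteqP; split=> // g hg; case: nex; exists g.
set F := [set a] `|` act g0 @` [set y | d a y <= L].
apply: (@sub_finite_set _ _ [set g | (act g @` F) `&` F !=set0]); last first.
  apply: PD; rewrite finite_setU; split; first exact: finite_set1.
  exact/finite_image/ball_finite.
move=> g [hA hB].
have fixW M N : imgw (act g) M = N -> imgw (act g0) M = N -> imgw (act (g0^-1 * g)%g) M = M.
  move=> e e0; have -> : imgw (act (g0^-1 * g)%g) M = imgw (act (g0^-1)%g) (imgw (act g) M).
    by rewrite imgw_comp; congr (imgw _ M); apply/funext => z /=; rewrite actM.
  by rewrite e -e0 imgw_comp imgw_id // => z /=; rewrite actK.
have := ha _ (fixW _ _ hA gA) (fixW _ _ hB gB); rewrite actM => le.
exists (act g a); split; first by exists a => //; left.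
by right; exists (act (g0^-1)%g (act g a)); rewrite ?actVK.
Qed.

(** An element moving [x] and [y] by at most [e] sends at most [2 * e] hyperplanes
    of a family for [x], [y] to hyperplanes that do not separate [x] from [y]. Two
    of them remain, their images are among finitely many hyperplanes, and
    [ws_stab_finite] applies. *)
Lemma acylindrical L e x y : 2 * e + 2 <= deltan L x y ->
  finite_set [set g | deltan L x (act g x) <= e /\ deltan L y (act g y) <= e].
Proof.
have [F [uF sF wF] <-] := deltan_ex hX L x y => sz.
have mF J : J \in F -> hyperplane J by move=> /sF /side_hyp.
pose W : set (set (set X)) := [set` walls hX x y]; pose S : set (set (set X)) := [set` F].
apply: (@sub_finite_set _ _ (\bigcup_(J in S) \bigcup_(K in S `\ J) \bigcup_(A in W) \bigcup_(B in W)
   [set g | imgw (act g) J = A /\ imgw (act g) K = B])).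
  move=> g [hx hy].
  pose bad z J := side (imgw (act g) J) z != side (imgw (act g) J) (act g z).
  have cnt z : deltan L z (act g z) <= e -> count (bad z) F <= e.
    move=> h; apply: leq_trans h.
    have h : sepfam L (act g x) (act g y) [seq imgw (act g) J | J <- F].
      by apply: sepfam_image => //; split.
    have := deltan_ge hX (sepfam_sub z (act g z) h).
    by rewrite size_filter count_map.
  have := cnt _ hx; have := cnt _ hy.
  set good := [seq J <- F | ~~ bad x J && ~~ bad y J].
  have sg : size F <= count (bad x) F + count (bad y) F + size good.
    rewrite /good size_filter; elim: (F) => //= J s IH.
    by case: (bad x J); case: (bad y J) => /=; lia.
  have ug : uniq good by exact: filter_uniq.
  move=> c1 c2; have : 2 <= size good by lia.
  have gW J : J \in good -> J \in F /\ imgw (act g) J \in walls hX x y.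
    rewrite mem_filter mem_walls /bad !negbK => /andP[/andP[/eqP -> /eqP ->] JF].
    by split=> //; rewrite (side_image hX) sF.
  case: good ug gW {sg} => [|J [|K s]] //= + gW _.
  have [JF wJ] : J \in F /\ imgw (act g) J \in walls hX x y by apply: gW; rewrite in_cons eqxx.
  have [KF wK] : K \in F /\ imgw (act g) K \in walls hX x y.
    by apply: gW; rewrite !in_cons eqxx orbT.
  rewrite in_cons => /andP[/norP[/eqP JK _] _].
  exists J => //; exists K; first by split=> // /esym.
  by exists (imgw (act g) J) => //; exists (imgw (act g) K).
apply: bigcup_finite => [|J JF]; first exact: finite_seq.
apply: bigcup_finite => [|K [KF KJ]]; first exact/finite_setD/finite_seq.
apply: bigcup_finite => [|A _]; first exact: finite_seq.
apply: bigcup_finite => [|B _]; first exact: finite_seq.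
apply: (@ws_stab_finite L); [exact: mF|exact: mF|apply: wF => //].
by move=> e'; apply: KJ.
Qed.

(** Cocompactness bounds the number of edges at a vertex. *)
Lemma degree_bound : exists k, forall x (s : seq {classic X}), uniq s ->
  (forall y, y \in s -> adj x y) -> size s <= k.
Proof.
have [C [finC CQ cov]] := CC.
have fU : finite_set (\bigcup_(P in C) P).
  by apply: bigcup_finite => // P /CQ/cube_finite.
have [s0 E] := (@finite_seqP {classic X} _).1 fU.
have deg x : exists k, forall s : seq {classic X}, uniq s -> (forall y, y \in s -> adj x y) -> size s <= k.
  have [t Et] := (@finite_seqP {classic X} _).1 (locally_finite x).
  exists (size t) => s us hs; apply: uniq_leq_size => // y /hs a.
  by have : [set y | adj x y] y by []; rewrite Et.
have [k hk] : exists k, forall p, p \in s0 -> forall s : seq {classic X}, uniq s ->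
    (forall y, y \in s -> adj p y) -> size s <= k.
  elim: (s0) => [|p s [k IH]]; first by exists 0.
  have [k' hk'] := deg p; exists (maxn k k') => q; rewrite in_cons => /orP[/eqP ->|/IH h] t ut ht.
    by rewrite leq_max hk' ?orbT.
  by rewrite leq_max h.
exists k => x s us hs; have [g [P [CP Ex]]] := cov _ (cube_vertex x).
have [p Pp px] : (act g @` P) x by rewrite -Ex.
have ps : p \in s0.
  by have : (\bigcup_(P in C) P) p by [exists P]; rewrite E.
pose f : {classic X} -> {classic X} := isom_inv (act g).
have fI : injective f by exact: can_inj (isom_invK (act g)).
rewrite -(size_map f s); apply: (hk p ps); first by rewrite map_inj_uniq.
move=> _ /mapP [y /hs a ->].
by have := adj_image (inv_isom (act g)) a; rewrite /= -px isom_funK.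
Qed.

End Acylindricity.

(** * Large families of hyperplanes *)

Definition ramsey_bound (a b n : nat) : Prop :=
  forall (T : eqType) (r : T -> T -> bool) (s : seq T),
  symmetric r -> uniq s -> n <= size s ->
  (exists t, [/\ subseq t s, size t = a & forall x y, x \in t -> y \in t -> x <> y -> r x y]) \/
  (exists t, [/\ subseq t s, size t = b & forall x y, x \in t -> y \in t -> x <> y -> ~~ r x y]).

Lemma ramsey a b : exists n, ramsey_bound a b n.
Proof.
move E : (a + b) => m; elim: m a b E => [|m IH] a b E.
  have -> : a = 0 by lia.
  by exists 0 => T r s _ _ _; left; exists [::]; split; rewrite ?sub0seq.
case: a E => [|a] E; first by exists 0 => T r s _ _ _; left; exists [::]; split; rewrite ?sub0seq.
case: b E => [|b] E; first by exists 0 => T r s _ _ _; right; exists [::]; split; rewrite ?sub0seq.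
have [n1 h1] : exists n, ramsey_bound a b.+1 n by apply: IH; lia.
have [n2 h2] : exists n, ramsey_bound a.+1 b n by apply: IH; lia.
exists (n1 + n2).+1 => T r [|x s] // sr; rewrite cons_uniq => /andP[xs us] sz0.
have sz : n1 + n2 <= size s by [].
have cc : size [seq y <- s | r x y] + size [seq y <- s | ~~ r x y] = size s.
  by rewrite !size_filter; exact: (count_predC (r x)).
have ext (p : bool) t : subseq t [seq y <- s | r x y == p] ->
    (forall y z, y \in t -> z \in t -> y <> z -> r y z == p) ->
    subseq (x :: t) (x :: s) /\
    (forall y z, y \in x :: t -> z \in x :: t -> y <> z -> r y z == p).
  move=> st ht; split.
    by rewrite /= eqxx; exact: (subseq_trans st (filter_subseq _ _)).
  have rx y : y \in t -> r x y == p by move=> /(mem_subseq st); rewrite mem_filter => /andP[].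
  move=> y z; rewrite !in_cons => /orP[/eqP ->|hy] /orP[/eqP ->|hz] // ne; [exact: rx| |exact: ht].
  by rewrite sr rx.
have f1 : [seq y <- s | r x y] = [seq y <- s | r x y == true].
  by apply: eq_filter => y; rewrite eqb_id.
have f2 : [seq y <- s | ~~ r x y] = [seq y <- s | r x y == false].
  by apply: eq_filter => y; rewrite eqbF_neg.
have [le|le] : n1 <= size [seq y <- s | r x y] \/ n2 <= size [seq y <- s | ~~ r x y] by lia.
- have [[t [t1 t2 t3]]|[t [t1 t2 t3]]] := h1 _ r _ sr (filter_uniq _ us) le; last first.
    right; exists t; split=> //; apply: (subseq_trans t1).
    exact: (subseq_trans (filter_subseq _ _) (subseq_cons _ _)).
  left; rewrite f1 in t1; have [|u1 u2] := ext true t t1.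
    by move=> y z hy hz ne; rewrite eqb_id t3.
  by exists (x :: t); split=> [//|/=|y z hy hz ne]; rewrite ?t2 // -[r y z]eqb_id u2.
- have [[t [t1 t2 t3]]|[t [t1 t2 t3]]] := h2 _ r _ sr (filter_uniq _ us) le.
    left; exists t; split=> //; apply: (subseq_trans t1).
    exact: (subseq_trans (filter_subseq _ _) (subseq_cons _ _)).
  right; rewrite f2 in t1; have [|u1 u2] := ext false t t1.
    by move=> y z hy hz ne; rewrite eqbF_neg t3.
  by exists (x :: t); split=> [//|/=|y z hy hz ne]; rewrite ?t2 // -eqbF_neg u2.
Qed.

Section Walls.
Variable X : cube_complex.
Hypothesis hX : CAT0 X.
Implicit Types (x y z a b c u v w p q : X) (J K H : set (set X)).
Local Notation d := (@distn X).

Lemma convexI (A B : set X) : convex A -> convex B -> convex (A `&` B).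
Proof. by move=> hA hB a b w [? ?] [? ?] bt; split; [exact: hA bt|exact: hB bt]. Qed.

Lemma med_between x y z :
  [/\ between x (med hX x y z) y, between x (med hX x y z) z & between y (med hX x y z) z].
Proof.
by split; apply/(between_side hX) => J; rewrite side_med;
  case: (side J x) (side J y) (side J z) => [] [] [].
Qed.

(** For three sets, the median of three points in the pairwise intersections is a
    common point; the general case follows by induction, intersecting all other
    sets with the first one. *)
Lemma helly (l : seq (set X)) : l != [::] -> (forall A, A \in l -> convex A) ->
  (forall A B, A \in l -> B \in l -> A `&` B !=set0) -> exists z, forall A, A \in l -> A z.
Proof.
move E : (size l) => n; elim: n l E => [|n IH] [|A l] //= [sl] _ cv pw.
case: l sl cv pw => [|B l] sl cv pw.
  have hA : A \in [:: A] by rewrite mem_seq1.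
  have [z [Az _]] := pw A A hA hA.
  by exists z => C; rewrite mem_seq1 => /eqP ->.
have [z hz] : exists z, forall C, C \in [seq A `&` C | C <- B :: l] -> C z.
  apply: IH => //; first by rewrite size_map.
    move=> _ /mapP [C hC ->]; apply: convexI; apply: cv; rewrite in_cons ?eqxx //.
    by rewrite hC orbT.
  move=> _ _ /mapP [C hC ->] /mapP [C' hC' ->].
  have AA : A \in A :: B :: l by rewrite in_cons eqxx.
  have hC2 : C \in A :: B :: l by rewrite in_cons hC orbT.
  have hC2' : C' \in A :: B :: l by rewrite in_cons hC' orbT.
  have [u [Au Cu]] := pw _ _ AA hC2; have [v [Av Cv]] := pw _ _ AA hC2'.
  have [w [Cw Cw']] := pw _ _ hC2 hC2'.
  have [b1 b2 b3] := med_between u v w.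
  have mA := cv _ AA _ _ _ Au Av b1.
  by exists (med hX u v w); split; split=> //; [exact: cv hC2 _ _ _ Cu Cw b2|exact: cv hC2' _ _ _ Cv Cw' b3].
exists z => C; rewrite in_cons => /orP[/eqP ->|hC].
  by have [] := hz (A `&` B) (map_f _ (mem_head _ _)).
by have [] := hz (A `&` C) (map_f _ hC).
Qed.

(** The vertex [p] is the gate of [y] in the intersection [A] of the halfspaces
    around [x]. For [J] in [s], let [t] be the gate of [p] in the halfspace of [J]
    around [y], and [K] the hyperplane crossed by the first edge of a geodesic from
    [p] to [t]. Then [K] separates [p] from that halfspace, hence does not cross [J].
    In particular it separates [p] from [y], so that edge leaves [A] and [K] is
    in [s]; thus [K] is [J]. *)
Lemma clique_vertex x y (s : seq (set (set X))) :
  (forall J, J \in s -> side J x != side J y) ->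
  (forall J K, J \in s -> K \in s -> J <> K -> cross J K) ->
  exists p, forall J, J \in s -> exists q, across J p q.
Proof.
move=> sep cr; pose A := [set z | forall J, J \in s -> side J z = side J x].
have cA : convex A.
  move=> a b w Aa Ab bt J Js; have := side_convex hX (J := J) (e := side J x).
  by move=> /(_ a b w (Aa _ Js) (Ab _ Js) bt).
have [|p Ap near] := @nearest_ex X A y; first by exists x.
exists p => J Js; have sJ := sep _ Js; have pJ := Ap _ Js.
have [|t tB gt] := gate_ex hX p (side_convex hX (J := J) (e := side J y)); first by exists y.
have [n dn] : exists n, d p t = n.+1.
  case E : (d p t) => [|n]; last by exists n.
  by have e := distn_eq0 hX E; move: tB sJ; rewrite /= -e pJ => ->; rewrite eqxx.
have [p1 pp1 dp1] := distn_step hX dn.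
have [K [hK uK]] := edge_wall hX pp1.
have Kfar b : side J b = side J y -> side K b = side K p1.
  move=> /gt/(between_side hX)/(_ K) h1.
  have : between p p1 t by rewrite /between (distn_adj hX pp1) dp1 dn.
  move=> /(between_side hX)/(_ K) h2.
  by move: h1 h2 hK; case: (side K b) (side K t) (side K p) (side K p1) => [] [] [] [] h1 h2 _ //;
    first [by have := h1 erefl|by have := h2 erefl].
have Ky := Kfar y erefl.
have Ks : K \in s.
  apply: contraT => nK.
  have Ap1 : A p1.
    move=> H Hs; rewrite -(Ap _ Hs); apply/esym/eqP; apply: contraT => /uK e.
    by rewrite -e Hs in nK.
  have := near _ Ap1; have := edge_closer hX y (adj_sym pp1) (J := K).
  by rewrite eq_sym hK Ky eqxx /closer !(distn_sym hX y) => /(_ isT); lia.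
have [e|/eqP ne] := eqVneq K J; first by exists p1; rewrite -e; exact/acrossP.
have [z [z1 z2]] := cr _ _ Ks Js ne (side K p) (side J y).
by rewrite -z1 (Kfar _ z2) eqxx in hK.
Qed.

End Walls.

(** * Isometries skewering a halfspace *)

Section Skewer.
Variable X : cube_complex.
Hypothesis hX : CAT0 X.
Implicit Types (x y z a b c u v w p : X) (H K : set (set X)) (i j : int).
Local Notation d := (@distn X).

Variables (h : isom X) (J : set (set X)) (e : bool).

(** With [D] the halfspace of [J] on the side [e], [skewers] says that [h] maps [D]
    into itself, and [deep i z] that [z] lies in the image of [D] under [h ^ i]. *)
Definition skewers : Prop := forall z, side J (isom_inv h z) = e -> side J z = e.
Definition deep (i : int) z : bool := side J (isom_pow h (- i)%R z) == e.
Definition trans (i : int) : set (set X) := imgw (isom_pow h i) J.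
Definition level (i : int) z : Prop := deep i z /\ ~~ deep (i + 1)%R z.

Lemma deep_pow i j z : deep i (isom_pow h j z) = deep (i - j)%R z.
Proof. by rewrite /deep -isom_powD opprB addrC. Qed.

Lemma pow_isom_fun i : (pow_isom h i : X -> X) = isom_pow h i.
Proof. by apply/funext => z; exact: pow_isomE. Qed.

Lemma side_trans i x y : (side (trans i) x == side (trans i) y) = (deep i x == deep i y).
Proof.
have E z : isom_pow h i (isom_pow h (- i)%R z) = z by rewrite -isom_powD subrr.
rewrite -{1}(E x) -{1}(E y) /trans -pow_isom_fun side_image // /deep.
by case: (side J _) (side J _) e => [] [] [].
Qed.

Lemma trans_pow i k : imgw (isom_pow h k) (trans i) = trans (k + i)%R.
Proof.
by rewrite /trans imgw_comp; congr (imgw _ J); apply/funext => z /=; rewrite isom_powD.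
Qed.

Lemma deep_side i : exists f : bool, forall z, deep i z = (side (trans i) z == f).
Proof.
have [q|n] := pselect (exists q : X, True); last first.
  by exists true => z; case: n; exists z.
case: q => q _.
exists (side (trans i) q == deep i q) => z; have := side_trans i z q.
by case: (deep i z) (deep i q) (side (trans i) z) (side (trans i) q) => [] [] [] [].
Qed.

Lemma deep_med i x y z :
  deep i (med hX x y z) = maj (deep i x) (deep i y) (deep i z).
Proof.
have [f E] := deep_side i; rewrite !E side_med.
by case: (side _ x) (side _ y) (side _ z) f {E} => [] [] [] [].
Qed.

Lemma deep_between i a w b : between a w b -> deep i a = deep i b -> deep i w = deep i a.
Proof.
have [f E] := deep_side i; rewrite !E => /(between_side hX)/(_ (trans i)).
by case: (side _ a) (side _ b) (side _ w) f {E} => [] [] [] [] // /(_ erefl).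
Qed.

Lemma level_between i a w b : between a w b -> level i a -> level i b -> level i w.
Proof.
move=> bt [a1 /negbTE a2] [b1 /negbTE b2]; split.
  by rewrite (deep_between bt) ?a1.
by rewrite (deep_between bt) a2 ?b2.
Qed.

Lemma cross_deep H i : (forall u v : bool, exists z, side H z = u /\ deep i z = v) <->
  cross H (trans i).
Proof.
have [f E] := deep_side i; split=> c u v.
  have [z [z1 z2]] := c u (v == f); exists z; split=> //.
  by move: z2; rewrite E; case: side v f {E} => [] [] [].
have [z [z1 z2]] := c u (v == f); exists z; split=> //.
by rewrite E z2; case: v f {E z2} => [] [].
Qed.

Hypothesis sk : skewers.

Lemma deep_le i j z : (i <= j)%R -> deep j z -> deep i z.
Proof.
move=> ij; have -> : j = (i + `|j - i|%N%:Z)%R by lia.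
elim: `|j - i|%N => [|n IH]; first by rewrite addr0.
move=> hd; apply: IH; move: hd; rewrite /deep => /eqP hd; apply/eqP/sk.
by rewrite -isom_powN1 -hd; congr (side J (isom_pow h _ z)); lia.
Qed.

Variable q : X.
Hypothesis q0 : deep 0 q.
Hypothesis q1 : ~~ deep 1 q.

Definition orb (i : int) := isom_pow h i q.

Lemma level_orb i : level i (orb i).
Proof. by split; rewrite /orb deep_pow ?subrr // addrAC subrr add0r. Qed.

Lemma trans_inj : injective trans.
Proof.
have H i j : (i < j)%R -> trans i <> trans j.
  move=> ij E; have := side_trans i (orb i) (orb j); have := side_trans j (orb i) (orb j).
  rewrite -E => -> /eqP; have [-> _] := level_orb i; have [-> _] := level_orb j.
  have [oj _] := level_orb j; rewrite (deep_le _ oj); last by lia.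
  case D : (deep j (orb i)) => //; have [_ /negP[]] := level_orb i.
  by apply: deep_le D; lia.
move=> i j E; case: (ltgtP i j) => // /H; first by rewrite E.
by move/nesym; rewrite E.
Qed.

Lemma trans_hyp i : hyperplane (trans i).
Proof.
apply: (@side_hyp _ (trans i) (orb i) (orb (i - 1)%R)); rewrite side_trans.
have [-> _] := level_orb i; have [_] := level_orb (i - 1)%R.
by rewrite subrK => /negbTE ->.
Qed.

(** The [n] hyperplanes [trans (i + 1)], ..., [trans (i + n)] separate [z] from
    [w]. *)
Lemma level_dist n i z w : ~~ deep (i + 1)%R z -> deep (i + n%:Z)%R w -> n <= d z w.
Proof.
move=> nz dw; pose s := [seq trans (i + 1 + k%:Z)%R | k <- iota 0 n].
have -> : n = size s by rewrite size_map size_iota.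
apply: (distn_ge hX).
  rewrite map_inj_in_uniq ?iota_uniq // => k k' _ _ /trans_inj; lia.
move=> H /mapP [k]; rewrite mem_iota => kn ->; rewrite side_trans.
have -> : deep (i + 1 + k%:Z)%R w by apply: deep_le dw; lia.
suff /negbTE -> : ~~ deep (i + 1 + k%:Z)%R z by [].
by apply: contra nz; apply: deep_le; lia.
Qed.

(** By [level_dist], the levels of [z] and [q] differ by at most their distance. *)
Lemma level_ex z : exists i, level i z.
Proof.
have low : deep (- (d q z).+1%:Z)%R z.
  apply: contraT => nd; have : (d q z).+2 <= d z q; last by rewrite (distn_sym hX z q); lia.
  apply: (@level_dist _ (- (d q z).+2%:Z)%R); last by rewrite addNr.
  by have -> : (- (d q z).+2%:Z + 1)%R = (- (d q z).+1%:Z)%R by lia.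
have high : ~~ deep (- (d q z).+1%:Z + (2 * (d q z).+1)%:Z)%R z.
  apply/negP => dz; have : (d q z).+1 <= d q z; last by rewrite ltnn.
  apply: (@level_dist _ 0%R); first by rewrite add0r.
  by move: dz; congr (deep _ z); lia.
move: (- _)%R low (2 * _) high => i li n; elim: n i li => [|n IH] i li hi.
  by rewrite addr0 li in hi.
have [di|di] := boolP (deep (i + 1)%R z); last by exists i.
apply: (IH (i + 1)%R di); apply: contra hi.
by have -> : (i + n.+1%:Z)%R = (i + 1 + n%:Z)%R by lia.
Qed.

Lemma orb_step n i : d (orb i) (orb (i + n%:Z)%R) <= n * d q (h q).
Proof.
elim: n => [|n IH]; first by rewrite addr0 distn0.
apply: leq_trans (distn_tri hX _ (orb (i + n%:Z)%R) _) _; rewrite mulSn addnC.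
apply: leq_add IH; have -> : orb (i + n.+1%:Z)%R = isom_pow h (i + n%:Z)%R (h q).
  have -> : (i + n.+1%:Z)%R = ((i + n%:Z) + 1)%R by lia.
  by rewrite /orb isom_powD.
by rewrite /orb -pow_isom_fun distn_image.
Qed.

Lemma orb_dist i j : d (orb i) (orb j) <= `|i - j|%N * d q (h q).
Proof.
case: (lerP i j) => ij.
  have E : j = (i + `|i - j|%N%:Z)%R by lia.
  by rewrite {1}E; exact: orb_step.
have E : i = (j + `|i - j|%N%:Z)%R by lia.
by rewrite (distn_sym hX) {1}E; exact: orb_step.
Qed.

Lemma level_le i j z w n : level i z -> level j w -> d z w <= n -> (j <= i + n%:Z)%R.
Proof.
move=> [_ hz] [hw _] dn; case: lerP => // ij.
have E : (i + `|j - i|%N%:Z)%R = j by lia.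
rewrite -E in hw; have := level_dist hz hw; lia.
Qed.

Lemma level_near i j z w n : level i z -> level j w -> d z w <= n -> `|i - j|%N <= n.
Proof.
move=> hz hw dn; have := level_le hz hw dn; have := level_le hw hz.
by rewrite (distn_sym hX) => /(_ _ dn); lia.
Qed.

Lemma ws_shift L i j k : well_separated L (trans i) (trans j) ->
  well_separated L (trans (k + i)%R) (trans (k + j)%R).
Proof. by rewrite -!trans_pow -pow_isom_fun; apply: ws_image => //; exact: trans_hyp. Qed.

Lemma trans_disjoint i j : i <> j -> ~ cross (trans i) (trans j).
Proof.
suff H k l : (k < l)%R -> ~ cross (trans k) (trans l).
  by move=> ne c; case: (ltgtP i j) => // /H; apply=> //; exact: cross_sym.
move=> kl /cross_deep c; have [f E] := deep_side k.
have [z [z1 z2]] := c (~~ f) true; have := deep_le (ltW kl) z2.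
by rewrite E z1; case: (f).
Qed.

(** A hyperplane crossing two translates crosses every translate in between, so
    the translates by multiples of [M] are pairwise well-separated. *)
Lemma level_deltan L M n i z w : 0 < M ->
  (forall k, well_separated L (trans k) (trans (k + M%:Z)%R)) ->
  ~~ deep (i + 1)%R z -> deep (i + (n * M)%:Z)%R w -> n <= deltan L z w.
Proof.
move=> M0 ws nz dw; pose s := [seq trans (i + 1 + (k * M)%:Z)%R | k <- iota 0 n].
have -> : n = size s by rewrite size_map size_iota.
have wsd k l : k < l -> well_separated L (trans (i + 1 + (k * M)%:Z)%R) (trans (i + 1 + (l * M)%:Z)%R).
  move=> kl; have := ws (i + 1 + (k * M)%:Z)%R.
  have lM : k * M + M <= l * M by rewrite addnC -mulSn leq_mul2r kl orbT.
  move=> wk; apply: (ws_between hX (trans_hyp _) (trans_hyp _) (trans_hyp _) (trans_hyp _) wk).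
  - by move=> /trans_inj; lia.
  - by apply: trans_disjoint; lia.
  move=> H c1 c2; split=> //; apply/cross_deep => u v.
  move/cross_deep: c1 => c1; move/cross_deep: c2 => c2.
  case: v.
    by have [x [x1 x2]] := c2 u true; exists x; split=> //; apply: deep_le x2; lia.
  have [x [x1 x2]] := c1 u false; exists x; split=> //.
  by apply: contraFF x2; apply: deep_le; lia.
apply: (deltan_ge hX); split.
- rewrite map_inj_in_uniq ?iota_uniq // => k k' _ _ /trans_inj E.
  by apply/eqP; rewrite -(eqn_pmul2r M0); apply/eqP; lia.
- move=> H /mapP [k]; rewrite mem_iota => /andP[_ kn] ->; rewrite side_trans.
  have lM : k * M + 1 <= n * M.
    by apply: leq_trans (_ : k.+1 * M <= _); rewrite ?leq_mul2r ?kn ?orbT // mulSn; lia.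
  have -> : deep (i + 1 + (k * M)%:Z)%R w by apply: deep_le dw; lia.
  suff /negbTE -> : ~~ deep (i + 1 + (k * M)%:Z)%R z by [].
  by apply: contra nz; apply: deep_le; lia.
- move=> H K /mapP [k _ ->] /mapP [l _ ->] ne.
  case: (ltngtP k l) => [/wsd //|/wsd w'|E]; last by case: ne; rewrite E.
  by apply: ws_sym w' => //; exact: trans_hyp.
Qed.

Definition nearest (Y : set X) z p : Prop := Y p /\ forall y, Y y -> d z p <= d z y.

(** The form of [contracting] used below, for balls of integral radius. *)
Definition contracts (k : nat) (Y : set X) : Prop := forall c n z w p p',
  (forall y, Y y -> n < d c y) -> d c z <= n -> d c w <= n ->
  nearest Y z p -> nearest Y w p' -> d p p' <= k.

Lemma nearestE Y z : Y !=set0 -> exists p, nearest Y z p.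
Proof.
move=> /(nearest_ex z) [p Yp mp]; exists p; split=> // y /mp.
by rewrite !(distn_sym hX z).
Qed.

Section Contracting.
Variables (L c1 : nat) (Y : set X).
Hypothesis ws : well_separated L (trans 0) (trans 1).
Hypothesis Yorb : forall i, Y (orb i).
Hypothesis Yco : forall p, Y p -> exists i, d p (orb i) <= c1.

Let D := d q (h q).
Let C := L + 3 * D.

(** A hyperplane separating the orbit point [orb i] from both ends either separates
    it from one of the two previous orbit points, or crosses both [trans (i - 1)]
    and [trans i], which are well-separated. *)
Lemma med_orb i z w : ~~ deep (i - 1)%R z -> deep i w ->
  d (med hX z w (orb i)) (orb i) <= C.
Proof.
move=> nz dw; set m := med hX z w (orb i).
pose near k H := side H (orb i) != side H (orb k).
pose W := walls hX m (orb i).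
have cW : size W <= count (near (i - 1)%R) W + count (near (i - 2)%R) W +
    size [seq H <- W | ~~ near (i - 1)%R H && ~~ near (i - 2)%R H].
  rewrite size_filter; elim: (W) => //= H s IH.
  by case: (near _ H); case: (near _ H) => /=; move: IH; clear; lia.
have cn k : count (near k) W <= d (orb i) (orb k).
  rewrite -size_filter; apply: distn_ge => [//||H].
    by rewrite filter_uniq ?walls_uniq.
  by rewrite mem_filter => /andP[].
have n1 := leq_trans (cn (i - 1)%R) (orb_dist _ _).
have n2 := leq_trans (cn (i - 2)%R) (orb_dist _ _).
have e1 : `|(i - (i - 1))%R|%N = 1 by clear; lia.
have e2 : `|(i - (i - 2))%R|%N = 2 by clear; lia.
rewrite e1 in n1; rewrite e2 in n2.
suff c3 : size [seq H <- W | ~~ near (i - 1)%R H && ~~ near (i - 2)%R H] <= L.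
  rewrite -(size_walls hX) -/W; apply: leq_trans cW _.
  apply: leq_trans (leq_add (leq_add n1 n2) c3) _; rewrite -/D /C; clear; lia.
have hw : well_separated L (trans (i - 1)%R) (trans i).
  by have := ws_shift (i - 1)%R ws; rewrite addr0 subrK.
apply: (@ws_card _ hX L _ _ _ m (orb i) (trans_hyp _) (trans_hyp _) hw).
- by rewrite filter_uniq ?walls_uniq.
- move=> H; rewrite mem_filter /near !negbK mem_walls side_med.
  move=> /andP[/andP[/eqP y1 /eqP y2]].
  have [l0 l1] := level_orb i; have [l2 l3] := level_orb (i - 1)%R.
  have [l4 l5] := level_orb (i - 2)%R; rewrite subrK in l3.
  have l5' : ~~ deep (i - 1)%R (orb (i - 2)%R).
    by have <- : (i - 2 + 1)%R = (i - 1)%R by clear; lia.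
  have l0' : deep (i - 1)%R (orb i) by apply: deep_le l0; clear; lia.
  have dw' : deep (i - 1)%R w by apply: deep_le dw; clear; lia.
  have nz' : ~~ deep i z by apply: contra nz; apply: deep_le; clear; lia.
  have two (s t : bool) : s != t -> forall r : bool, r = s \/ r = t.
    by case: s t => [] [] // _ []; auto.
  move=> sep.
  have [s1 s2] : side H z = side H w /\ side H w != side H (orb i).
    by move: sep; case: (side H z) (side H w) (side H (orb i)) => [] [] [].
  split; apply/cross_deep => r r2; have [->|->] := two _ _ s2 r; case: r2.
  + by exists w.
  + by exists z; split=> //; exact/negbTE.
  + by exists (orb i).
  + by exists (orb (i - 2)%R); split=> //; exact/negbTE.
  + by exists w.
  + by exists z; split=> //; exact/negbTE.
  + by exists (orb i).
  + by exists (orb (i - 1)%R); split=> //; exact/negbTE.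
- by move=> H; rewrite mem_filter mem_walls => /andP[].
Qed.

Lemma med_orb_path i z w : ~~ deep (i - 1)%R z -> deep i w ->
  exists m, [/\ between z m w, between w m z & d m (orb i) <= C].
Proof.
move=> nz dw; exists (med hX z w (orb i)); have [b _ _] := med_between hX z w (orb i).
split=> //; last exact: med_orb.
by move: b; rewrite /between !(distn_sym hX _ z) !(distn_sym hX w) addnC.
Qed.

(** Otherwise a geodesic from [z] to [w] would pass near an orbit point whose level
    is next to that of [z] and far from that of [w]. *)
Lemma level_gap i j z w : level i z -> level j w ->
  (forall k m, between z m w -> d m (orb k) <= C -> d (orb k) w <= 2 * C) ->
  `|i - j|%N <= 2 * C + 2.
Proof.
move=> lz lw near; have [z1 z2] := lz; have [w1 w2] := lw.
have up : (j <= i + 2 + (2 * C)%:Z)%R.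
  case: (lerP j (i + 2)%R) => ij; first by lia.
  have [||m [b _ dm]] := @med_orb_path (i + 2)%R z w.
  - by have -> : (i + 2 - 1 = i + 1)%R by lia.
  - by apply: deep_le w1; lia.
  exact: level_le (level_orb _) lw (near _ _ b dm).
have low : (i <= j + 2 + (2 * C)%:Z)%R.
  case: (lerP i (j + 2)%R) => ij; first by lia.
  have [||m [_ b dm]] := @med_orb_path i w z.
  - by apply: contra w2; apply: deep_le; lia.
  - by [].
  suff : (i <= j + (2 * C)%:Z)%R by lia.
  apply: (level_le lw (level_orb _)); rewrite (distn_sym hX).
  exact: near b dm.
lia.
Qed.

(** The orbit point lies within [C] of a geodesic from [z] to [p], and is not
    nearer to [z] than [p]. *)
Lemma level_nearest i j z p : level i z -> nearest Y z p -> level j p ->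
  `|i - j|%N <= 2 * C + 2.
Proof.
move=> lz np lp; apply: level_gap lz lp _ => k m bt dm.
have := np.2 _ (Yorb k); move: bt; rewrite /between.
have := distn_tri hX z m (orb k); have := distn_tri hX (orb k) m p.
by rewrite (distn_sym hX (orb k) m); lia.
Qed.

(** The orbit avoids the ball, so a geodesic from [c] to [z] does not come within
    [C] of it before its last [C] edges. *)
Lemma level_ball i j c z n : level i c -> level j z ->
  (forall y, Y y -> n < d c y) -> d c z <= n -> `|i - j|%N <= 2 * C + 2.
Proof.
move=> lc lz far cz; apply: level_gap lc lz _ => k m bt dm.
have := far _ (Yorb k); move: bt; rewrite /between.
have := distn_tri hX c m (orb k); have := distn_tri hX (orb k) m z.
by rewrite (distn_sym hX (orb k) m); lia.
Qed.

Lemma near_level p i : Y p -> level i p -> d p (orb i) <= c1 + c1 * D.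
Proof.
move=> /Yco [j dj] lp; apply: leq_trans (distn_tri hX p (orb j) _) _.
apply: leq_add => //; apply: leq_trans (orb_dist _ _) _; rewrite leq_mul2r.
by apply/orP; right; rewrite distnC; apply: level_near lp (level_orb j) dj.
Qed.

Lemma skewer_contracts : exists k, contracts k Y.
Proof.
exists (2 * (c1 + c1 * D) + 4 * (2 * C + 2) * D) => c n z w p p' far cz cw np np'.
have [i lc] := level_ex c; have [j lz] := level_ex z; have [k lw] := level_ex w.
have [a lp] := level_ex p; have [b lp'] := level_ex p'.
have h1 := level_ball lc lz far cz; have h2 := level_ball lc lw far cw.
have h3 := level_nearest lz np lp; have h4 := level_nearest lw np' lp'.
have h5 := near_level np.1 lp; have h6 := near_level np'.1 lp'.
have h7 : `|a - b|%N <= 4 * (2 * C + 2) by lia.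
have h8 : d (orb a) (orb b) <= 4 * (2 * C + 2) * D.
  by apply: leq_trans (orb_dist _ _) _; rewrite leq_mul2r h7 orbT.
have := distn_tri hX p (orb a) p'; have := distn_tri hX (orb a) (orb b) p'.
rewrite (distn_sym hX (orb b)); move: h5 h6 h8.
move: (c1 + c1 * D) (4 * _ * D) (d p p') (d p (orb a)) (d (orb a) p').
by move: (d (orb a) (orb b)) (d p' (orb b)); clear; lia.
Qed.

End Contracting.

Lemma between_trans u v t w : between u v w -> between v t w -> between u t w.
Proof.
rewrite /between => h1 h2; have := distn_tri hX u v t; have := distn_tri hX u t w; lia.
Qed.

Lemma between_at u w k : k <= d u w -> exists2 v, between u v w & d u v = k.
Proof.
elim: k => [_|k IH kd]; first by exists u; rewrite ?/between distn0.
have [v b e'] := IH (ltnW kd).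
have [n dn] : exists n, d v w = n.+1.
  by exists (d v w).-1; move: b; rewrite /between e'; lia.
have [v' vv' dv'] := distn_step hX dn.
have b' : between v v' w by rewrite /between (distn_adj hX vv') dv' dn.
have b2 := between_trans b b'; exists v' => //.
by move: b b2; rewrite /between dn dv' e'; lia.
Qed.

Section WellSeparating.
Variables (k c1 : nat) (Y : set X).
Hypothesis k1 : 0 < k.
Hypothesis con : contracts k Y.
Hypothesis Yorb : forall i, Y (orb i).
Hypothesis Yco : forall p, Y p -> exists i, d p (orb i) <= c1.

Let Y0 : Y !=set0. Proof. by exists (orb 0). Qed.
Let D := d q (h q).

(** A path staying at distance more than [r] from [Y] is cut into pieces of length
    [r], each contained in a ball disjoint from [Y]. *)
Lemma far_travel r n u w p p' : 0 < r -> d u w = n ->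
  (forall v, between u v w -> forall y, Y y -> r < d v y) ->
  nearest Y u p -> nearest Y w p' -> d p p' * r <= k * (n + r).
Proof.
move=> r0; elim/ltn_ind: n u p => n IH u p dn far np np'.
have fu : forall y, Y y -> r < d u y by apply: far; rewrite /between distn0.
have [nr|nr] := leqP n r.
  have : d p p' <= k by apply: (con fu _ _ np np'); rewrite ?distn0 ?dn.
  by move=> h1; apply: leq_trans (leq_mul h1 (leqnn r)) _; rewrite leq_mul2l leq_addl orbT.
have [|v bv dv] := @between_at u w r; first by rewrite dn ltnW.
have [p2 np2] := nearestE v Y0.
have h1 : d p p2 <= k by apply: (con fu _ _ np np2); rewrite ?distn0 ?dv.
have dvw : d v w = n - r by move: bv; rewrite /between dv dn; lia.
have h2 : d p2 p' * r <= k * (n - r + r).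
  apply: (IH (n - r) _ v) => //; first by lia.
  by move=> t bt; apply: far; exact: between_trans bv bt.
rewrite subnK ?(ltnW nr) // in h2.
apply: leq_trans (leq_mul (distn_tri hX p p2 p') (leqnn r)) _.
rewrite mulnDl mulnDr addnC; apply: leq_add => //; exact: leq_mul.
Qed.

Fact travel_arith (x n l : nat) : x * (2 * k) <= k * (n - l + 2 * k) ->
  n <= l + 1 + k + x + 2 * k + 1 -> x <= 5 * k + 2.
Proof.
move=> h1; have : x * 2 <= n - l + 2 * k.
  by rewrite -(leq_pmul2l k1) mulnCA (mulnC k 2).
by clear; lia.
Qed.

(** Let [w] be the first vertex, on geodesics from [u] to [y], within [2 * k + 1] of
    [Y]. Up to [u'], the last point in the largest ball around [u] disjoint from
    [Y], the projection moves by at most [k]. Beyond it, [far_travel] with [r = 2 * k]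
    says that the projection moves at most half as fast as the path; as the path
    from [u] to [w] is a geodesic, this motion is bounded. *)
Lemma geodesic_near u p y : nearest Y u p -> Y y ->
  exists2 w, between u w y & d w p <= 8 * k + 3.
Proof.
move=> np Yy.
pose P n := exists w y', [/\ between u w y, d u w = n, Y y' & d w y' <= 2 * k + 1].
have ex : exists n, `[< P n >].
  exists (d u y); apply/asboolP; exists y, y; split=> //; last by rewrite distn0.
  by rewrite /between distn0 // addn0.
case: (ex_minnP ex) => n /asboolP [w [y' [bw dw Yy' dwy']]] mn.
exists w => //; case: n dw mn => [|n] dw mn.
  have eu := distn_eq0 hX dw; rewrite -eu in dwy' *; have := np.2 _ Yy'; lia.
have mn' v : between u v w -> d u v < n.+1 -> forall y2, Y y2 -> 2 * k + 1 < d v y2.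
  move=> bv dv y2 Yy2; rewrite ltnNge; apply/negP => le.
  have : n.+1 <= d u v; last by lia.
  apply: mn; apply/asboolP; exists v, y2; split=> //.
  move: bv bw; rewrite /between; have := distn_tri hX v w y; have := distn_tri hX u v y; lia.
have far v : between u v w -> forall y2, Y y2 -> 2 * k < d v y2.
  move=> bv y2 Yy2; have [|dv] := ltnP (d u v) n.+1; first by move/(mn' _ bv)/(_ _ Yy2); lia.
  have ev : v = w by apply: (distn_eq0 hX); move: bv; rewrite /between dw; lia.
  have [|v' bv' dv'] := @between_at u w n; first by rewrite dw.
  have := mn' _ bv' _ _ Yy2; rewrite dv' ltnSn => /(_ isT).
  have := distn_tri hX v' w y2; move: bv'; rewrite /between dv' dw ev; lia.
have [q' nq'] := nearestE w Y0; have dq' := leq_trans (nq'.2 _ Yy') dwy'.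
have tw : d w p <= d w q' + d q' p := distn_tri hX _ _ _.
have [lt|ge] := ltnP n.+1 (d u p).
  have : d p q' <= k.
    apply: (con (c := u) (n := n.+1) _ _ _ np nq'); rewrite ?distn0 ?dw //.
    by move=> y2 /np.2; lia.
  by rewrite distn_sym //; lia.
have l0 : 0 < d u p.
  have := far u _ _ np.1; rewrite /between distn0 // add0n => /(_ erefl); lia.
have [|u' bu' du'] := @between_at u w (d u p).-1; first by rewrite dw; lia.
have [p2 np2] := nearestE u' Y0.
have h1 : d p p2 <= k.
  apply: (con (c := u) (n := (d u p).-1) _ _ _ np np2); rewrite ?distn0 ?du' //.
  by move=> y2 /np.2; lia.
have h2 : d p2 q' * (2 * k) <= k * (d u' w + 2 * k).
  apply: far_travel np2 nq'; rewrite ?muln_gt0 ?k1 //.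
  by move=> v bv; apply: far; exact: between_trans bu' bv.
have e1 : d u' w = n.+1 - (d u p).-1 by move: bu'; rewrite /between du' dw; lia.
rewrite e1 in h2.
have h3 : d p2 q' <= 5 * k + 2.
  apply: travel_arith h2 _; rewrite -dw.
  have := distn_tri hX u p w; have := distn_tri hX p p2 w; have := distn_tri hX p2 q' w.
  by rewrite (distn_sym hX q' w); lia.
have := distn_tri hX q' p2 p; rewrite (distn_sym hX q' p2) (distn_sym hX p2 p).
lia.
Qed.

(** Levels are constant on the interval between [u] and the orbit point at the
    same level, and that interval passes near [p]. *)
Lemma level_proj i j u p : level i u -> nearest Y u p -> level j p ->
  `|i - j|%N <= 8 * k + 3.
Proof.
move=> lu np lp; have [w bw dw] := geodesic_near np (Yorb i).
by apply: level_near lp dw; exact: level_between bw lu (level_orb i).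
Qed.

(** Three pairwise opposite hyperplanes form a facing triple. *)
Definition opposite H H' : bool :=
  `[< forall z, ~ (side H z = ~~ side H q /\ side H' z = ~~ side H' q) >].

Lemma opposite_sym : symmetric opposite.
Proof.
by move=> H H'; apply/asboolP/asboolP => n z [? ?]; apply: (n z).
Qed.

(** Suppose that a large family without facing triples crosses [trans 1] and
    [trans m]. By Ramsey's theorem, [N] of its hyperplanes are pairwise not
    opposite, and by Helly's theorem there are points [a] and [b] beyond all of
    them, on the near side of [trans 1] and on the far side of [trans m]. The
    medians [u] and [v] of [a], [b] and an orbit point lie beyond the [N]
    hyperplanes as well, at levels [0] and [m], and are as close to each other as
    the two orbit points. For large [N] the point [u] is far from [Y], so contraction
    makes their projections close; but these have levels near [0] and [m]. *)
Lemma contracts_ws : exists M L, 0 < M /\ well_separated L (trans 1) (trans (1 + M%:Z)%R).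
Proof.
pose M := k + 2 * (8 * k + 3); pose m : int := (1 + M%:Z)%R.
pose rho := M.+1 * D; pose N := (rho + c1 + (rho + c1) * D).+1.
have [L hL] := ramsey 3 N; exists M, L; split; first by rewrite /M addn_gt0 k1.
apply: (ws_intro hX (trans_hyp _) (trans_hyp _)).
- by move=> /trans_inj; rewrite /M; clear -k1; lia.
- by apply: trans_disjoint; rewrite /M; clear; lia.
move=> s us cs nf; rewrite leqNgt; apply/negP => /ltnW /(hL _ opposite s opposite_sym us).
case=> [[t [st t3 ot]]|[t [st tN ot]]].
  have ut := subseq_uniq st us; have sub := mem_subseq st.
  case: t st t3 ot ut sub => [|H1 [|H2 [|H3 [|]]]] // st _ ot ut sub.
  have m1 : H1 \in [:: H1; H2; H3] by rewrite !in_cons eqxx.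
  have m2 : H2 \in [:: H1; H2; H3] by rewrite !in_cons eqxx orbT.
  have m3 : H3 \in [:: H1; H2; H3] by rewrite !in_cons eqxx !orbT.
  move: ut; rewrite /= !inE negb_or => /andP[/andP[/eqP n12 /eqP n13] /andP[/eqP n23 _]].
  apply: (nf H1 H2 H3 (sub _ m1) (sub _ m2) (sub _ m3)).
  have hh H : H \in [:: H1; H2; H3] -> hyperplane H.
    by move=> /sub/cs [] /cross_hyp.
  apply: (facing_intro hX (hh _ m1) (hh _ m2) (hh _ m3) n12 n13 n23);
    by apply/asboolP; apply: ot.
have sub := mem_subseq st.
have beyond i : (i = 1%R \/ i = m) -> forall f, exists z, deep i z = f /\
    forall H, H \in t -> side H z = ~~ side H q.
  move=> hi f; pose S H := [set z | side H z = ~~ side H q].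
  have ci H : H \in t -> cross H (trans i) by move=> /sub/cs []; case: hi => ->.
  have onto : exists z, deep i z = f.
    case: f; first by exists (orb i); case: (level_orb i).
    by exists (orb (i - 1)%R); have [_ /negbTE] := level_orb (i - 1)%R; rewrite subrK.
  have [z hz] : exists z, forall A, A \in [set z | deep i z = f] :: [seq S H | H <- t] -> A z.
    apply: (helly hX) => // [A|A B].
      rewrite in_cons => /orP[/eqP ->|/mapP [H _ ->]]; last exact: side_convex.
      by move=> a b w /= ha hb bt; rewrite (deep_between bt) ha // hb.
    have meet H : H \in t -> [set z | deep i z = f] `&` S H !=set0.
      move=> Ht; have [z [z1 z2]] := (cross_deep _ _).2 (ci _ Ht) (~~ side H q) f.
      by exists z.
    rewrite !in_cons => /orP[/eqP ->|/mapP [H hH ->]] /orP[/eqP ->|/mapP [H' hH' ->]].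
    - by have [z hz] := onto; exists z.
    - exact: meet.
    - by rewrite setIC; exact: meet.
    have [<-|/eqP ne] := eqVneq H H'.
      by have [z hz] := side_onto hX (~~ side H q) (cross_hyp (ci _ hH)); exists z.
    have /asboolPn/existsNP [z /contrapT [z1 z2]] := ot _ _ hH hH' ne.
    by exists z.
  exists z; split; first by apply: (hz [set z | deep i z = f]); rewrite in_cons eqxx.
  by move=> H Ht; apply: (hz (S H)); rewrite in_cons map_f ?orbT.
have [a [da ha]] := beyond 1%R (or_introl erefl) false.
have [b [db hb]] := beyond m (or_intror erefl) true.
pose u := med hX a b (orb 0); pose v := med hX a b (orb m).
have nda i : (1 <= i)%R -> deep i a = false.
  by move=> hi; apply: contraFF da; exact: deep_le.
have pdb i : (i <= m)%R -> deep i b by move=> hi; exact: deep_le db.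
have m1 : (1 <= m)%R by rewrite /m; clear; lia.
have [o0 o1] := level_orb 0%R; have [o2 o3] := level_orb m.
have lu : level 0%R u.
  split; rewrite /u deep_med.
    by rewrite o0 pdb ?/maj ?orbT // /m; clear; lia.
  by rewrite add0r /maj nda // (negbTE o1) !andbF.
have lv : level m v.
  split; rewrite /v deep_med.
    by rewrite o2 db /maj andbT orbT.
  by rewrite (negbTE o3) nda /maj ?andbF // /m; clear; lia.
have duv : d u v <= rho.
  have : d u v <= d (orb 0) (orb m).
    rewrite -(size_walls hX u v); apply: (distn_ge hX (walls_uniq hX _ _)) => H.
    rewrite mem_walls !side_med /maj.
    by case: (side H a) (side H b) (side H (orb 0)) (side H (orb m)) => [] [] [] [].
  move=> h1; apply: leq_trans h1 _; apply: leq_trans (orb_dist _ _) _.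
  by rewrite /rho /D leq_mul2r; apply/orP; right; rewrite /m; clear; lia.
have far y : Y y -> rho < d u y.
  move=> Yy; rewrite ltnNge; apply/negP => le.
  have dN : N <= d u (orb 0).
    rewrite -tN; apply: (distn_ge hX (subseq_uniq st us)) => H Ht.
    rewrite side_med ha // hb // [orb 0]/orb /= /maj.
    by case: (side H q).
  have [i di] := Yco Yy.
  have dui : d u (orb i) <= rho + c1 by apply: leq_trans (distn_tri hX _ y _) (leq_add le di).
  have li := level_near lu (level_orb i) dui.
  have d0i : d (orb i) (orb 0) <= (rho + c1) * D.
    by apply: leq_trans (orb_dist _ _) _; rewrite leq_mul2r distnC li orbT.
  have := leq_trans dN (distn_tri hX u (orb i) (orb 0)).
  by rewrite /N ltnNge leq_add.
have [p np] := nearestE u Y0; have [p' np'] := nearestE v Y0.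
have dp : d p p' <= k by apply: (con far _ duv np np'); rewrite distn0.
have [i lp] := level_ex p; have [j lp'] := level_ex p'.
have h1 := level_proj lu np lp; have h2 := level_proj lv np' lp'.
have h3 := level_near lp lp' dp.
by move: h1 h2 h3; rewrite /m /M; clear; lia.
Qed.

End WellSeparating.
End Skewer.

(** * Finding a skewered halfspace *)

Section Skewering.
Variable X : cube_complex.
Hypothesis hX : CAT0 X.
Implicit Types (x y z u v w : X) (H K J : set (set X)) (g h : isom X).
Local Notation d := (@distn X).

Lemma isom_powM g (k i : int) x : isom_pow (pow_isom g k) i x = isom_pow g (k * i)%R x.
Proof.
elim/int_rec: i => [|m IH|m IH]; first by rewrite mulr0.
  have -> : (m.+1%:Z = m%:Z + 1)%R by lia.
  by rewrite isom_powS pow_isomE IH -isom_powD mulrDr mulr1 addrC.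
have -> : (- m.+1%:Z = - m%:Z - 1)%R by lia.
rewrite isom_powN1 IH; apply: (can_inj (isom_funK (pow_isom g k))).
by rewrite isom_invK pow_isomE -isom_powD mulrBr mulr1 addrCA subrr addr0.
Qed.

Lemma pow_distn g x (s t : int) : d (isom_pow g s x) (isom_pow g t x) <= `|s - t|%N * d x (g x).
Proof.
have H n (i : int) : d (isom_pow g i x) (isom_pow g (i + n%:Z)%R x) <= n * d x (g x).
  elim: n => [|n IH]; first by rewrite addr0 distn0.
  apply: leq_trans (distn_tri hX _ (isom_pow g (i + n%:Z)%R x) _) _; rewrite mulSn addnC.
  apply: leq_add IH; have -> : (i + n.+1%:Z)%R = ((i + n%:Z) + 1)%R by lia.
  rewrite (isom_powD g (i + n%:Z)%R 1%R x); have -> : isom_pow g 1 x = g x by [].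
  by rewrite -!pow_isomE distn_image.
case: (lerP s t) => st.
  have E : t = (s + `|s - t|%N%:Z)%R by lia.
  by rewrite {1}E; exact: H.
have E : s = (t + `|s - t|%N%:Z)%R by lia.
by rewrite (distn_sym hX) {1}E; exact: H.
Qed.

Lemma side_pow g (k : int) H u v :
  (side (imgw (isom_pow g k) H) (isom_pow g k u) ==
   side (imgw (isom_pow g k) H) (isom_pow g k v)) = (side H u == side H v).
Proof. by rewrite -(pow_isom_fun g k) side_image. Qed.

Lemma imgw_pow g (i j : int) H :
  imgw (isom_pow g i) (imgw (isom_pow g j) H) = imgw (isom_pow g (i + j)%R) H.
Proof.
rewrite imgw_comp; congr (imgw _ H); apply/funext => z.
by rewrite [LHS]/comp isom_powD.
Qed.

Lemma imgw_pow0 g H : imgw (isom_pow g 0) H = H.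
Proof. exact: imgw_id. Qed.

(** Every hyperplane separating [x] from a point of its orbit is a translate of one
    of the [d x (g x)] hyperplanes separating [x] from [g x]. By the pigeonhole
    principle, two hyperplanes of [F] are translates of the same one with the same
    orientation, and being disjoint they are nested. *)
Lemma pigeonhole g x n (F : seq (set (set X))) :
  uniq F -> (forall H, H \in F -> side H x != side H (isom_pow g n%:Z x)) ->
  (forall H K, H \in F -> K \in F -> H <> K -> ~ cross H K) ->
  2 * d x (g x) < size F ->
  exists J J' (k : int) e, [/\ J \in F, J' \in F, J <> J',
    J' = imgw (isom_pow g k) J & skewers (pow_isom g k) J e].
Proof.
move=> uF sF nF sz; set y := isom_pow g n%:Z x.
pose jump H (i : nat) := side H (isom_pow g i%:Z x) != side H (isom_pow g i.+1%:Z x).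
(* [f H] is the first step of the orbit that crosses [H]; [code H] records the
   hyperplane separating [x] from [g x] that [H] is a translate of, and whether
   [x] is on the same side of [H] as the starting point of that step. *)
pose f H := find (jump H) (iota 0 n).
have fP H : H \in F -> jump H (f H).
  move=> HF; have hs : has (jump H) (iota 0 n).
    apply: contraT => /hasPn nj; have := sF _ HF.
    have -> : side H x = side H (isom_pow g n%:Z x); last by rewrite eqxx.
    suff st m : m <= n -> side H x = side H (isom_pow g m%:Z x) by exact: st.
    elim: m => [//|m IH] mn; rewrite IH; last exact: ltnW.
    by have := nj m; rewrite mem_iota mn /jump negbK => /(_ isT)/eqP.
  have := nth_find 0 hs; rewrite nth_iota //.
  by move: hs; rewrite has_find size_iota.
pose code H := (imgw (isom_pow g (- (f H)%:Z)%R) H,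
                side H x == side H (isom_pow g (f H)%:Z x)).
have [H [K [HF KF HK cHK]]] : exists H K, [/\ H \in F, K \in F, H <> K & code H = code K].
  apply: contra_notP (negP _ : ~ (size F <= 2 * d x (g x))); last by rewrite -ltnNge.
  move=> nc; pose W := [seq (a, b) | a <- walls hX x (g x), b <- [:: true; false]].
  have -> : 2 * d x (g x) = size W by rewrite size_allpairs size_walls mulnC.
  rewrite -(size_map code); apply: uniq_leq_size.
    rewrite map_inj_in_uniq // => H K HF KF E; apply: contrapT => ne.
    by apply: nc; exists H, K.
  move=> _ /mapP [H HF ->]; apply/allpairsP.
  exists (code H); split; [|by case: (code H).2; rewrite !in_cons eqxx ?orbT|by case: (code H)].
  rewrite mem_walls /code /=.
  have := side_pow g (- (f H)%:Z)%R H (isom_pow g (f H)%:Z x) (isom_pow g (f H).+1%:Z x).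
  rewrite -!isom_powD addNr (_ : (- (f H)%:Z + (f H).+1%:Z)%R = 1%R); last by clear; lia.
  by move=> ->; exact: fP.
pose k : int := ((f K)%:Z - (f H)%:Z)%R.
have eK : K = imgw (isom_pow g k) H.
  case: cHK => E _.
  have E' : imgw (isom_pow g (f K)%:Z) (imgw (isom_pow g (- (f K)%:Z)%R) K) = K.
    by rewrite imgw_pow subrr imgw_pow0.
  by rewrite -{1}E' -E imgw_pow.
have sk u v : (side K (isom_pow g k u) == side K (isom_pow g k v)) = (side H u == side H v).
  by rewrite eK side_pow.
have sH := sF _ HF; have sK := sF _ KF.
have far z : (side K (isom_pow g k z) == side K y) = (side H z == side H y).
  case: cHK => _; have := sk z (isom_pow g (f H)%:Z x).
  have -> : isom_pow g k (isom_pow g (f H)%:Z x) = isom_pow g (f K)%:Z x.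
    by rewrite -isom_powD /k subrK.
  move: sH sK; rewrite -/y; case: (side K x) (side H x) (side K y) (side H y) => [] [] [] [] // _ _;
  by case: (side K _) (side K _) (side H _) (side H _) => [] [] [] [].
have [nst|nst] := nested sH sK (nF _ _ HF KF HK).
  exists K, H, (- k)%R, (side K y); split=> //; first exact: nesym.
    by rewrite eK imgw_pow addNr imgw_pow0.
  move=> z; set w := isom_inv _ z => hw.
  have ez : isom_pow g (- k)%R w = z by rewrite -pow_isomE isom_invK.
  apply: nst; apply/eqP; rewrite -far -ez -isom_powD subrr; exact/eqP.
exists H, K, k, (side H y); split=> // z; set w := isom_inv _ z => hw.
have ez : isom_pow g k w = z by rewrite -pow_isomE isom_invK.
by apply: nst; apply/eqP; rewrite -ez far; exact/eqP.
Qed.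

(** The base point has some level [a]; the [a]-th translate of the halfspace is the
    required one. *)
Lemma normalize h J e x : skewers h J e -> hyperplane J -> J <> imgw h J ->
  exists J2 e2, [/\ skewers h J2 e2, deep h J2 e2 0 x, ~~ deep h J2 e2 1 x
    & forall L, well_separated L J (imgw h J) ->
        well_separated L (trans h J2 0) (trans h J2 1)].
Proof.
move=> sk hJ ne.
have t0 : trans h J 0 = J by rewrite /trans imgw_id.
have t1 : trans h J 1 = imgw h J by [].
have [q [q0 q1]] : exists q, deep h J e 0 q /\ ~~ deep h J e 1 q.
  have [a Ca _] := carrier_ex hX true hJ.
  have [b ab sab] := (carrierP hX a hJ).1 Ca.
  have A : across J a b by apply/(acrossP hX).
  apply: contra_notP ne => nq.
  have dE z : deep h J e 0 z = deep h J e 1 z.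
    apply/idP/idP => [dz|]; last exact: deep_le.
    by apply: contraT => ndz; case: nq; exists z.
  have := side_trans hX h J e 1 a b; have := side_trans hX h J e 0 a b.
  rewrite !dE t0 t1 (negbTE sab) => <- /negbT; rewrite A => /eqP ->.
  by [].
have [a [a0 a1]] := level_ex hX sk q0 q1 x.
pose J2 := trans h J a; pose e2 := side J2 x; exists J2, e2.
have dE i z : deep h J2 e2 i z = deep h J e (a + i)%R z.
  rewrite {1}/deep /e2 /J2 (side_trans hX h J e) a0 deep_pow opprK.
  by case: deep.
split; last first.
- have tE i : trans h J2 i = trans h J (a + i)%R by rewrite addrC -trans_pow.
  by move=> L; rewrite !tE -t1 -{1}t0; exact: (ws_shift hX q0 q1).
- by rewrite dE.
- by rewrite dE addr0.
move=> z hz; have d1 : deep h J2 e2 1 z by apply/eqP.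
suff /eqP : deep h J2 e2 0 z by [].
rewrite dE; rewrite dE in d1; apply: (deep_le sk) d1; lia.
Qed.

End Skewering.

(** * Contracting orbits *)

Section Orbits.
Variable R : realType.
Variable X : cube_complex.
Hypothesis hX : CAT0 X.
Implicit Types (x y z u v w p : X) (H K J : set (set X)) (g h : isom X).
Local Notation d := (@distn X).

Definition orbit g x : set X := range (fun n : int => isom_pow g n x).

Lemma orb_pow g x (k i : int) : orb (pow_isom g k) x i = isom_pow g (k * i)%R x.
Proof. exact: isom_powM. Qed.

Lemma orbit_orb g x k i : orbit g x (orb (pow_isom g k) x i).
Proof. by rewrite orb_pow; exists (k * i)%R. Qed.

Lemma near_orbit g x (k t : int) : k != 0%R ->
  d (isom_pow g t x) (orb (pow_isom g k) x (t %/ k)%Z) <= `|k|%N * d x (g x).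
Proof.
move=> k0; rewrite orb_pow; apply: leq_trans (pow_distn hX _ _ _ _) _.
rewrite leq_mul2r; apply/orP; right.
have := divz_eq t k; have := modz_ge0 t k0; have := ltz_mod t k0.
by rewrite [(k * _)%R]mulrC; clear; lia.
Qed.

Lemma orbit_co g x k : k != 0%R -> forall p, orbit g x p ->
  exists i, d p (orb (pow_isom g k) x i) <= `|k|%N * d x (g x).
Proof. by move=> k0 p [t _ <-]; exists (t %/ k)%Z; exact: near_orbit. Qed.

(** The orbit of [g] stays at bounded distance from the orbit of [g ^ k]. *)
Lemma orbit_linear (rho : X -> X -> nat) g x k M : k != 0%R ->
  (forall u v, rho u v <= d u v) -> (forall u v w, rho u w <= rho u v + rho v w) ->
  (forall i, `|i|%N <= M * rho x (orb (pow_isom g k) x i) + M) ->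
  exists a b, forall t, `|t|%N <= a * rho x (isom_pow g t x) + b.
Proof.
move=> k0 rd tri lin; set c := `|k|%N * d x (g x).
exists (`|k|%N * M), (`|k|%N * (M * c + M) + `|k|%N) => t.
set i := (t %/ k)%Z; have h1 := lin i.
have h2 : rho x (orb (pow_isom g k) x i) <= rho x (isom_pow g t x) + c.
  apply: leq_trans (tri _ (isom_pow g t x) _) _; rewrite leq_add2l.
  by apply: leq_trans (rd _ _) _; exact: near_orbit.
have h3 : `|t|%N <= `|k|%N * `|i|%N + `|k|%N.
  have := divz_eq t k; have := modz_ge0 t k0; have := ltz_mod t k0; rewrite -/i -abszM mulrC.
  by clear; lia.
apply: leq_trans h3 _; rewrite addnA leq_add2r -mulnA -mulnDr leq_mul2l; apply/orP; right.
apply: leq_trans h1 _; rewrite addnA -mulnDr leq_add2r leq_mul2l h2 orbT.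
by [].
Qed.

Lemma orbit_qi (rho : X -> X -> nat) g x :
  (forall u v, rho u v <= d u v) -> (forall h u v, rho (h u) (h v) = rho u v) ->
  (exists a b, forall t, `|t|%N <= a * rho x (isom_pow g t x) + b) ->
  qi_embedding (@distz R) (fun u v => (rho u v)%:R : R)%R (fun n => isom_pow g n x).
Proof.
move=> rd inv [a [b lin]]; pose D := d x (g x).
exists (a + D + 1)%N%:R%R, b%:R%R; split.
- by rewrite ler1n addn1.
- exact: ler0n.
move=> m n; have -> : rho (isom_pow g m x) (isom_pow g n x) = rho x (isom_pow g (n - m)%R x).
  rewrite -[in RHS](inv (pow_isom g m)) !pow_isomE -isom_powD; congr (rho _ (isom_pow g _ x)).
  by clear; lia.
have -> : (distz R m n = (`|n - m|%N)%:R)%R.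
  by rewrite /distz distrC -abszE -pmulrn.
set t := (n - m)%R; have h1 := lin t.
have h2 : rho x (isom_pow g t x) <= `|t|%N * D.
  apply: leq_trans (rd _ _) _; have := pow_distn hX g x 0%R t.
  by rewrite sub0r abszN.
apply/andP; split.
  rewrite lerBlDr mulrC ler_pdivrMr ?ltr0n ?addn1 // -natrD -natrM ler_nat.
  apply: leq_trans h1 _; rewrite mulnDl; apply: leq_add; first by rewrite mulnC leq_mul //; clear; lia.
  by rewrite -addnS -[X in X <= _]muln1 leq_mul // addnS.
rewrite -natrM -natrD ler_nat; apply: leq_trans h2 _.
by rewrite mulnC; apply: leq_trans (leq_addr _ _); rewrite leq_mul2r; apply/orP; right; clear; lia.
Qed.

Lemma contracts_contracting k (Y : set X) : contracts k Y -> contracting (@dist R X) Y.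
Proof.
move=> con; exists k%:R%R => // B [[c [r ->]] dis] p p' [z hz [Yp np]] [w hw [Yp' np']].
rewrite ler_nat; apply: (con c (maxn (d c z) (d c w)) z w).
- move=> y Yy; rewrite gtn_max -!(ltr_nat R) -/(dist R c y).
  have : ~ [set y | (dist R c y <= r)%R] y by move=> hy; rewrite -[False]/(set0 y) -dis.
  by move=> /negP; rewrite /= -ltNge => ry; rewrite !(le_lt_trans _ ry).
- exact: leq_maxl.
- exact: leq_maxr.
- by split=> // y /np; rewrite ler_nat.
- by split=> // y /np'; rewrite ler_nat.
Qed.

Lemma contracting_contracts (Y : set X) : contracting (@dist R X) Y ->
  exists2 k, 0 < k & contracts k Y.
Proof.
move=> [K K0 con]; exists (Num.Def.archi_bound K).+1 => // c n z w p p' far cz cw [Yp np] [Yp' np'].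
pose B := [set y | (dist R c y <= n%:R)%R].
have : (dist R p p' <= K)%R.
  apply: (con B).
  - split; first by exists c, n%:R%R.
    by apply/seteqP; split=> // y [By /far]; move: By; rewrite /B /= /dist ler_nat ltnNge => ->.
  - exists z; first by rewrite /B /= /dist ler_nat.
    by split=> // y /np; rewrite /dist ler_nat.
  - exists w; first by rewrite /B /= /dist ler_nat.
    by split=> // y /np'; rewrite /dist ler_nat.
move=> le; have := le_lt_trans le (archi_boundP K0); rewrite /dist ltr_nat => lt.
exact: leq_trans (ltnW lt) (leqnSn _).
Qed.

(** By [pigeonhole], a power of [g] maps a halfspace into itself, the hyperplane and
    its image being well-separated; then [skewer_contracts] applies. *)
Lemma far_contracting L g x n :
  2 * d x (g x) < deltan L x (isom_pow g n%:Z x) -> contracting_isom R g.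
Proof.
have [F [uF sF wF] <-] := deltan_ex hX L x (isom_pow g n%:Z x) => sz.
have hF H : H \in F -> hyperplane H by move=> /sF/side_hyp.
have nF H K : H \in F -> K \in F -> H <> K -> ~ cross H K.
  by move=> HF KF ne; have [] := ws_disjoint hX (hF _ HF) (hF _ KF) (wF _ _ HF KF ne).
have [J [J' [k [e [JF J'F ne eJ sk]]]]] := pigeonhole hX uF sF nF sz.
have k0 : k != 0%R by apply/eqP => k0; apply: ne; rewrite eJ k0 imgw_pow0.
have hJ := hF _ JF.
have eJ' : J' = imgw (pow_isom g k) J by rewrite pow_isom_fun.
rewrite eJ' in ne J'F.
have [J2 [e2 [sk2 b0 b1 ws2]]] := normalize hX x sk hJ ne.
have ws := ws2 _ (wF _ _ JF J'F ne).
have co := @orbit_co g x k k0.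
exists x; split.
  apply: (@orbit_qi d) => //; first by move=> h u v; exact: distn_image.
  apply: (@orbit_linear d g x k 1 k0) => //; first exact: distn_tri.
  move=> i; rewrite mul1n; apply: leq_trans (leq_addr _ _).
  have l0 : level (pow_isom g k) J2 e2 0 x by split; rewrite ?add0r.
  have := level_near hX sk2 b0 b1 l0 (level_orb b0 b1 i) (leqnn _).
  by rewrite sub0r abszN.
have [k' con] := skewer_contracts hX sk2 b0 b1 ws (orbit_orb g x k) co.
exact: contracts_contracting con.
Qed.

Lemma ws_mono L L' J K : L <= L' -> well_separated L J K -> well_separated L' J K.
Proof.
move=> le [dis ws]; split=> // F hF nf; apply: card_le_trans (ws F hF nf) _.
by rewrite card_le_II.
Qed.

(** Far along the orbit, many hyperplanes are crossed; by Ramsey's theorem and the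
    bound on the number of edges at a vertex, many of them are pairwise disjoint,
    and [pigeonhole] and [contracts_ws] apply. *)
Lemma contracting_loxodromic g : (exists k, forall x (s : seq {classic X}), uniq s ->
    (forall y, y \in s -> adj x y) -> size s <= k) ->
  contracting_isom R g -> exists L0, forall L, L0 <= L -> exists x,
  qi_embedding (@distz R) (@delta_dist R X L) (fun n => isom_pow g n x).
Proof.
move=> [deg hdeg] [x [[A [B [A1 B0 qi]]] /contracting_contracts [k k0 con]]].
have [N hN] := ramsey deg.+1 (2 * d x (g x)).+1.
have [n hn] : exists n : nat, N <= d x (isom_pow g n%:Z x).
  have A0 : (0 < A)%R by apply: lt_le_trans A1.
  exists (Num.Def.archi_bound (A * (N%:R + B)))%R.
  set n := Num.Def.archi_bound _.
  have := (qi 0%R (Posz n)).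
  have -> : (distz R 0 n = n%:R)%R by rewrite /distz sub0r normrN.
  move=> /andP[h1 _]; rewrite -(ler_nat R); apply: le_trans h1.
  rewrite lerBrDr mulrC ler_pdivlMr // mulrC.
  by apply/ltW/archi_boundP; rewrite mulr_ge0 ?addr_ge0 // ltW.
set y := isom_pow g n%:Z x in hn.
have xsym : symmetric (fun H K => `[< cross H K >]).
  by move=> H K; apply/asboolP/asboolP; exact: cross_sym.
have hn' : N <= size (walls hX x y) by rewrite size_walls.
have wsep H : H \in walls hX x y -> side H x != side H y by rewrite mem_walls.
case: (hN _ _ _ xsym (walls_uniq hX x y) hn') => -[F [sub szF FF]].
  have [p hp] : exists p, forall J, J \in F -> exists q, across J p q.
    apply: (@clique_vertex _ hX x y F) => [H /(mem_subseq sub)/wsep //|H K HF KF ne].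
    by have /asboolP := FF _ _ HF KF ne.
  pose f H : {classic X} := xget (p : {classic X}) [set q | across H p q].
  have fP H : H \in F -> across H p (f H).
    by move=> /hp ex; exact: (@xgetPex {classic X} p [set q | across H p q]).
  have : size [seq f H | H <- F] <= deg.
    apply: (hdeg p) => [|z /mapP [H HF ->]]; last by case: ((acrossP hX _ _ _).1 (fP _ HF)).
    rewrite map_inj_in_uniq; first exact: subseq_uniq sub (walls_uniq hX x y).
    move=> H K HF KF E; apply/eqP; rewrite -(fP _ KF H) -E (fP _ HF H); exact/eqP.
  by rewrite size_map szF ltnn.
have [J [J' [k' [e [JF J'F ne eJ sk]]]]] : exists J J' (k : int) e, [/\ J \in F, J' \in F, J <> J',
    J' = imgw (isom_pow g k) J & skewers (pow_isom g k) J e].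
  apply: (pigeonhole hX (subseq_uniq sub (walls_uniq hX x y)) (x := x) (n := n)).
  - by move=> H /(mem_subseq sub)/wsep.
  - by move=> H K HF KF ne; have /asboolPn := FF _ _ HF KF ne.
  - by rewrite szF.
have k0' : k' != 0%R by apply/eqP => k0'; apply: ne; rewrite eJ k0' imgw_pow0.
have hJ : hyperplane J by exact/side_hyp/wsep/(mem_subseq sub).
have eJ' : J' = imgw (pow_isom g k') J by rewrite pow_isom_fun.
rewrite eJ' in ne J'F.
have [J2 [e2 [sk2 b0 b1 _]]] := normalize hX x sk hJ ne.
have [M [L0 [M0 ws]]] := contracts_ws hX sk2 b0 b1 k0 con (orbit_orb g x k') (@orbit_co g x k' k0').
exists L0 => L le; exists x; apply: (@orbit_qi (deltan L)).
- exact: deltan_le.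
- by move=> h u v; exact: deltan_image.
apply: (@orbit_linear (deltan L) g x k' M k0').
- exact: deltan_le.
- exact: deltan_tri.
move=> i; have wsL l : well_separated L (trans (pow_isom g k') J2 l) (trans (pow_isom g k') J2 (l + M%:Z)%R).
  have := ws_shift hX b0 b1 (l - 1)%R (ws_mono le ws).
  by rewrite subrK addrA subrK.
set j := `|i|%N %/ M.
have jM : `|i|%N < M * j + M by rewrite -mulnSr mulnC ltn_ceil.
have jM' : j * M <= `|i|%N := leq_trunc_div _ _.
suff dj : j <= deltan L x (orb (pow_isom g k') x i).
  by apply: leq_trans (ltnW jM) _; rewrite leq_add2r leq_mul2l dj orbT.
have [o0 o1] := level_orb b0 b1 i; have o0' := b0; have b1' : ~~ deep (pow_isom g k') J2 e2 (0 + 1) x by rewrite add0r.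
case: (lerP 0 i) => i0.
  apply: (level_deltan hX sk2 b0 b1 M0 wsL b1'); apply: (deep_le sk2) o0.
  by move: jM' i0; clear; lia.
rewrite (deltan_sym hX); apply: (level_deltan hX sk2 b0 b1 M0 wsL o1).
by apply: (deep_le sk2) b0; move: jM' i0; clear; lia.
Qed.

End Orbits.

Local Close Scope classical_set_scope.

Theorem theorem6p52 (R : realType) (X : cube_complex) (hX : CAT0 X)
    (G : groupType) (act : G -> isom X) (hG : geometric_action act) :
  (forall L : nat, hyperbolic (@delta_dist R X L) ((9 * (L + 2))%N%:R)%R) /\
  (forall L : nat,
     nonuniformly_acylindrical (@delta_dist R X L) (fun g x => act g x)) /\
  (forall g : isom X,
     (contracting_isom R g <->
        exists L0 : nat, forall L : nat, (L0 <= L)%N ->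
          loxodromic (@delta_dist R X L) g) /\
     (~ contracting_isom R g ->
        forall L : nat, elliptic (@delta_dist R X L) g)).
Proof.
have iso L (g : isom X) : isometric (@delta_dist R X L) g.
  split; first exact: Bijective (isom_funK g) (isom_invK g).
  by move=> x y; rewrite /delta_dist deltan_image.
have ell g : ~ contracting_isom R g -> forall L, elliptic (@delta_dist R X L) g.
  move=> nc L; split=> // x; exists (2 * distn x (g x))%:R%R => m n.
  have bound (k l : int) : (k <= l)%R ->
      deltan L (isom_pow g k x) (isom_pow g l x) <= 2 * distn x (g x).
    move=> kl; rewrite leqNgt; apply/negP => lt; apply: nc.
    apply: (@far_contracting R X hX L g x `|l - k|%N).
    have E : isom_pow g l x = pow_isom g k (isom_pow g `|l - k|%N%:Z x).
      by rewrite pow_isomE -isom_powD; congr (isom_pow g _ x); lia.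
    by move: lt; rewrite E -(pow_isomE g k x) deltan_image.
  rewrite /delta_dist ler_nat; case: (lerP m n) => [/bound //|/ltW/bound].
  by rewrite deltan_sym.
split; [move=> L|split; [move=> L|move=> g; split]].
- split.
    split=> [x y|x y|x y z].
    + split=> [/eqP|->]; last by apply/eqP; rewrite pnatr_eq0; apply/eqP/deltan_eq0.
      by rewrite pnatr_eq0 => /eqP/(deltan_eq0 hX).
    + by rewrite /delta_dist deltan_sym.
    + by rewrite /delta_dist -natrD ler_nat deltan_tri.
  move=> p q r s; rewrite /delta_dist -!natrD.
  have := deltan_hyp hX L p q r s; rewrite -(ler_nat R) => h; apply: le_trans h _.
  by rewrite natrD natr_max lerD2l -(natrM R 2) ler_nat; clear; lia.
- split=> [g|eps eps0]; first exact: iso.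
  pose e := Num.Def.archi_bound eps; have he := archi_boundP eps0.
  exists (2 * e + 2)%:R%R; first exact: ler0n.
  move=> x y; rewrite ler_nat => /(acylindrical hX hG); apply: sub_finite_set => g [h1 h2].
  by split; rewrite -(ler_nat R); apply: ltW; [exact: le_lt_trans h1 he|exact: le_lt_trans h2 he].
- split.
    move=> /(contracting_loxodromic hX (degree_bound hG)) [L0 h]; exists L0 => L /h [x qi].
    by split=> //; exists x.
  move=> [L0 /(_ L0 (leqnn _)) [_ [x [A [B [A1 B0 qi]]]]]]; apply: contrapT => nc.
  have [_ /(_ x) [C hC]] := ell _ nc L0.
  have A0 : (0 < A)%R by apply: lt_le_trans A1.
  pose n := Num.Def.archi_bound (A * (`|C| + B))%R.
  have /andP[h1 _] := qi 0%R (Posz n).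
  have := le_trans h1 (hC _ _).
  have -> : (distz R 0 n = n%:R)%R by rewrite /distz sub0r normrN.
  rewrite lerBlDr mulrC ler_pdivrMr // => h2.
  have : (A * (`|C| + B) < n%:R)%R by apply: archi_boundP; rewrite mulr_ge0 ?addr_ge0 // ltW.
  have h3 : ((C + B) * A <= A * (`|C| + B))%R.
    by rewrite mulrC ler_pM2l // lerD2r ler_norm.
  by move=> /(le_lt_trans h3) /(le_lt_trans h2); rewrite ltxx.
- exact: ell.
Qed.
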